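(* Let $X$ be a complex Banach space, $E=\ell^2(\mathbb Z,X)$, and let $A\in L(E)$ have a tridiagonal matrix representation. For $n\in\mathbb N$ let $\varepsilon''_n:=2(\|\alpha\|_\infty+\|\gamma\|_\infty)\sin\frac{\pi}{2(n+1)}$. Then, for every $\varepsilon\ge 0$, $$d_H\big(\Gamma^n_{\varepsilon+\varepsilon''_n}(A),\,\mathrm{Spec}_\varepsilon A\big)\to 0\quad\text{as } n\to\infty,$$ in particular $d_H(\Gamma^n_{\varepsilon''_n}(A),\mathrm{Spec}\,A)\to 0$. If $X$ has Globevnik's property, then also, for every $\varepsilon>0$, $$d_H\big(\gamma^n_{\varepsilon+\varepsilon''_n}(A),\,\mathrm{spec}_\varepsilon A\big)\to 0\quad\text{as } n\to\infty .$$
   Context: $E=\ell^2(\mathbb Z,X)$ has norm $\|x\|=(\sum_j\|x_j\|_X^2)^{1/2}$. $A\in L(E)$ is tridiagonal: it acts as $(Ax)_i=\alpha_{i-1}x_{i-1}+\beta_ix_i+\gamma_{i+1}x_{i+1}$ with bounded sequences $\alpha,\beta,\gamma$ in $L(X)$, i.e. its matrix $[a_{i,j}]$ has $a_{j+1,j}=\alpha_j$, $a_{j,j}=\beta_j$, $a_{j-1,j}=\gamma_j$ and zeros elsewhere; $\|\alpha\|_\infty:=\sup_j\|\alpha_j\|_{L(X)}$, etc. The Banach space adjoint $A^*$ acts on $E^*=\ell^2(\mathbb Z,X^* )$ with matrix $[a_{j,i}^*]$ (so $(A-\lambda I)^*=A^*-\lambda I$). Lower norm: $\nu(B):=\inf_{\|x\|=1}\|Bx\|$.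 For $k\in\mathbb Z$, $n\in\mathbb N$, $E_{n,k}$ denotes the subspace of sequences supported in $\{k+1,\dots,k+n\}$ (in $E$, or in $E^*$ when applied to an adjoint). Define $$\mu_n(B):=\inf_{k\in\mathbb Z}\min\big(\nu(B|_{E_{n,k}}),\nu(B^*|_{E_{n,k}})\big),$$ $\gamma^n_\varepsilon(A):=\{\lambda\in\mathbb C:\mu_n(A-\lambda I)<\varepsilon\}$ for $\varepsilon>0$, and $\Gamma^n_\varepsilon(A):=\{\lambda\in\mathbb C:\mu_n(A-\lambda I)\le\varepsilon\}$ for $\varepsilon\ge0$. Pseudospectra: for $B\in L(Y)$, $Y$ a complex Banach space, with $\|C^{-1}\|:=\infty$ if $C$ is not invertible and $1/\infty:=0$, $\mathrm{Spec}_\varepsilon B:=\{\lambda:1/\|(B-\lambda I)^{-1}\|\le\varepsilon\}$ for $\varepsilon>0$ (closed), $\mathrm{Spec}_0B:=\mathrm{Spec}\,B$ (the spectrum), and $\mathrm{spec}_\varepsilon B:=\{\lambda:1/\|(B-\lambda I)^{-1}\|<\varepsilon\}$ for $\varepsilon>0$ (open). $d_H(S,T):=\max(\sup_{s\in S}\mathrm{dist}(s,T),\sup_{t\in T}\mathrm{dist}(t,S))$ for bounded non-empty $S,T\subset\mathbb C$. A Banach space $Y$ has Globevnik's property if $Y$ is finite-dimensional or $Y$ or $Y^*$ is complex uniformly convex (for every $\epsilon>0$ there is $\delta>0$ such that $\|y\|\ge\epsilon$ and $\|x+\zeta y\|\le1$ for all $|\zeta|\le1$ imply $\|x\|\le1-\delta$).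 *)

(* Defs.v *)
From HB Require Import structures.
From mathcomp Require Import all_boot all_order all_algebra.
From mathcomp Require Import all_classical all_reals all_analysis.
From mathcomp Require Import finmap complex lra.

Set Implicit Arguments.
Unset Strict Implicit.
Unset Printing Implicit Defensive.

Import Order.TTheory GRing.Theory Num.Theory.
Import numFieldNormedType.Exports.

Local Open Scope classical_set_scope.
Local Open Scope ring_scope.
Local Open Scope complex_scope.

(* The norm of a normed module over R[i] takes its (real, nonnegative) values
   in R[i]; [rnorm] reads them in R. *)
Definition rnorm (R : realType) (V : normedZmodType R[i]) (x : V) : R :=
  complex.Re `|x|.

Section rnorm_lemmas.
Context {R : realType}.

Lemma rnormE (V : normedZmodType R[i]) (x : V) : `|x| = (rnorm x)%:C.
Proof.
have := normr_ge0 x; rewrite /rnorm lecE /=.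
by case: `|x| => a b /= /andP[/eqP -> _].
Qed.

Lemma rnorm_ge0 (V : normedZmodType R[i]) (x : V) : 0 <= rnorm x.
Proof. by have := normr_ge0 x; rewrite rnormE lecR. Qed.

Lemma rnormD (V : normedZmodType R[i]) (x y : V) :
  rnorm (x + y) <= rnorm x + rnorm y.
Proof. by have := ler_normD x y; rewrite !rnormE -rmorphD lecR. Qed.

Lemma rnorm0 (V : normedZmodType R[i]) : rnorm (0 : V) = 0.
Proof. by rewrite /rnorm normr0. Qed.

Lemma rnorm0_eq0 (V : normedZmodType R[i]) (x : V) : rnorm x = 0 -> x = 0.
Proof. by move=> x0; apply/eqP; rewrite -normr_eq0 rnormE x0. Qed.

Lemma rnormZ (V : normedModType R[i]) (a : R[i]) (x : V) :
  rnorm (a *: x) = rnorm a * rnorm x.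
Proof.
by have := normrZ a x; rewrite !rnormE -rmorphM => /complexI.
Qed.

Lemma rnormV (a : R[i]) : rnorm a^-1 = (rnorm a)^-1.
Proof. by have := normfV a; rewrite !rnormE -fmorphV => /complexI. Qed.

End rnorm_lemmas.

(* The space L(U, V) of bounded linear maps, normed by the operator norm *)
Section bounded_operators.
Context {R : realType} (U V : normedModType R[i]).

Definition bounded_op : {pred U -> V} := fun f =>
  `[< linear f /\ exists M : R, forall x, rnorm (f x) <= M * rnorm x >].

Record bop := Bop { bop_fun :> U -> V ; bop_funP : bop_fun \in bounded_op }.

HB.instance Definition _ := [isSub for bop_fun].
HB.instance Definition _ := [Choice of bop by <:].

Fact bounded_op_submod : GRing.subsemimod_closed bounded_op.
Proof.
split; first split.
- apply/asboolP; split; first by move=> a x y; rewrite [RHS]addr0 [RHS]scaler0.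
  by exists 0 => x; rewrite rnorm0 mul0r.
- move=> f g /asboolP[lf [M fM]] /asboolP[lg [N gN]]; apply/asboolP; split.
    by move=> a x y; rewrite !fctE lf lg scalerDr addrACA.
  exists (M + N) => x; rewrite mulrDl (le_trans (rnormD _ _))//.
  by rewrite lerD.
- move=> a f /asboolP[lf [M fM]]; apply/asboolP; split.
    by move=> b x y; rewrite !fctE lf scalerDr !scalerA mulrC.
  exists (rnorm a * M) => x; rewrite rnormZ -mulrA.
  by rewrite ler_wpM2l ?rnorm_ge0.
Qed.

HB.instance Definition _ :=
  GRing.SubChoice_isSubLmodule.Build _ _ _ bop bounded_op_submod.

Lemma bop_ext (f g : bop) : f =1 g -> f = g.
Proof. by move=> fg; apply/val_inj/funext. Qed.

Lemma bop_linear (f : bop) : linear f.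
Proof. by case: f => f /= /asboolP[]. Qed.

Lemma bop_bounded (f : bop) :
  exists M : R, forall x, rnorm (f x) <= M * rnorm x.
Proof. by case: f => f /= /asboolP[]. Qed.

HB.instance Definition _ (f : bop) :=
  GRing.isLinear.Build R[i] U V *:%R f (bop_linear f).

Definition opnorm (f : bop) : R :=
  sup [set rnorm (f x) | x in [set x : U | rnorm x <= 1]].

Lemma opnorm_has_sup (f : bop) :
  has_sup [set rnorm (f x) | x in [set x : U | rnorm x <= 1]].
Proof.
split; first by exists (rnorm (f 0)), 0; rewrite //= rnorm0.
have [M fM] := bop_bounded f; exists (Num.max M 0) => _ [x /= x1 <-].
rewrite (le_trans (fM x))// (@le_trans _ _ (Num.max M 0 * rnorm x))//.
  by rewrite ler_wpM2r ?rnorm_ge0// le_max lexx.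
by rewrite -[leRHS]mulr1 ler_wpM2l// le_max lexx orbT.
Qed.

Lemma opnorm_ub (f : bop) x : rnorm x <= 1 -> rnorm (f x) <= opnorm f.
Proof.
by move=> x1; apply: ub_le_sup; [exact: (opnorm_has_sup f).2|exists x].
Qed.

Lemma opnorm_le (f : bop) M :
  (forall x, rnorm x <= 1 -> rnorm (f x) <= M) -> opnorm f <= M.
Proof.
move=> fM; apply: ge_sup; first exact: (opnorm_has_sup f).1.
by move=> _ [x /= x1 <-]; exact: fM.
Qed.

Lemma opnorm_ge0 (f : bop) : 0 <= opnorm f.
Proof.
by apply: le_trans (@opnorm_ub f 0 _); rewrite ?rnorm_ge0// rnorm0.
Qed.

Lemma opnormP (f : bop) x : rnorm (f x) <= opnorm f * rnorm x.
Proof.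
have [x0|x0] := eqVneq (rnorm x) 0.
  by rewrite x0 mulr0 (rnorm0_eq0 x0) linear0 rnorm0.
have xgt0 : 0 < rnorm x by rewrite lt_def x0 rnorm_ge0.
have e : rnorm ((rnorm x)^-1%:C : R[i]) = (rnorm x)^-1.
  by rewrite /rnorm ger0_norm// ler0c invr_ge0 ltW.
have := @opnorm_ub f ((rnorm x)^-1%:C *: x).
rewrite linearZ/= !rnormZ e mulVf// => /(_ (lexx _)).
by rewrite mulrC ler_pdivrMr.
Qed.

Definition opnorm_norm (f : bop) : R[i] := (opnorm f)%:C.

Fact opnorm_normD (f g : bop) :
  opnorm_norm (f + g) <= opnorm_norm f + opnorm_norm g.
Proof.
rewrite /opnorm_norm -rmorphD lecR; apply: opnorm_le => x x1.
by rewrite (le_trans (rnormD _ _))// lerD ?opnorm_ub.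
Qed.

Lemma opnormZ_le (a : R[i]) (f : bop) : opnorm (a *: f) <= rnorm a * opnorm f.
Proof.
apply: opnorm_le => x x1.
by rewrite rnormZ ler_wpM2l ?rnorm_ge0// opnorm_ub.
Qed.

Fact opnorm_normZ (a : R[i]) (f : bop) :
  opnorm_norm (a *: f) = `|a| * opnorm_norm f.
Proof.
rewrite /opnorm_norm rnormE -rmorphM; congr (_%:C).
apply/eqP; rewrite eq_le opnormZ_le /=.
have [->|a0] := eqVneq a 0; first by rewrite rnorm0 mul0r opnorm_ge0.
have ra0 : 0 < rnorm a.
  rewrite lt_def rnorm_ge0 andbT; apply: contra a0 => /eqP.
  by move/rnorm0_eq0 => ->.
have := opnormZ_le a^-1 (a *: f); rewrite scalerA mulVf// scale1r.
by rewrite rnormV ler_pdivlMl.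
Qed.

Fact opnorm_norm0_eq0 (f : bop) : opnorm_norm f = 0 -> f = 0.
Proof.
move=> /complexI f0; apply: bop_ext => x; apply: rnorm0_eq0.
by apply/eqP; rewrite eq_le rnorm_ge0 andbT (le_trans (opnormP f x))// f0 mul0r.
Qed.

HB.instance Definition _ :=
  Lmodule_isNormed.Build R[i] bop opnorm_normD opnorm_normZ opnorm_norm0_eq0.

Lemma rnorm_bop (f : bop) : rnorm f = opnorm f.
Proof. by []. Qed.

End bounded_operators.

Notation "''L' ( U , V )" := (bop U V)
  (at level 8, format "''L' ( U ,  V )") : type_scope.

Definition dual (R : realType) (V : normedModType R[i]) :
  normedModType R[i] := 'L(V, R[i]^o).

Section bop_constructions.
Context {R : realType}.

Fact id_bop_subproof (V : normedModType R[i]) :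
  (fun x : V => x) \in @bounded_op R V V.
Proof. by apply/asboolP; split => //; exists 1 => x; rewrite mul1r. Qed.

Definition id_bop (V : normedModType R[i]) : 'L(V, V) :=
  Bop (id_bop_subproof V).

Fact comp_bop_subproof (U V W : normedModType R[i])
  (g : 'L(V, W)) (f : 'L(U, V)) : g \o f \in @bounded_op R U W.
Proof.
apply/asboolP; split; first by move=> a x y; rewrite /= !linearP.
exists (opnorm g * opnorm f) => x /=.
by rewrite (le_trans (opnormP _ _))// -mulrA ler_wpM2l ?opnorm_ge0 ?opnormP.
Qed.

Definition comp_bop (U V W : normedModType R[i])
    (g : 'L(V, W)) (f : 'L(U, V)) : 'L(U, W) :=
  Bop (comp_bop_subproof g f).

Fact adjoint_subproof (U V : normedModType R[i]) (f : 'L(U, V)) :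
  (fun phi : dual V => comp_bop phi f) \in @bounded_op R (dual V) (dual U).
Proof.
apply/asboolP; split; first by move=> a phi psi; exact: bop_ext.
exists (opnorm f) => phi; rewrite !rnorm_bop.
apply: ge_sup; first by exists (rnorm (comp_bop phi f 0)), 0; rewrite //= rnorm0.
move=> _ [x /= x1 <-]; rewrite (le_trans (opnormP _ _))// mulrC.
by rewrite ler_wpM2r ?opnorm_ge0// opnorm_ub.
Qed.

Definition adjoint (U V : normedModType R[i]) (f : 'L(U, V)) :
    'L(dual V, dual U) :=
  Bop (adjoint_subproof f).

End bop_constructions.

Section ell2.
Context {R : realType} (X : normedModType R[i]).

Definition sqsum (x : int -> X) : \bar R :=
  \esum_(j in [set: int]) ((rnorm (x j)) ^+ 2)%:E.

Definition sqsummable : {pred int -> X} := fun x => (sqsum x < +oo)%E.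

Record ell2 := Ell2 { ell2_fun :> int -> X ; ell2_funP : ell2_fun \in sqsummable }.

HB.instance Definition _ := [isSub for ell2_fun].
HB.instance Definition _ := [Choice of ell2 by <:].

Lemma sqsum_ge0 (x : int -> X) : (0 <= sqsum x)%E.
Proof. by apply: esum_ge0 => j _; rewrite lee_fin sqr_ge0. Qed.

Lemma fsum_le_sqsum (x : int -> X) (F : {fset int}) :
  ((\sum_(j <- F) rnorm (x j) ^+ 2)%:E <= sqsum x)%E.
Proof.
apply: ereal_sup_ubound; exists [set` F]; first by split.
by rewrite fsbig_finite//= set_fsetK sumEFin.
Qed.

Lemma sqsum_le (x : int -> X) (M : R) :
  (forall F : {fset int}, \sum_(j <- F) rnorm (x j) ^+ 2 <= M) ->
  (sqsum x <= M%:E)%E.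
Proof.
move=> xM; apply: ge_ereal_sup => _ [A [finA _] <-].
by rewrite fsbig_finite//= sumEFin lee_fin.
Qed.

Lemma sqsummableP (x : int -> X) : reflect
  (exists2 M : R, 0 <= M & forall F : {fset int},
    \sum_(j <- F) rnorm (x j) ^+ 2 <= M ^+ 2) (x \in sqsummable).
Proof.
apply: (iffP idP) => [xoo|[M _ /sqsum_le]]; last first.
  by move=> /le_lt_trans; apply; rewrite ltry.
have xfin : sqsum x \is a fin_num by rewrite ge0_fin_numE ?sqsum_ge0.
exists (Num.sqrt (fine (sqsum x))) => // F.
by rewrite sqr_sqrtr ?fine_ge0 ?sqsum_ge0// -lee_fin fineK// fsum_le_sqsum.
Qed.

Definition ell2norm (x : ell2) : R := Num.sqrt (fine (sqsum x)).

Lemma ell2norm_ge0 (x : ell2) : 0 <= ell2norm x.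
Proof. exact: sqrtr_ge0. Qed.

Lemma sqsumE (x : ell2) : sqsum x = (ell2norm x ^+ 2)%:E.
Proof.
rewrite sqr_sqrtr ?fine_ge0 ?sqsum_ge0// fineK// ge0_fin_numE ?sqsum_ge0//.
exact: (ell2_funP x).
Qed.

Lemma ell2norm_fsum (x : ell2) (F : {fset int}) :
  \sum_(j <- F) rnorm (x j) ^+ 2 <= ell2norm x ^+ 2.
Proof. by rewrite -lee_fin -sqsumE fsum_le_sqsum. Qed.

Lemma ell2norm_le (x : ell2) (M : R) : 0 <= M ->
  (forall F : {fset int}, \sum_(j <- F) rnorm (x j) ^+ 2 <= M ^+ 2) ->
  ell2norm x <= M.
Proof.
move=> M0 /sqsum_le; rewrite sqsumE lee_fin => xM.
by rewrite -(@ler_pXn2r _ 2)// nnegrE ell2norm_ge0.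
Qed.

Lemma rnorm_ell2_coord (x : ell2) j : rnorm (x j) <= ell2norm x.
Proof.
have := ell2norm_fsum x [fset j]%fset; rewrite big_seq_fset1 => h.
by rewrite -(@ler_pXn2r _ 2)// nnegrE ?ell2norm_ge0 ?rnorm_ge0.
Qed.

Lemma fsumD_le (x y : int -> X) (F : {fset int}) (a b : R) :
  0 <= a -> 0 <= b ->
  \sum_(j <- F) rnorm (x j) ^+ 2 <= a ^+ 2 ->
  \sum_(j <- F) rnorm (y j) ^+ 2 <= b ^+ 2 ->
  \sum_(j <- F) rnorm (x j + y j) ^+ 2 <= (a + b) ^+ 2.
Proof.
move=> a0 b0 xa yb.
have coord0 (z : int -> X) : \sum_(j <- F) rnorm (z j) ^+ 2 <= 0 ->
    forall j, j \in F -> z j = 0.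
  move=> z0 j jF; apply: rnorm0_eq0; apply/eqP; rewrite -sqrf_eq0 eq_le sqr_ge0.
  rewrite andbT (le_trans _ z0)// (big_fsetD1 j)//= lerDl.
  by apply: sumr_ge0 => i _; rewrite sqr_ge0.
have [a_eq0|a_neq0] := eqVneq a 0.
  rewrite a_eq0 add0r; move: xa; rewrite a_eq0 expr0n => /coord0 x0.
  rewrite (le_trans _ yb)// le_eqVlt; apply/orP; left; apply/eqP.
  by rewrite !big_seq; apply: eq_bigr => j jF; rewrite x0// add0r.
have [b_eq0|b_neq0] := eqVneq b 0.
  rewrite b_eq0 addr0; move: yb; rewrite b_eq0 expr0n => /coord0 y0.
  rewrite (le_trans _ xa)// le_eqVlt; apply/orP; left; apply/eqP.
  by rewrite !big_seq; apply: eq_bigr => j jF; rewrite y0// addr0.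
have ab0 : 0 < a * b by rewrite mulr_gt0// lt_def ?a_neq0 ?b_neq0.
have cs : \sum_(j <- F) rnorm (x j) * rnorm (y j) <= a * b.
  have : \sum_(j <- F) (2 * (a * b)) * (rnorm (x j) * rnorm (y j)) <=
      \sum_(j <- F) (b ^+ 2 * rnorm (x j) ^+ 2 + a ^+ 2 * rnorm (y j) ^+ 2).
    apply: ler_sum => j _.
    have := sqr_ge0 (b * rnorm (x j) - a * rnorm (y j)); lra.
  rewrite big_split/= -!mulr_sumr => h.
  have ab20 : 0 < 2 * (a * b) by rewrite mulr_gt0.
  rewrite -(ler_pM2l ab20); apply: (le_trans h).
  have : b ^+ 2 * (\sum_(j <- F) rnorm (x j) ^+ 2) <= b ^+ 2 * a ^+ 2.
    by rewrite ler_wpM2l ?sqr_ge0.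
  have : a ^+ 2 * (\sum_(j <- F) rnorm (y j) ^+ 2) <= a ^+ 2 * b ^+ 2.
    by rewrite ler_wpM2l ?sqr_ge0.
  lra.
rewrite (@le_trans _ _ (\sum_(j <- F) (rnorm (x j) ^+ 2 +
    rnorm (y j) ^+ 2 + 2 * (rnorm (x j) * rnorm (y j)))))//.
  apply: ler_sum => j _.
  rewrite (@le_trans _ _ ((rnorm (x j) + rnorm (y j)) ^+ 2))//; last lra.
  by rewrite ler_pXn2r ?nnegrE ?rnormD ?addr_ge0 ?rnorm_ge0.
rewrite !big_split/= -mulr_sumr; lra.
Qed.

Lemma fsumZ (c : R[i]) (x : int -> X) (F : {fset int}) :
  \sum_(j <- F) rnorm (c *: x j) ^+ 2 =
  rnorm c ^+ 2 * \sum_(j <- F) rnorm (x j) ^+ 2.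
Proof.
by rewrite mulr_sumr; apply: eq_bigr => j _; rewrite rnormZ exprMn.
Qed.

Fact sqsummable_submod : GRing.subsemimod_closed sqsummable.
Proof.
split; first split.
- apply/sqsummableP; exists 0 => // F.
  by rewrite big1 ?expr0n// => j _; rewrite (_ : (0 : int -> X) j = 0)// rnorm0 expr0n.
- move=> x y /sqsummableP[a a0 xa] /sqsummableP[b b0 yb].
  by apply/sqsummableP; exists (a + b) => [|F]; [exact: addr_ge0|exact: fsumD_le].
- move=> c x /sqsummableP[a a0 xa]; apply/sqsummableP.
  exists (rnorm c * a) => [|F]; first by rewrite mulr_ge0 ?rnorm_ge0.
  by rewrite fsumZ exprMn ler_wpM2l ?sqr_ge0.
Qed.

HB.instance Definition _ :=
  GRing.SubChoice_isSubLmodule.Build _ _ _ ell2 sqsummable_submod.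

Lemma ell2_ext (x y : ell2) : x =1 y -> x = y.
Proof. by move=> xy; apply/val_inj/funext. Qed.

Definition ell2norm_norm (x : ell2) : R[i] := (ell2norm x)%:C.

Fact ell2norm_normD (x y : ell2) :
  ell2norm_norm (x + y) <= ell2norm_norm x + ell2norm_norm y.
Proof.
rewrite /ell2norm_norm -rmorphD lecR; apply: ell2norm_le => [|F].
  by rewrite addr_ge0 ?ell2norm_ge0.
by apply: fsumD_le; rewrite ?ell2norm_ge0 ?ell2norm_fsum.
Qed.

Fact ell2norm_normZ (c : R[i]) (x : ell2) :
  ell2norm_norm (c *: x) = `|c| * ell2norm_norm x.
Proof.
have le c' (z : ell2) : ell2norm (c' *: z) <= rnorm c' * ell2norm z.
  apply: ell2norm_le => [|F]; first by rewrite mulr_ge0 ?rnorm_ge0 ?ell2norm_ge0.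
  by rewrite fsumZ exprMn ler_wpM2l ?sqr_ge0 ?ell2norm_fsum.
rewrite /ell2norm_norm rnormE -rmorphM; congr (_%:C).
apply/eqP; rewrite eq_le le /=.
have [->|c0] := eqVneq c 0; first by rewrite rnorm0 mul0r ell2norm_ge0.
have rc0 : 0 < rnorm c.
  rewrite lt_def rnorm_ge0 andbT; apply: contra c0 => /eqP.
  by move/rnorm0_eq0 => ->.
have := le c^-1 (c *: x); rewrite scalerA mulVf// scale1r.
by rewrite rnormV ler_pdivlMl.
Qed.

Fact ell2norm_norm0_eq0 (x : ell2) : ell2norm_norm x = 0 -> x = 0.
Proof.
move=> /complexI x0; apply: ell2_ext => j; apply: rnorm0_eq0.
by apply/eqP; rewrite eq_le rnorm_ge0 andbT -x0 rnorm_ell2_coord.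
Qed.

HB.instance Definition _ :=
  Lmodule_isNormed.Build R[i] ell2
    ell2norm_normD ell2norm_normZ ell2norm_norm0_eq0.

Lemma rnorm_ell2 (x : ell2) : rnorm x = ell2norm x.
Proof. by []. Qed.

Definition single_fun (j : int) (v : X) : int -> X := fun i => if i == j then v else 0.

Lemma single_fsum j v (F : {fset int}) :
  \sum_(i <- F) rnorm (single_fun j v i) ^+ 2 <= rnorm v ^+ 2.
Proof.
have [jF|jF] := boolP (j \in F).
  rewrite (big_fsetD1 j)//= /single_fun eqxx big1_fset ?addr0// => i.
  by rewrite !inE => /andP[/negPf-> _] _; rewrite rnorm0 expr0n.
rewrite big1_fset ?sqr_ge0// => i iF _; rewrite /single_fun; case: eqP => [ij|_].
  by move: jF; rewrite -ij iF.
by rewrite rnorm0 expr0n.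
Qed.

Fact single_subproof j v : single_fun j v \in sqsummable.
Proof.
by apply/sqsummableP; exists (rnorm v) => [|F]; [exact: rnorm_ge0|exact: single_fsum].
Qed.

Definition single j v : ell2 := Ell2 (single_subproof j v).

Fact single_bounded_op j : single j \in @bounded_op R X ell2.
Proof.
apply/asboolP; split.
  move=> a u v; apply: ell2_ext => i; rewrite /= /single_fun !fctE/=.
  by case: eqP => // _; rewrite scaler0 addr0.
exists 1 => v; rewrite mul1r rnorm_ell2; apply: ell2norm_le => [|F].
  exact: rnorm_ge0.
exact: single_fsum.
Qed.

Definition inject (j : int) : 'L(X, ell2) := Bop (single_bounded_op j).

End ell2.

Section finite_sections.
Context {R : realType} (X : normedModType R[i]).

Definition window (n : nat) (k : int) : set int :=
  [set j | k < j <= k + n%:Z].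

Definition supp_in (W : set int) : set (ell2 X) :=
  [set x | forall j, ~ W j -> x j = 0].

(* phi corresponds to the sequence of its coordinates phi_j : X^*,
   v |-> phi (..., 0, v, 0, ...), in the identification
   ell2(Z, X)^* = ell2(Z, X^* ). *)
Definition dual_coord (phi : dual (ell2 X)) (j : int) : dual X :=
  comp_bop phi (inject X j).

Definition dual_supp_in (W : set int) : set (dual (ell2 X)) :=
  [set phi | forall j, ~ W j -> dual_coord phi j = 0].

(* the lower norm of the restriction of B to F; +oo if F has no unit vector *)
Definition lower_norm (U V : normedModType R[i]) (B : 'L(U, V)) (F : set U) :
    \bar R :=
  ereal_inf [set (rnorm (B x))%:E | x in [set x | F x /\ rnorm x = 1]].

Definition mu (n : nat) (B : 'L(ell2 X, ell2 X)) : \bar R :=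
  ereal_inf [set mine (lower_norm B (supp_in (window n k)))
                      (lower_norm (adjoint B) (dual_supp_in (window n k)))
            | k in [set: int]].

End finite_sections.

Definition shift_op (R : realType) (V : normedModType R[i])
    (B : 'L(V, V)) (lambda : R[i]) : 'L(V, V) :=
  B - lambda *: id_bop V.

Section section_sets.
Context {R : realType} (X : normedModType R[i]).
Implicit Type A : 'L(ell2 X, ell2 X).

Definition gamma_open (n : nat) (eps : R) A : set R[i] :=
  [set lambda | (mu n (shift_op A lambda) < eps%:E)%E].

Definition Gamma_closed (n : nat) (eps : R) A : set R[i] :=
  [set lambda | (mu n (shift_op A lambda) <= eps%:E)%E].

End section_sets.

Section pseudospectra.
Context {R : realType} (Y : normedModType R[i]).
Implicit Types B C D : 'L(Y, Y).

Definition is_inverse C D := comp_bop D C = id_bop Y /\ comp_bop C D = id_bop Y.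

Definition invertible C := exists D, is_inverse C D.

Definition spectrum B : set R[i] := [set lambda | ~ invertible (shift_op B lambda)].

Definition inv_norm C : \bar R :=
  if pselect (invertible C) is left h then (rnorm (projT1 (cid h)))%:E else +oo%E.

(* In \bar R, (+oo)^-1 = 0 and 0^-1 = +oo. *)
Definition Spec_closed (eps : R) B : set R[i] :=
  if eps == 0 then spectrum B
  else [set lambda | ((inv_norm (shift_op B lambda))^-1 <= eps%:E)%E].

Definition spec_open (eps : R) B : set R[i] :=
  [set lambda | ((inv_norm (shift_op B lambda))^-1 < eps%:E)%E].

End pseudospectra.

Section hausdorff_distance.
Context {R : realType}.
Implicit Types S T : set R[i].

Definition dist (s : R[i]) T : \bar R :=
  ereal_inf [set (rnorm (s - t))%:E | t in T].

(* The 0 only matters for S = T = set0, where the two suprema are -oo. *)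
Definition hausdorff_dist S T : \bar R :=
  maxe 0%E (maxe (ereal_sup [set dist s T | s in S])
                 (ereal_sup [set dist t S | t in T])).

End hausdorff_distance.

Section globevnik.
Context {R : realType}.

Definition finite_dimensional (Y : normedModType R[i]) :=
  exists (n : nat) (b : 'I_n -> Y),
    forall y, exists c : 'I_n -> R[i], y = \sum_(i < n) c i *: b i.

Definition complex_uniformly_convex (Y : normedModType R[i]) :=
  forall e : R, 0 < e -> exists2 delta : R, 0 < delta &
    forall x y : Y, e <= rnorm y ->
      (forall zeta : R[i], rnorm zeta <= 1 -> rnorm (x + zeta *: y) <= 1) ->
      rnorm x <= 1 - delta.

Definition globevnik_property (Y : normedModType R[i]) :=
  [\/ finite_dimensional Y,
      complex_uniformly_convex Y |
      complex_uniformly_convex (dual Y)].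

End globevnik.

Section tridiagonal.
Context {R : realType} (X : normedModType R[i]).

Definition bounded_seq (a : int -> 'L(X, X)) :=
  has_ubound (range (fun j => rnorm (a j))).

Definition seq_norm (a : int -> 'L(X, X)) : R :=
  sup (range (fun j => rnorm (a j))).

Definition tridiagonal (A : 'L(ell2 X, ell2 X))
    (alpha beta gamma : int -> 'L(X, X)) : Prop :=
  [/\ bounded_seq alpha, bounded_seq beta, bounded_seq gamma &
      forall (x : ell2 X) (i : int),
        A x i = alpha (i - 1) (x (i - 1)) + beta i (x i)
                + gamma (i + 1) (x (i + 1))].

Definition eps'' (alpha gamma : int -> 'L(X, X)) (n : nat) : R :=
  2 * (seq_norm alpha + seq_norm gamma) * sin (pi / (2 * n.+1%:R)).

End tridiagonal.

(* Main.v *)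
Require Import Defs.
From HB Require Import structures.
From mathcomp Require Import all_boot all_order all_algebra.
From mathcomp Require Import all_classical all_reals all_analysis.
From mathcomp Require Import complex finmap ring lra zify.

Set Implicit Arguments.
Unset Strict Implicit.
Unset Printing Implicit Defensive.

Import Order.TTheory GRing.Theory Num.Theory.
Import numFieldNormedType.Exports.

Local Open Scope classical_set_scope.
Local Open Scope ring_scope.

(* For invertible B one has 1/|B^-1| = min(nu(B), nu(B^* )), and the complement
   of a pseudospectrum is therefore described by bounding A - lambda and its
   adjoint from below ([bounded_below]).

   Localization: multiply x by the weights sin((j - k) pi/(n + 1)) supported in
   the window k+1, ..., k+n and sum the squared norms over all k. The commutator
   with A only sees the differences of consecutive weights, so a lower bound c on
   all windows gives the lower bound c - eps''_n on the whole space. The dual of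
   ell^2(Z, X) is handled by the same computation in ell^2(Z, X^* ). Hence
   Spec_eps A is contained in Gamma^n_{eps + eps''_n}(A), which is contained in
   Spec_{eps + eps''_n} A, and compactness lets the latter shrink to Spec_eps A.

   For the open sets it remains to see that spec_eps A is dense in Spec_eps A.
   Otherwise the resolvent norm equals M = 1/eps at some lambda and is at most M
   nearby. With T = (A - lambda)^-1, averaging the resolvent over a small circle
   against a positive kernel yields |T + zeta c_k T^(k+1)| <= M for all k >= 1 and
   |zeta| <= 1. If X or X^* is complex uniformly convex, k = 1 contradicts that T
   is bounded below. If dim X = d is finite, but the norm of X is arbitrary, take
   near-maximisers u of |T u| and set g_l = T^(l+1) u. A limit of suitably
   translated and normalised g_l gives functionals phi_j on X with
   phi_j(g_0(j)) = |g_0(j)| and phi_j(g_l(j)) = 0 for l >= 1, and g_l(j) = 0 for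
   all l wherever g_0(j) = 0, while the limit of A - lambda, still tridiagonal,
   maps g_l to g_(l-1). If g_0 vanishes on both sides of a short interval, the
   finite-dimensional space of functionals on it carries arbitrarily many
   independent phi_j o (A - lambda)^k. Otherwise g_0 has no zeros on an interval
   of 2^p points; splitting it dyadically and adding at each scale the
   functionals phi_c o (A - lambda)^k centred at the midpoint c, with k up to the
   scale, produces p 2^p / 4 independent functionals, too many when p is large
   compared with d. *)

(** * Norms with real values and the Hahn-Banach theorem *)

Section rnorm_complements.
Context {R : realType}.

Lemma rnormN (V : normedZmodType R[i]) (x : V) : rnorm (- x) = rnorm x.
Proof. by rewrite /rnorm normrN. Qed.

Lemma rnorm_distC (V : normedZmodType R[i]) (x y : V) :
  rnorm (x - y) = rnorm (y - x).
Proof. by rewrite -rnormN opprB. Qed.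

Lemma ler_rnormB (V : normedZmodType R[i]) (x y : V) :
  rnorm x - rnorm y <= rnorm (x - y).
Proof. by rewrite lerBlDr -{1}(subrK y x) rnormD. Qed.

Lemma rnorm_eq0 (V : normedZmodType R[i]) (x : V) : (rnorm x == 0) = (x == 0).
Proof. by apply/eqP/eqP => [/rnorm0_eq0//|->]; rewrite rnorm0. Qed.

Lemma rnorm_gt0 (V : normedZmodType R[i]) (x : V) : (0 < rnorm x) = (x != 0).
Proof. by rewrite lt_def rnorm_ge0 andbT rnorm_eq0. Qed.

Lemma rnorm_sum (V : normedZmodType R[i]) (I : Type) (s : seq I) (P : pred I)
    (F : I -> V) :
  rnorm (\sum_(i <- s | P i) F i) <= \sum_(i <- s | P i) rnorm (F i).
Proof.
elim/big_rec2 : _ => [|i y z _ yz]; first by rewrite rnorm0.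
by rewrite (le_trans (rnormD _ _))// lerD2l.
Qed.

Lemma rnormM (a b : R[i]) : rnorm (a * b) = rnorm a * rnorm b.
Proof. by have := normrM a b; rewrite !rnormE -rmorphM => /complexI. Qed.

Lemma rnorm1 : rnorm (1 : R[i]) = 1.
Proof. by rewrite /rnorm normr1. Qed.

Lemma rnormX (a : R[i]) n : rnorm (a ^+ n) = rnorm a ^+ n.
Proof.
by elim: n => [|n IH]; rewrite ?expr0 ?rnorm1// !exprS rnormM IH.
Qed.

Lemma rnorm_real (r : R) : rnorm (r%:C%C) = `|r|.
Proof. by rewrite /rnorm normc_def/= expr0n addr0 sqrtr_sqr. Qed.

Lemma rnorm_pos (r : R) : 0 <= r -> rnorm (r%:C%C) = r.
Proof. by move=> r0; rewrite rnorm_real ger0_norm. Qed.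

Lemma rnorm_sqrE (z : R[i]) :
  rnorm z ^+ 2 = complex.Re z ^+ 2 + complex.Im z ^+ 2.
Proof. by rewrite /rnorm normc_def/= sqr_sqrtr// addr_ge0 ?sqr_ge0. Qed.

Lemma absRe_le_rnorm (z : R[i]) : `|complex.Re z| <= rnorm z.
Proof.
rewrite -(@ler_pXn2r _ 2)// ?nnegrE ?rnorm_ge0// rnorm_sqrE real_normK ?num_real//.
by rewrite lerDl sqr_ge0.
Qed.

Lemma absIm_le_rnorm (z : R[i]) : `|complex.Im z| <= rnorm z.
Proof.
rewrite -(@ler_pXn2r _ 2)// ?nnegrE ?rnorm_ge0// rnorm_sqrE real_normK ?num_real//.
by rewrite lerDr sqr_ge0.
Qed.

Lemma Re_le_rnorm (z : R[i]) : complex.Re z <= rnorm z.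
Proof. exact: le_trans (ler_norm _) (absRe_le_rnorm z). Qed.

Lemma rnorm_le_ReIm (z : R[i]) :
  rnorm z <= `|complex.Re z| + `|complex.Im z|.
Proof.
rewrite -(@ler_pXn2r _ 2)// ?nnegrE ?rnorm_ge0 ?addr_ge0//.
rewrite rnorm_sqrE sqrrD !real_normK ?num_real//.
have : 0 <= `|complex.Re z| * `|complex.Im z| by rewrite mulr_ge0.
lra.
Qed.

Lemma ReD (a b : R[i]) : complex.Re (a + b) = complex.Re a + complex.Re b.
Proof. by case: a b => [? ?] [? ?]. Qed.

Lemma normalize_rnorm (V : normedModType R[i]) (x : V) : x != 0 ->
  rnorm ((rnorm x)^-1%:C%C *: x) = 1.
Proof.
rewrite -rnorm_gt0 => x0.
by rewrite rnormZ rnorm_pos ?invr_ge0 ?ltW// mulVf ?gt_eqF.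
Qed.

Lemma invn_small (e : R) : 0 < e -> exists N : nat, forall n : nat, (N <= n)%N ->
  (n.+1%:R)^-1 <= e.
Proof.
move=> e0; exists (Num.trunc e^-1) => n Nn.
rewrite -[leRHS]invrK lef_pV2 ?posrE ?invr_gt0//.
have := Num.Theory.truncnS_gt e^-1; move/ltW/le_trans; apply.
by rewrite ler_nat.
Qed.

Lemma phaseP (z : R[i]) :
  exists u : R[i], rnorm u = 1 /\ u * z = (rnorm z)%:C%C.
Proof.
have [->|z0] := eqVneq z 0.
  by exists 1; rewrite rnorm1 mulr0 rnorm0.
exists ((rnorm z)%:C%C / z); rewrite mulfVK//; split=> //.
rewrite rnormM rnormV rnorm_pos ?rnorm_ge0// mulfV//.
by rewrite rnorm_eq0.
Qed.

End rnorm_complements.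

Section hahn_banach.
Context {R : realType} (V : lmodType R[i]).
Implicit Types (p q : V -> R) (v x y : V).

(** Homogeneity is asked for nonnegative real scalars only: V is first treated as a real space, and
    complex scalars come back in [hahn_banach]. *)
Definition sublinear p :=
  (forall x y, p (x + y) <= p x + p y) /\
  (forall (t : R) x, 0 <= t -> p (t%:C%C *: x) = t * p x).

Lemma sublinear0 p : sublinear p -> p 0 = 0.
Proof. by move=> [_ /(_ 0 0 (lexx _))]; rewrite scaler0 mul0r. Qed.

Lemma sublinearN p x : sublinear p -> - p (- x) <= p x.
Proof.
move=> hp; have := hp.1 x (- x); rewrite subrr sublinear0//; lra.
Qed.

(* [slide q v <= q] is again sublinear, and [slide q v = q] says that [q] is
   additive in the direction [v]: a minimal sublinear functional is linear. *)
Definition slide q v x : R :=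
  inf [set q (x + t%:C%C *: v) - t * q v | t in [set t : R | 0 <= t]].

Lemma slide_le q v x (t : R) : sublinear q -> 0 <= t ->
  slide q v x <= q (x + t%:C%C *: v) - t * q v.
Proof.
move=> hq t0; apply: ge_inf; last by exists t.
exists (- q (- x)) => _ [s /= s0 <-].
have := hq.1 (x + s%:C%C *: v) (- x); rewrite addrAC subrr add0r hq.2//; lra.
Qed.

Lemma le_slide q v x (a : R) :
  (forall t, 0 <= t -> a <= q (x + t%:C%C *: v) - t * q v) -> a <= slide q v x.
Proof.
move=> h; apply: lb_le_inf; last by move=> _ [t /= t0 <-]; exact: h.
by exists (q (x + 0%:C%C *: v) - 0 * q v), 0 => /=.
Qed.

Lemma slide_le_id q v x : sublinear q -> slide q v x <= q x.
Proof.
by move=> hq; have := slide_le v x hq (lexx 0); rewrite scale0r addr0 mul0r subr0.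
Qed.

(** For subadditivity the parameters t and s of two competitors add up to one for x + y; for
    homogeneity the parameter is rescaled with x. *)
Lemma slide_sublinear q v : sublinear q -> sublinear (slide q v).
Proof.
move=> hq; split=> [x y|t x].
  rewrite -lerBlDr; apply: le_slide => t t0.
  rewrite lerBlDr -lerBlDl; apply: le_slide => s s0.
  have := slide_le v (x + y) hq (addr_ge0 t0 s0).
  rewrite rmorphD scalerDl addrACA.
  have := hq.1 (x + t%:C%C *: v) (y + s%:C%C *: v); lra.
rewrite le_eqVlt => /orP[/eqP<-|t0].
  rewrite scale0r mul0r; apply/eqP; rewrite eq_le; apply/andP; split.
    by rewrite (le_trans (slide_le_id _ _ hq))// sublinear0.
  by apply: le_slide => s s0; rewrite add0r hq.2// subrr.
have tC : t%:C%C != 0 :> R[i].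
  by rewrite -(rmorph0 (real_complex R)) (inj_eq (@complexI R)) gt_eqF.
apply/eqP; rewrite eq_le; apply/andP; split.
  rewrite -ler_pdivrMl//; apply: le_slide => s s0.
  rewrite ler_pdivrMl//.
  have := slide_le v (t%:C%C *: x) hq (mulr_ge0 (ltW t0) s0).
  by rewrite rmorphM -scalerA -scalerDr hq.2 ?(ltW t0)// -mulrA -mulrBr.
apply: le_slide => s s0.
have si : 0 <= s / t by rewrite divr_ge0// ltW.
have := slide_le v x hq si.
have -> : q (t%:C%C *: x + s%:C%C *: v) = t * q (x + (s / t)%:C%C *: v).
  rewrite -hq.2 ?(ltW t0)// scalerDr scalerA -rmorphM mulrC divfK//.
  by rewrite gt_eqF.
by rewrite -(ler_pM2l t0) mulrBr mulrA [t * (s / t)]mulrC divfK ?gt_eqF.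
Qed.

Definition minorant p := {q : V -> R | sublinear q /\ forall x, q x <= p x}.

(** Zorn's lemma for the reversed pointwise order. The pointwise infimum of a chain is finite,
    because q <= p forces q x >= - p (- x). *)
Lemma exists_minimal_sublinear p : sublinear p ->
  exists q, [/\ sublinear q, forall x, q x <= p x &
    forall q', sublinear q' -> (forall x, q' x <= q x) -> q' = q].
Proof.
move=> hp.
pose T := minorant p.
pose r (a b : T) : bool := `[< forall x, sval b x <= sval a x >].
have lb (a : T) x : - p (- x) <= sval a x.
  case: a => q [hq qp] /=; rewrite (le_trans _ (sublinearN x hq))// lerN2.
  exact: qp.
have [t|a b c /asboolP ab /asboolP bc|a b /asboolP ab /asboolP ba|C Ctot|q qmin]
    := @Zorn T r.
- exact/asboolP.
- by apply/asboolP => x; exact: le_trans (bc x) (ab x).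
- case: a b ab ba => [a ha] [b hb] /= ab ba.
  have e : a = b by apply/funext => x; apply/eqP; rewrite eq_le ab ba.
  by subst b; congr exist; exact: Prop_irrelevance.
(* The empty chain is bounded by p itself. *)
- have [[c0 Cc0]|C0] := pselect (C !=set0); last first.
    exists (exist _ p (conj hp (fun x => lexx _))) => s Cs.
    by exfalso; apply: C0; exists s.
  pose m x := inf [set sval a x | a in C].
  have hlb x : has_lbound [set sval a x | a in C].
    by exists (- p (- x)) => _ [a _ <-]; exact: lb.
  have mle (a : T) x : C a -> m x <= sval a x.
    by move=> Ca; apply: ge_inf => //; exists a.
  have lem x (b : R) : (forall a, C a -> b <= sval a x) -> b <= m x.
    move=> h; apply: lb_le_inf; first by exists (sval c0 x), c0.
    by move=> _ [a Ca <-]; exact: h.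
  have hm : sublinear m.
    split=> [x y|t x t0].
      rewrite -lerBlDr; apply: (lem _ _) => a Ca.
      rewrite lerBlDr -lerBlDl; apply: (lem _ _) => b Cb.
      rewrite lerBlDl.
      (* Two members of the chain are comparable, and the smaller one serves for both x and y. *)
      have [/asboolP ab|/asboolP ba] := Ctot a b Ca Cb.
        rewrite (le_trans (mle b _ Cb))// (le_trans ((svalP b).1.1 _ _))//.
        by rewrite lerD2r ab.
      rewrite (le_trans (mle a _ Ca))// (le_trans ((svalP a).1.1 _ _))//.
      by rewrite lerD2l ba.
    have [->|tn0] := eqVneq t 0.
      rewrite scale0r mul0r; apply/eqP; rewrite eq_le; apply/andP; split.
        by rewrite (le_trans (mle c0 _ Cc0))// sublinear0//; exact: (svalP c0).1.
      by apply: (lem _ _) => a _; rewrite sublinear0//; exact: (svalP a).1.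
    have tgt0 : 0 < t by rewrite lt_def tn0.
    apply/eqP; rewrite eq_le; apply/andP; split.
      rewrite -ler_pdivrMl//; apply: (lem _ _) => a Ca.
      by rewrite ler_pdivrMl// -(svalP a).1.2// mle.
    apply: (lem _ _) => a Ca; rewrite (svalP a).1.2// ler_wpM2l//; exact: mle.
  have mp x : m x <= p x by rewrite (le_trans (mle c0 x Cc0))//; exact: (svalP c0).2.
  exists (exist _ m (conj hm mp)) => s Cs; apply/asboolP => x /=; exact: mle.
exists (sval q); split; [exact: (svalP q).1|exact: (svalP q).2|].
move=> q' hq' q'q.
have q'p x : q' x <= p x by rewrite (le_trans (q'q x))//; exact: (svalP q).2.
by rewrite -(qmin (exist _ q' (conj hq' q'p)))//; apply/asboolP.
Qed.

(** Minimality is used below [slide p v] rather than below p: this gives f (- v) <= slide p v (- v)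
    <= - p v, hence f v = p v. Additivity comes from [slide f y = f]. *)
Lemma sublinear_dominates p v : sublinear p ->
  exists f : V -> R, [/\ forall x y, f (x + y) = f x + f y,
    forall (t : R) x, f (t%:C%C *: x) = t * f x,
    forall x, f x <= p x & f v = p v].
Proof.
move=> hp.
have [f [hf fle fmin]] := exists_minimal_sublinear (slide_sublinear v hp).
have fp x : f x <= p x by rewrite (le_trans (fle x))// slide_le_id.
have fD x y : f (x + y) = f x + f y.
  apply/eqP; rewrite eq_le hf.1/= -lerBrDr.
  rewrite -{1}(fmin _ (slide_sublinear y hf) (fun z => slide_le_id y z hf)).
  by have := slide_le y x hf ler01; rewrite scale1r mul1r.
have fN x : f (- x) = - f x.
  by apply/eqP; rewrite -addr_eq0 addrC -fD subrr sublinear0.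
exists f; split=> //.
- move=> t x; have [t0|t0] := leP 0 t; first exact: hf.2.
  rewrite -[LHS]opprK -fN -scaleNr -rmorphN hf.2 ?oppr_ge0 1?ltW//.
  by rewrite mulNr opprK.
- apply/eqP; rewrite eq_le fp/= -lerN2 -fN (le_trans (fle _))//.
  have := slide_le v (- v) hp ler01.
  by rewrite scale1r addNr sublinear0// mul1r add0r.
Qed.

(** Passage to complex scalars: phi x = f x - i f (i x) for a real-linear f dominated by p, and
    rotating x until phi x is real bounds |phi x| by p x. *)
Theorem hahn_banach p v :
  (forall x y, p (x + y) <= p x + p y) ->
  (forall (a : R[i]) x, p (a *: x) = rnorm a * p x) ->
  exists phi : V -> R[i], [/\ linear (phi : V -> R[i]^o),
    forall x, rnorm (phi x) <= p x & phi v = (p v)%:C%C].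
Proof.
move=> pD pZ.
have hp : sublinear p by split=> // t x t0; rewrite pZ rnorm_pos.
have [f [fD fZ fp fv]] := sublinear_dominates v hp.
have fN x : f (- x) = - f x.
  by have := fZ (-1) x; rewrite rmorphN rmorph1 scaleN1r mulN1r.
pose phi x : R[i] := (f x +i* (- f ('i%C *: x)))%C.
have phiD x y : phi (x + y) = phi x + phi y.
  by rewrite /phi scalerDr !fD opprD.
have phiR (t : R) x : phi (t%:C%C *: x) = t%:C%C * phi x.
  rewrite /phi scalerA mulrC -scalerA !fZ.
  by apply/eqP; rewrite eq_complex/= !mul0r subr0 addr0 mulrN !eqxx.
have phii x : phi ('i%C *: x) = 'i%C * phi x.
  rewrite /phi scalerA -expr2 sqr_i scaleN1r fN opprK.
  by apply/eqP; rewrite eq_complex/= !mul0r !mul1r !add0r opprK !eqxx.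
have phiZ a x : phi (a *: x) = a * phi x.
  rewrite {1}(complexE a) scalerDl -scalerA phiD phii !phiR.
  by rewrite mulrA -mulrDl -complexE.
have phip x : rnorm (phi x) <= p x.
  have [u [u1 ux]] := phaseP (phi x).
  have -> : rnorm (phi x) = f (u *: x).
    by rewrite -[LHS]/(complex.Re (rnorm (phi x))%:C%C) -ux -phiZ.
  by rewrite (le_trans (fp _))// pZ u1 mul1r.
exists phi; split=> //; first by move=> a x y; rewrite phiD phiZ.
(* The real part of phi v is already p v, so |phi v| <= p v leaves no room for an imaginary part. *)
have := phip v; have := rnorm_sqrE (phi v).
rewrite /= fv sqrrN => e le.
have : rnorm (phi v) ^+ 2 <= p v ^+ 2.
  by rewrite ler_pXn2r// nnegrE ?rnorm_ge0// (le_trans (rnorm_ge0 _) le).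
rewrite e gerDl => f0.
have /eqP : f ('i%C *: v) ^+ 2 = 0 by apply/eqP; rewrite eq_le f0 sqr_ge0.
by rewrite sqrf_eq0 => /eqP f00; rewrite /phi f00 oppr0 fv.
Qed.

End hahn_banach.

Section functionals.
Context {R : realType} (V : normedModType R[i]).

Lemma functional_of (phi : V -> R[i]) (M : R) : linear (phi : V -> R[i]^o) ->
  (forall x, rnorm (phi x) <= M * rnorm x) ->
  exists2 psi : dual V, (forall x, psi x = phi x) & (0 <= M -> rnorm psi <= M).
Proof.
move=> lphi bphi.
have h : (phi : V -> R[i]^o) \in @bounded_op R V R[i]^o.
  by apply/asboolP; split => //; exists M.
exists (Bop h) => // M0; rewrite rnorm_bop; apply: opnorm_le => x x1 /=.
by rewrite (le_trans (bphi x))// ler_piMr.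
Qed.

Lemma norming_functional (v : V) :
  exists2 phi : dual V, rnorm phi <= 1 & phi v = (rnorm v)%:C%C.
Proof.
have [||phi [lphi phib phiv]] := @hahn_banach R V (@rnorm R V) v.
- exact: rnormD.
- exact: rnormZ.
have [|psi psiE psi1] := @functional_of phi 1 lphi.
  by move=> x; rewrite mul1r.
by exists psi; [exact: psi1|rewrite psiE].
Qed.

Lemma rnorm_functional (phi : dual V) (x : V) :
  rnorm (phi x : R[i]) <= rnorm phi * rnorm x.
Proof. exact: (@opnormP R V R[i]^o phi x). Qed.

End functionals.

Section bop_linearity.
Context {R : realType} {U V : normedModType R[i]} (f : 'L(U, V)).

Lemma bop0 : f 0 = 0. Proof. exact: linear0. Qed.

Lemma bopD x y : f (x + y) = f x + f y. Proof. exact: linearD. Qed.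

Lemma bopN x : f (- x) = - f x. Proof. exact: linearN. Qed.

Lemma bopB x y : f (x - y) = f x - f y. Proof. exact: linearB. Qed.

Lemma bopZ a x : f (a *: x) = a *: f x. Proof. exact: linearZ. Qed.

Lemma bop_sum (I : Type) (s : seq I) (P : pred I) (F : I -> U) :
  f (\sum_(i <- s | P i) F i) = \sum_(i <- s | P i) f (F i).
Proof. exact: linear_sum. Qed.

End bop_linearity.

Section dual_operations.
Context {R : realType} {V W : normedModType R[i]}.
Implicit Types (f g : dual V) (B : 'L(W, V)).

Lemma dualD f g x : (f + g) x = f x + g x. Proof. by []. Qed.

Lemma dualB f g x : (f - g) x = f x - g x. Proof. by []. Qed.

Lemma dualZ a f x : (a *: f) x = a *: f x. Proof. by []. Qed.

Lemma comp_bopE (U : normedModType R[i]) (g : 'L(V, U)) B x : comp_bop g B x = g (B x).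
Proof. by []. Qed.

Lemma adjointE f B x : adjoint B f x = f (B x).
Proof. by []. Qed.

End dual_operations.

(** * Lower norms, inverses and pseudospectra *)

Section cauchy_completeness.
Context {R : realType}.

(** Completeness as a property of a plain normed module, so that it can be transferred from X to
    [ell2 X]. *)
Definition cauchy_complete (V : normedModType R[i]) := forall u : nat -> V,
  (forall e : R, 0 < e -> exists N : nat, forall m n : nat, (N <= m)%N ->
     (N <= n)%N -> rnorm (u m - u n) <= e) ->
  exists l, forall e : R, 0 < e -> exists N : nat, forall n : nat,
     (N <= n)%N -> rnorm (u n - l) <= e.

Lemma complex_gt0 (e : R[i]) : 0 < e -> 0 < complex.Re e /\ e = (complex.Re e)%:C%C.
Proof. by case: e => a b; rewrite ltcE /= => /andP[/eqP -> ->]. Qed.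

Lemma completeNormedMod_cauchy_complete (X : completeNormedModType R[i]) :
  cauchy_complete X.
Proof.
move=> u cu.
have /cauchy_cvg/cvg_ex[l ul] : cauchy (u @ \oo).
  apply: cauchy_exP => e e0; have [re0 eE] := complex_gt0 e0.
  have [N hN] := cu (complex.Re e / 2) (divr_gt0 re0 (ltr0Sn _ 1)).
  exists (u N), N => // n /= Nn; rewrite -ball_normE /= rnormE eE ltcR.
  by rewrite (le_lt_trans (hN _ _ (leqnn N) Nn))// ltr_pdivrMr// ltr_pMr// ltr1n.
exists l => e e0.
have /cvgrPdist_le /(_ e%:C%C) := ul; rewrite ltcR => /(_ e0) [N _ hN].
by exists N => n Nn; have := hN n Nn; rewrite /= rnormE lecR rnorm_distC.
Qed.

Lemma eventually_all (I : eqType) (s : seq I) (P : I -> nat -> Prop) :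
  (forall i, i \in s -> exists N : nat, forall n : nat, (N <= n)%N -> P i n) ->
  exists N : nat, forall i, i \in s -> forall n : nat, (N <= n)%N -> P i n.
Proof.
elim: s => [_|i s IH h]; first by exists 0%N.
have [|N hN] := IH; first by move=> j js; apply: h; rewrite inE js orbT.
have [|M hM] := h i; first by rewrite inE eqxx.
exists (maxn M N) => j; rewrite inE => /orP[/eqP->|js] n; rewrite geq_max.
  by case/andP => Mn _; exact: hM.
by case/andP => _ Nn; exact: hN.
Qed.

(** The coordinatewise limit works: on a finite set F, u n is compared with a u m whose coordinates
    on F are already close to the limit. The index m depends on F, the resulting bound does not. *)
Lemma ell2_cauchy_complete (X : normedModType R[i]) :
  cauchy_complete X -> cauchy_complete (ell2 X).
Proof.
move=> cX u cu.
have /choice[l hl] : forall j, exists l, forall e : R, 0 < e ->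
    exists N : nat, forall n : nat, (N <= n)%N -> rnorm (u n j - l) <= e.
  move=> j; apply: cX => e e0; have [N hN] := cu e e0.
  exists N => m n Nm Nn; rewrite (le_trans _ (hN _ _ Nm Nn))//.
  exact: (rnorm_ell2_coord (u m - u n) j).
have key (e : R) : 0 < e -> exists N : nat, forall n : nat, (N <= n)%N ->
    forall F : {fset int}, \sum_(j <- F) rnorm (u n j - l j) ^+ 2 <= e ^+ 2.
  move=> e0; have e20 : 0 < e / 2 by rewrite divr_gt0.
  have [N hN] := cu _ e20; exists N => n Nn F.
  (* Small enough that the cardinality of F times d^2 is at most (e / 2)^2. *)
  pose d := e / 2 / (#|` F|%:R + 1).
  have F1 : 0 < #|` F|%:R + 1 :> R by rewrite ltr_pwDr.
  have d0 : 0 < d by rewrite divr_gt0.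
  have [j _|M hM] := @eventually_all _ F (fun j m => rnorm (u m j - l j) <= d).
    exact: hl.
  pose m := maxn M N.
  have -> : e = e / 2 + e / 2 by rewrite -splitr.
  rewrite (eq_bigr (fun j => rnorm ((u n j - u m j) + (u m j - l j)) ^+ 2));
    last by move=> j _; rewrite addrA subrK.
  apply: fsumD_le; rewrite ?(ltW e20)//.
    rewrite (le_trans (ell2norm_fsum (u n - u m) F))//.
    rewrite ler_pXn2r ?nnegrE ?ell2norm_ge0 ?(ltW e20)//.
    exact: (hN n m Nn (leq_maxr _ _)).
  rewrite (@le_trans _ _ (\sum_(j <- F) d ^+ 2))//.
    rewrite big_seq [leRHS]big_seq; apply: ler_sum => j jF.
    by rewrite ler_pXn2r ?nnegrE ?rnorm_ge0 ?(ltW d0)// hM// leq_maxl.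
  rewrite big_const_seq count_predT iter_addr_0 -[leLHS]mulr_natl.
  have -> : e / 2 = d * (#|` F|%:R + 1) by rewrite /d divfK// gt_eqF.
  rewrite [leRHS]exprMn [leLHS]mulrC ler_wpM2l ?sqr_ge0//.
  have : 0 <= #|` F|%:R :> R by [].
  rewrite sqrrD1; nra.
have [N hN] := key 1 ltr01.
have lS : l \in @sqsummable R X.
  have uS : (fun j => u N j - l j) \in @sqsummable R X.
    by apply/sqsummableP; exists 1 => // F; exact: hN.
  have -> : l = u N - Ell2 uS.
    by apply/funext => j; rewrite [RHS]/= opprB addrCA subrr addr0.
  exact: ell2_funP.
exists (Ell2 lS) => e e0; have [M hM] := key e e0.
by exists M => n Mn; apply: ell2norm_le; [exact: ltW|exact: hM].
Qed.

End cauchy_completeness.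

Section bounded_below.
Context {R : realType} (V : normedModType R[i]).
Implicit Types B C D : 'L(V, V).

(** On a complete space and for c > 0 this means that B has an inverse of norm at most 1 / c; the
    bound on the adjoint is what makes the range dense. *)
Definition bounded_below (c : R) B :=
  (forall x, c * rnorm x <= rnorm (B x)) /\
  (forall phi : dual V, c * rnorm phi <= rnorm (adjoint B phi)).

Lemma opnorm_comp (U W : normedModType R[i]) (g : 'L(V, W)) (f : 'L(U, V)) :
  opnorm (comp_bop g f) <= opnorm g * opnorm f.
Proof.
apply: opnorm_le => x x1; rewrite (le_trans (opnormP g (f x)))//.
by rewrite ler_wpM2l ?opnorm_ge0 ?opnorm_ub.
Qed.

(** An operator that is bounded below has closed range: the preimages of a sequence converging to v
    are Cauchy. *)
Lemma dist_range_eq0 (B : 'L(V, V)) (c : R) v : cauchy_complete V -> 0 < c ->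
  (forall x, c * rnorm x <= rnorm (B x)) ->
  (forall e : R, 0 < e -> exists y, rnorm (v - B y) <= e) ->
  exists x, B x = v.
Proof.
move=> cV c0 hB hv.
have /choice[u hu] : forall n : nat, exists y, rnorm (v - B y) <= (n.+1%:R)^-1.
  by move=> n; apply: hv; rewrite invr_gt0.
have small (e : R) : 0 < e -> exists N : nat, forall n : nat, (N <= n)%N ->
    rnorm (v - B (u n)) <= e.
  move=> e0; have [N hN] := invn_small e0.
  by exists N => n Nn; rewrite (le_trans (hu n))// hN.
have [e e0|x hx] := cV u.
  have [|N hN] := small (c * e / 2); first by rewrite divr_gt0// mulr_gt0.
  exists N => m n Nm Nn; rewrite -(ler_pM2l c0) (le_trans (hB _))//.
  rewrite bopB (_ : B (u m) - B (u n) = (v - B (u n)) - (v - B (u m))); last first.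
    by rewrite opprB [RHS]addrC addrA subrK.
  rewrite (le_trans (rnormD _ _))// rnormN.
  have := hN m Nm; have := hN n Nn; lra.
exists x; apply/eqP; rewrite -subr_eq0 -rnorm_eq0 eq_le rnorm_ge0 andbT.
apply/ler_addgt0Pr => e e0; rewrite add0r.
have [M Mge0 BM] : exists2 M, 0 <= M & forall y, rnorm (B y) <= M * rnorm y.
  by exists (opnorm B); [exact: opnorm_ge0|exact: opnormP].
have [|N1 h1] := small (e / 2); first by rewrite divr_gt0.
have [|N2 h2] := hx (e / 2 / (M + 1)).
  by rewrite divr_gt0 ?divr_gt0// ltr_wpDl.
pose n := maxn N1 N2.
rewrite (_ : B x - v = - (B (u n - x)) - (v - B (u n))); last first.
  by rewrite bopB !opprB addrA subrK.
rewrite (le_trans (rnormD _ _))// !rnormN.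
have := h1 n (leq_maxl _ _); have := h2 n (leq_maxr _ _); have := BM (u n - x).
rewrite ler_pdivlMr ?ltr_wpDl//.
have := rnorm_ge0 (u n - x); nra.
Qed.

(** A vector v outside the range has positive distance p v to it. Hahn-Banach for this seminorm
    gives a functional that vanishes on the range but not at v, and the adjoint, bounded below,
    would send it to 0. *)
Lemma bounded_below_invertible (c : R) B : cauchy_complete V -> 0 < c ->
  bounded_below c B -> exists2 D, is_inverse B D & rnorm D <= c^-1.
Proof.
move=> cV c0 [hB hBa].
have surj v : exists x, B x = v.
  apply: contrapT => nv.
  pose p x := inf [set rnorm (x - B y) | y in [set: V]].
  have lbp x : has_lbound [set rnorm (x - B y) | y in [set: V]].
    by exists 0 => _ [y _ <-]; exact: rnorm_ge0.
  have ple x y : p x <= rnorm (x - B y) by apply: ge_inf => //; exists y.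
  have lep x (a : R) : (forall y, a <= rnorm (x - B y)) -> a <= p x.
    move=> h; apply: lb_le_inf; first by exists (rnorm (x - B 0)), 0.
    by move=> _ [y _ <-]; exact: h.
  have p0 x : 0 <= p x by apply: (lep) => y; exact: rnorm_ge0.
  have pD x y : p (x + y) <= p x + p y.
    rewrite -lerBlDr; apply: (lep) => a; rewrite lerBlDr -lerBlDl.
    apply: (lep) => b; rewrite lerBlDl (le_trans (ple _ (a + b)))//.
    by rewrite bopD opprD addrACA rnormD.
  have pZle (a : R[i]) x : p (a *: x) <= rnorm a * p x.
    have [->|a0] := eqVneq a 0.
      by rewrite scale0r rnorm0 mul0r (le_trans (ple 0 0))// bop0 subrr rnorm0.
    rewrite -ler_pdivrMl ?rnorm_gt0//; apply: (lep) => y.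
    rewrite ler_pdivrMl ?rnorm_gt0// -rnormZ (le_trans (ple _ (a *: y)))//.
    by rewrite bopZ scalerBr.
  have pZ (a : R[i]) x : p (a *: x) = rnorm a * p x.
    apply/eqP; rewrite eq_le pZle/=.
    have [->|a0] := eqVneq a 0; first by rewrite rnorm0 mul0r.
    have := pZle a^-1 (a *: x).
    by rewrite scalerA mulVf// scale1r rnormV ler_pdivlMl ?rnorm_gt0.
  have pv : 0 < p v.
    rewrite lt_def p0 andbT; apply/eqP => pv0; apply: nv.
    apply: dist_range_eq0 cV c0 hB _ => e e0.
    have [|_ [y _ <-]] := @inf_adherent _ [set rnorm (v - B y) | y in [set: V]] e e0.
      by split; [exists (rnorm (v - B 0)), 0|exact: lbp].
    by rewrite -/(p v) pv0 add0r => /ltW; exists y.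
  have [phi [lphi phip phiv]] := hahn_banach v pD pZ.
  have [x|psi psiE _] := @functional_of _ _ phi 1 lphi.
    by rewrite mul1r (le_trans (phip x))// (le_trans (ple x 0))// bop0 subr0.
  have psi0 : rnorm psi = 0.
    apply/eqP; rewrite eq_le rnorm_ge0 andbT -(ler_pM2l c0) mulr0.
    rewrite (le_trans (hBa psi))// (_ : adjoint B psi = 0) ?rnorm0//.
    apply: bop_ext => x; rewrite [LHS]/= psiE; apply: rnorm0_eq0; apply/eqP.
    rewrite eq_le rnorm_ge0 andbT (le_trans (phip _))// (le_trans (ple _ x))//.
    by rewrite subrr rnorm0.
  have := psiE v; rewrite (rnorm0_eq0 psi0) phiv => /esym.
  by rewrite -[RHS](rmorph0 (real_complex R)) => /complexI/eqP; rewrite gt_eqF.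
have [d dE] := choice surj.
have inj x : B x = 0 -> x = 0.
  move=> Bx; apply: rnorm0_eq0; apply/eqP; rewrite eq_le rnorm_ge0 andbT.
  by rewrite -(ler_pM2l c0) mulr0 (le_trans (hB x))// Bx rnorm0.
have dB x : d (B x) = x.
  by apply/eqP; rewrite -subr_eq0; apply/eqP/inj; rewrite bopB dE subrr.
have db x : rnorm (d x) <= c^-1 * rnorm x.
  by rewrite ler_pdivlMl// (le_trans (hB _))// dE.
have dP : d \in @bounded_op R V V.
  apply/asboolP; split; last by exists c^-1.
  by move=> a x y; rewrite -[RHS]dB bopD bopZ !dE.
exists (Bop dP).
  by split; apply: bop_ext => x /=.
rewrite rnorm_bop; apply: opnorm_le => x x1.
by rewrite (le_trans (db x))// ler_piMr// invr_ge0 ltW.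
Qed.

Lemma inverseK B D x : is_inverse B D -> D (B x) = x.
Proof. by case=> e _; exact: (congr1 (fun f : 'L(V, V) => f x) e). Qed.

Lemma inverseVK B D x : is_inverse B D -> B (D x) = x.
Proof. by case=> _ e; exact: (congr1 (fun f : 'L(V, V) => f x) e). Qed.

Lemma inverse_bounded_below (c : R) B D : 0 < c -> is_inverse B D ->
  rnorm D <= c^-1 -> bounded_below c B.
Proof.
move=> c0 BD Dc; split=> [x|phi]; rewrite -ler_pdivlMl//.
  rewrite -{1}(inverseK x BD) (le_trans (opnormP D _))//.
  by rewrite ler_wpM2r ?rnorm_ge0.
have {1}-> : phi = comp_bop (adjoint B phi) D.
  by apply: bop_ext => x; rewrite comp_bopE adjointE (inverseVK x BD).
rewrite (le_trans (opnorm_comp _ _))// mulrC ler_wpM2r//.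
exact: opnorm_ge0.
Qed.

Lemma inverse_unique B C D : is_inverse B C -> is_inverse B D -> C = D.
Proof.
move=> BC BD; apply: bop_ext => x.
by rewrite -{1}(inverseVK x BD) (inverseK _ BC).
Qed.

Lemma inv_norm_inverse B D : is_inverse B D -> inv_norm B = (rnorm D)%:E.
Proof.
move=> BD; rewrite /inv_norm; case: pselect => [h|[]]; last by exists D.
by rewrite (inverse_unique (projT2 (cid h)) BD).
Qed.

Lemma inv_norm_noninvertible B : ~ invertible B -> inv_norm B = +oo%E.
Proof. by rewrite /inv_norm; case: pselect. Qed.

End bounded_below.

Section shift.
Context {R : realType} (V : normedModType R[i]).
Implicit Types B D : 'L(V, V).

Lemma shift_opE B l x : shift_op B l x = B x - l *: x.
Proof. by []. Qed.

Lemma shift_op_shift B l m x :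
  shift_op B m x = shift_op B l x - (m - l) *: x.
Proof. by rewrite !shift_opE scalerBl opprB addrA subrK. Qed.

Lemma adjoint_shift B l m (phi : dual V) :
  adjoint (shift_op B m) phi = adjoint (shift_op B l) phi - (m - l) *: phi.
Proof.
apply: bop_ext => x.
rewrite -[LHS]/(phi (shift_op B m x)) (shift_op_shift _ l) bopB bopZ.
by [].
Qed.

Lemma bounded_below_le (c c' : R) B :
  c' <= c -> bounded_below c B -> bounded_below c' B.
Proof.
move=> cc [h1 h2]; split=> x; [apply: le_trans (h1 x)|apply: le_trans (h2 x)];
  by rewrite ler_wpM2r ?rnorm_ge0.
Qed.

Lemma bounded_below_shift (c : R) B l m : bounded_below c (shift_op B l) ->
  bounded_below (c - rnorm (m - l)) (shift_op B m).
Proof.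
move=> [h1 h2]; split=> x.
  rewrite (shift_op_shift _ l) mulrBl -rnormZ (le_trans _ (ler_rnormB _ _))//.
  by rewrite lerB.
rewrite (adjoint_shift _ l) mulrBl -rnormZ (le_trans _ (ler_rnormB _ _))//.
by rewrite lerB.
Qed.

Lemma bounded_below_far B l : bounded_below (rnorm l - rnorm B) (shift_op B l).
Proof.
split=> x.
  rewrite mulrBl shift_opE rnorm_distC (le_trans _ (ler_rnormB _ _))//.
  by rewrite rnormZ lerB// opnormP.
rewrite mulrBl (adjoint_shift _ 0) subr0 rnorm_distC.
rewrite (le_trans _ (ler_rnormB _ _))// rnormZ lerB//.
rewrite (_ : shift_op B 0 = B) ?(le_trans (opnorm_comp _ _)) 1?mulrC//.
by rewrite /shift_op scale0r subr0.
Qed.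

(** The strict inequality answers the nonstrict one in [Spec_closed], and for eps = 0 it expresses
    invertibility; in [notin_spec_openP] the roles are exchanged. *)
Lemma notin_Spec_closedP (eps : R) B l : cauchy_complete V -> 0 <= eps ->
  (~ Spec_closed eps B l) <->
  exists2 c, eps < c & bounded_below c (shift_op B l).
Proof.
move=> cV; set C := shift_op B l; rewrite le_eqVlt => /orP[/eqP<-|eps0].
  rewrite /Spec_closed eqxx /spectrum /= -/C; split=> [/contrapT[D BD]|[c c0 h]].
    have M0 : 0 < rnorm D + 1 by rewrite ltr_wpDl ?rnorm_ge0.
    exists (rnorm D + 1)^-1; first by rewrite invr_gt0.
    apply: inverse_bounded_below BD _; first by rewrite invr_gt0.
    by rewrite invrK lerDl.
  by apply; have [D BD _] := bounded_below_invertible cV c0 h; exists D.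
rewrite /Spec_closed gt_eqF//= -/C; split=> [/negP|[c ec h]].
  rewrite -ltNge; have [[D BD]|nC] := pselect (invertible C); last first.
    by rewrite inv_norm_noninvertible// invey lte_fin ltNge ltW.
  (* [rnorm D = 0] only occurs on the zero space, where 0^-1 = +oo and every c is a lower bound. *)
  rewrite (inv_norm_inverse BD) inver; case: ifPn => [/eqP D0 _|D0].
    exists (eps + 1); first by rewrite ltrDl.
    apply: inverse_bounded_below BD _; first by rewrite addr_gt0.
    by rewrite D0 invr_ge0 addr_ge0// ltW.
  rewrite lte_fin => h; exists (rnorm D)^-1 => //.
  by apply: inverse_bounded_below BD _; rewrite ?invrK// invr_gt0 rnorm_gt0 -rnorm_eq0.
have c0 := lt_trans eps0 ec.
have [D BD Dc] := bounded_below_invertible cV c0 h.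
rewrite (inv_norm_inverse BD) inver; case: ifPn => [/eqP D0 //|D0].
apply/negP; rewrite -ltNge lte_fin (lt_le_trans ec)//.
by rewrite -[leLHS]invrK lef_pV2// posrE ?invr_gt0// rnorm_gt0 -rnorm_eq0.
Qed.

Lemma notin_spec_openP (eps : R) B l : cauchy_complete V -> 0 < eps ->
  (~ spec_open eps B l) <-> bounded_below eps (shift_op B l).
Proof.
move=> cV eps0; set C := shift_op B l; rewrite /spec_open /= -/C.
split=> [/negP|h].
  rewrite -leNgt; have [[D BD]|nC] := pselect (invertible C); last first.
    by rewrite inv_norm_noninvertible// invey lee_fin leNgt eps0.
  rewrite (inv_norm_inverse BD) inver; case: ifPn => [/eqP D0 _|D0].
    by apply: inverse_bounded_below BD _ => //; rewrite D0 invr_ge0 ltW.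
  rewrite lee_fin => h; apply: inverse_bounded_below BD _ => //.
  by rewrite -[leLHS]invrK lef_pV2// posrE invr_gt0 rnorm_gt0 -rnorm_eq0.
have [D BD Dc] := bounded_below_invertible cV eps0 h.
rewrite (inv_norm_inverse BD) inver; case: ifPn => [/eqP D0 //|D0].
apply/negP; rewrite -leNgt lee_fin -[leLHS]invrK lef_pV2// posrE ?invr_gt0//.
by rewrite rnorm_gt0 -rnorm_eq0.
Qed.

End shift.

(** * Localization to windows *)

Section ell2_sums.
Context {R : realType} (Y : normedModType R[i]).
Implicit Types x y z : ell2 Y.

Lemma uniq_sum_le x (s : seq int) : uniq s ->
  \sum_(j <- s) rnorm (x j) ^+ 2 <= ell2norm x ^+ 2.
Proof.
move=> us; have := ell2norm_fsum x [fset j in s]%fset.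
by rewrite (perm_big s)//; apply: uniq_perm => [|//|j]; rewrite ?fset_uniq ?inE.
Qed.

Lemma shifted_sum_le x (F : {fset int}) (s : int) :
  \sum_(j <- F) rnorm (x (j + s)) ^+ 2 <= ell2norm x ^+ 2.
Proof.
rewrite -(big_map (fun j => j + s) xpredT (fun j => rnorm (x j) ^+ 2)).
by rewrite uniq_sum_le// map_inj_uniq ?fset_uniq//; exact: addIr.
Qed.

Lemma ell2norm_approx x (e : R) : 0 < e -> exists F : {fset int},
  ell2norm x ^+ 2 <= \sum_(j <- F) rnorm (x j) ^+ 2 + e.
Proof.
move=> e0; apply: contrapT => /forallNP h.
have hF (F : {fset int}) : \sum_(j <- F) rnorm (x j) ^+ 2 <= ell2norm x ^+ 2 - e.
  by have /negP := h F; rewrite -ltNge => /ltW; rewrite lerBrDr.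
have xe0 : 0 <= ell2norm x ^+ 2 - e.
  by rewrite (le_trans _ (hF fset0))// big_seq_fset0.
have : ell2norm x <= Num.sqrt (ell2norm x ^+ 2 - e).
  by apply: ell2norm_le => // F; rewrite sqr_sqrtr.
rewrite -(@ler_pXn2r _ 2) ?nnegrE ?ell2norm_ge0 ?sqrtr_ge0// (sqr_sqrtr xe0).
by rewrite lerBrDr gerDl leNgt e0.
Qed.

Lemma fsum_subset_le x (F G : {fset int}) : (F `<=` G)%fset ->
  \sum_(j <- F) rnorm (x j) ^+ 2 <= \sum_(j <- G) rnorm (x j) ^+ 2.
Proof.
move=> FG; rewrite [leRHS](big_fsetID _ (mem F))/=.
rewrite (_ : [fset j in G | j \in F]%fset = F); last first.
  apply/fsetP => j; rewrite !inE/=.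
  by have [/(fsubsetP FG) ->|] := boolP (j \in F); rewrite ?andbT ?andbF.
by rewrite lerDl; apply: sumr_ge0 => j _; exact: sqr_ge0.
Qed.

(** Each of the finitely many norms is nearly attained on a finite set of coordinates; the union of
    these sets serves all of them. *)
Lemma sum_ell2norm_le (I : Type) (s : seq I) (z : I -> ell2 Y) (C : R) :
  (forall F : {fset int},
     \sum_(k <- s) \sum_(j <- F) rnorm (z k j) ^+ 2 <= C) ->
  \sum_(k <- s) ell2norm (z k) ^+ 2 <= C.
Proof.
move=> h.
have approx (e : R) : 0 < e -> exists F : {fset int},
    \sum_(k <- s) ell2norm (z k) ^+ 2 <=
    \sum_(k <- s) \sum_(j <- F) rnorm (z k j) ^+ 2 + (size s)%:R * e.
  move=> e0; elim: s {h} => [|k s [F hF]].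
    by exists fset0; rewrite !big_nil mul0r addr0.
  have [G hG] := ell2norm_approx (z k) e0.
  exists (F `|` G)%fset; rewrite !big_cons /= -natr1 mulrDl mul1r.
  have h1 := fsum_subset_le (z k) (fsubsetUr F G).
  have h2 : \sum_(l <- s) \sum_(j <- F) rnorm (z l j) ^+ 2 <=
      \sum_(l <- s) \sum_(j <- (F `|` G)%fset) rnorm (z l j) ^+ 2.
    by apply: ler_sum => l _; apply: fsum_subset_le; exact: fsubsetUl.
  lra.
apply/ler_addgt0Pr => e e0.
have s0 : 0 < (size s)%:R + 1 :> R by rewrite ltr_wpDl.
have [F hF] := approx (e / ((size s)%:R + 1)) (divr_gt0 e0 s0).
rewrite (le_trans hF)// lerD// mulrCA -[leRHS]mulr1 ler_wpM2l ?(ltW e0)//.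
by rewrite ler_pdivrMr// mul1r lerDl.
Qed.

Lemma ell2_scale_subproof (w : int -> R) x : (forall t, `|w t| <= 1) ->
  (fun j => (w j)%:C%C *: x j) \in @sqsummable R Y.
Proof.
move=> w1; apply/sqsummableP; exists (ell2norm x); first exact: ell2norm_ge0.
move=> F; rewrite (le_trans _ (ell2norm_fsum x F))//; apply: ler_sum => j _.
rewrite ler_pXn2r ?nnegrE ?rnorm_ge0// rnormZ rnorm_real.
by rewrite ler_piMl ?rnorm_ge0.
Qed.

End ell2_sums.

Section window_sums.
Context {R : realType}.

(** [f (i - k)] is nonzero only for k = i - t with 0 <= t < N, so the sum is reindexed by t. *)
Lemma window_sum (f : int -> R) (N : nat) (i : int) (K : {fset int}) :
  (forall t : int, f t != 0 -> 0 <= t < N%:Z) ->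
  \sum_(k <- K) f (i - k) =
  \sum_(t < N) (if i - t%:Z \in K then f t%:Z else 0).
Proof.
move=> fN.
transitivity (\sum_(k <- K) \sum_(t < N) (if k == i - t%:Z then f t%:Z else 0)).
  apply: eq_bigr => k _; have [f0|/fN] := eqVneq (f (i - k)) 0.
    rewrite f0 big1// => t _; case: eqP => // kE.
    by rewrite -f0; congr f; rewrite kE; lia.
  case E : (i - k) => [t|//] /= tN.
  rewrite (bigD1 (Ordinal tN))//= big1 ?addr0.
    by rewrite (_ : k = i - t%:Z) ?eqxx//; lia.
  move=> u ut; case: eqP => // kE; exfalso; move/negP: ut; apply.
  by apply/eqP/val_inj => /=; lia.
rewrite exchange_big; apply: eq_bigr => t _ /=.
have [tK|tK] := boolP (i - t%:Z \in K).
  rewrite (big_fsetD1 _ tK)/= eqxx big1_fset ?addr0// => k.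
  by rewrite !inE => /andP[/negPf->].
by rewrite big_seq big1// => k kK; case: eqP => // kE; rewrite -kE kK in tK.
Qed.

Lemma window_sum_le (f : int -> R) (N : nat) (i : int) (K : {fset int}) :
  (forall t, 0 <= f t) -> (forall t : int, f t != 0 -> 0 <= t < N%:Z) ->
  \sum_(k <- K) f (i - k) <= \sum_(t < N) f t%:Z.
Proof.
by move=> f0 fN; rewrite (window_sum _ _ fN); apply: ler_sum => t _; case: ifP.
Qed.

Lemma window_sum_eq (f : int -> R) (N : nat) (i : int) (K : {fset int}) :
  (forall t : int, f t != 0 -> 0 <= t < N%:Z) ->
  (forall t : nat, (t < N)%N -> i - t%:Z \in K) ->
  \sum_(k <- K) f (i - k) = \sum_(t < N) f t%:Z.
Proof.
by move=> fN iK; rewrite (window_sum _ _ fN); apply: eq_bigr => t _; rewrite iK.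
Qed.

(* Summed over many indices, this weighted Cauchy-Schwarz inequality gives
   Minkowski's inequality. *)
Lemma sqr_sum3_le (p q r P Q T : R) : 0 < P -> 0 < Q -> 0 < T ->
  (p + q + r) ^+ 2 <=
  (P + Q + T) * (p ^+ 2 / P + q ^+ 2 / Q + r ^+ 2 / T).
Proof.
move=> P0 Q0 T0.
have cross (a b A B : R) : 0 < A -> 0 < B ->
    2 * (a * b) <= B * (a ^+ 2 / A) + A * (b ^+ 2 / B).
  move=> A0 B0; have AB0 : 0 < A * B by rewrite mulr_gt0.
  rewrite -(ler_pM2r AB0).
  have -> : (B * (a ^+ 2 / A) + A * (b ^+ 2 / B)) * (A * B) =
    (a * B) ^+ 2 + (b * A) ^+ 2.
    by field; rewrite !gt_eqF.
  have := sqr_ge0 (a * B - b * A); lra.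
have diag (a A : R) : 0 < A -> A * (a ^+ 2 / A) = a ^+ 2.
  by move=> A0; rewrite mulrCA mulfV ?mulr1 ?gt_eqF.
have := cross p q P Q P0 Q0; have := cross p r P T P0 T0.
have := cross q r Q T Q0 T0.
have := diag p P P0; have := diag q Q Q0; have := diag r T T0; lra.
Qed.

End window_sums.

Section localization.
Context {R : realType} (Y : normedModType R[i]).
Variables (a b c : int -> Y -> Y) (na nc : R).
Hypothesis (na0 : 0 <= na) (nc0 : 0 <= nc).
Hypothesis (aZ : forall i (r : R) v, a i (r%:C%C *: v) = r%:C%C *: a i v).
Hypothesis (bZ : forall i (r : R) v, b i (r%:C%C *: v) = r%:C%C *: b i v).
Hypothesis (cZ : forall i (r : R) v, c i (r%:C%C *: v) = r%:C%C *: c i v).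
Hypothesis (a_le : forall i v, rnorm (a i v) <= na * rnorm v).
Hypothesis (c_le : forall i v, rnorm (c i v) <= nc * rnorm v).

(** With p, q, r the weights at i - 1, i, i + 1: the image of the cut-off sequence is the cut-off
    image plus commutator terms in q - p and r - q. *)
Lemma lincomb3E (p q r : R) (u v t : Y) :
  p%:C%C *: u + q%:C%C *: v + r%:C%C *: t =
  q%:C%C *: (u + v + t) + (- (q - p))%:C%C *: u + (r - q)%:C%C *: t.
Proof.
rewrite opprB !rmorphB !scalerBl !scalerDr.
move: (p%:C%C *: u) (q%:C%C *: u) (q%:C%C *: v) (r%:C%C *: t) (q%:C%C *: t).
move=> pu qu qv rt qt.
have -> : qu + qv + qt + (pu - qu) = pu + qv + qt by rewrite addrC !addrA subrK.
by rewrite -[RHS]addrA [qt + _]addrC subrK.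
Qed.

(** A relation between sequences rather than an operator, so that it covers A - lambda as well as
    its adjoint read through [dual_seq]. Coefficients are labelled by their column. *)
Definition tridiagonal_image (x z : int -> Y) := forall i,
  z i = a (i - 1) (x (i - 1)) + b i (x i) + c (i + 1) (x (i + 1)).

Variables (n : nat) (w : int -> R) (sigma : R).
Hypothesis (w1 : forall t, `|w t| <= 1).
Hypothesis (wn : forall t, w t != 0 -> 0 < t <= n%:Z).
Hypothesis (W0 : 0 < \sum_(t < n.+1) w t%:Z ^+ 2).
Hypothesis (sigma0 : 0 <= sigma).
Hypothesis (w_diff : \sum_(t < n.+1) (w (t%:Z + 1) - w t%:Z) ^+ 2 <=
  sigma ^+ 2 * \sum_(t < n.+1) w t%:Z ^+ 2).

(* Averaging over the position [k] of the window: the commutator of the operator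
   with the cut-off [w (j - k)] only involves the differences of [w]. *)
Lemma localization (q : R) (x z : ell2 Y) :
  (forall k (y : ell2 Y), supp_in (window n k) y ->
     exists2 z : ell2 Y, tridiagonal_image y z & q * ell2norm y <= ell2norm z) ->
  tridiagonal_image x z ->
  q * ell2norm x <= ell2norm z + (na + nc) * sigma * ell2norm x.
Proof.
move=> hq xz.
have X0 := ell2norm_ge0 x; have Z0 := ell2norm_ge0 z.
have [q0|q0] := leP q 0.
  rewrite (@le_trans _ _ 0)//; first by rewrite mulr_le0_ge0.
  by rewrite addr_ge0// !mulr_ge0// addr_ge0.
pose W := \sum_(t < n.+1) w t%:Z ^+ 2.
have Wgt0 : 0 < W := W0.
have w_diffW : \sum_(t < n.+1) (w (t%:Z + 1) - w t%:Z) ^+ 2 <= sigma ^+ 2 * W.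
  exact: w_diff.
pose dw t := w (t + 1) - w t.
(* The weight lives on 1, ..., n and its forward difference on 0, ..., n; both are summed over t < n
   + 1. *)
have wN (t : int) : w t ^+ 2 != 0 -> 0 <= t < n.+1%:Z.
  by rewrite sqrf_eq0 => /wn; lia.
have dwN (t : int) : dw t ^+ 2 != 0 -> 0 <= t < n.+1%:Z.
  rewrite sqrf_eq0 /dw; have [->|/wn] := eqVneq (w t) 0; last lia.
  by rewrite subr0 => /wn; lia.
pose y k : ell2 Y := Ell2 (ell2_scale_subproof x (fun t => w1 (t - k))).
have hy k : exists2 zk : ell2 Y, tridiagonal_image (y k) zk &
    q * ell2norm (y k) <= ell2norm zk.
  apply: (hq k) => j; rewrite /window /= => nj.
  have [->|/wn wj] := eqVneq (w (j - k)) 0; first by rewrite scale0r.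
  by exfalso; apply: nj; move: wj; lia.
have /choice[zz zzP] : forall k, exists zk : ell2 Y,
    tridiagonal_image (y k) zk /\ q * ell2norm (y k) <= ell2norm zk.
  by move=> k; have [zk h1 h2] := hy k; exists zk.
have zzE k i : rnorm (zz k i) <= `|w (i - k)| * rnorm (z i)
    + `|dw ((i - 1) - k)| * (na * rnorm (x (i - 1)))
    + `|dw (i - k)| * (nc * rnorm (x (i + 1))).
  have -> : zz k i = (w (i - k))%:C%C *: z i
      + (- dw ((i - 1) - k))%:C%C *: a (i - 1) (x (i - 1))
      + (dw (i - k))%:C%C *: c (i + 1) (x (i + 1)).
    rewrite (zzP k).1 xz /= aZ bZ cZ /dw.
    rewrite (_ : i - 1 - k + 1 = i - k); last lia.
    rewrite (_ : i - k + 1 = i + 1 - k); last lia.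
    exact: lincomb3E.
  rewrite (le_trans (rnormD _ _))// lerD//; last first.
    by rewrite rnormZ rnorm_real ler_wpM2l.
  rewrite (le_trans (rnormD _ _))// lerD//.
    by rewrite rnormZ rnorm_real.
  by rewrite rnormZ rnorm_real normrN ler_wpM2l.
(* The slack d makes the weights P, Q, T of [sqr_sum3_le] positive. Up to d they are the norm bounds
   of the three terms in [zzE], which is what yields Minkowski's inequality. *)
have main (d : R) (F : {fset int}) : 0 < d ->
    q ^+ 2 * \sum_(j <- F) rnorm (x j) ^+ 2 <=
    ((ell2norm z + d) + (na * sigma * ell2norm x + d)
      + (nc * sigma * ell2norm x + d)) ^+ 2.
  (* Contains every window position k whose weight can be nonzero on F. *)
  move=> d0; pose K : {fset int} :=
    [fset k in [seq j - t%:Z | j <- F, t <- iota 0 n.+1]]%fset.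
  have KF (j : int) (t : nat) : j \in F -> (t < n.+1)%N -> j - t%:Z \in K.
    move=> jF tn; rewrite !inE; apply/allpairsP; exists (j, t).
    by split=> //; rewrite mem_iota.
  set P := ell2norm z + d; set Q := na * _ * _ + d; set T := nc * _ * _ + d.
  have P0 : 0 < P by rewrite ltr_wpDl.
  have Q0 : 0 < Q by rewrite ltr_wpDl// !mulr_ge0.
  have T0 : 0 < T by rewrite ltr_wpDl// !mulr_ge0.
  have PQT0 : 0 < P + Q + T by exact: addr_gt0 (addr_gt0 P0 Q0) T0.
  rewrite -(ler_pM2l Wgt0) mulrCA.
  (* Each x_j with j in F is seen with total squared weight W by the windows in K. *)
  have -> : W * \sum_(j <- F) rnorm (x j) ^+ 2 =
      \sum_(k <- K) \sum_(j <- F) rnorm (y k j) ^+ 2.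
    rewrite exchange_big/= mulr_sumr big_seq [RHS]big_seq.
    apply: eq_bigr => j jF /=.
    under eq_bigr do rewrite rnormZ rnorm_real exprMn real_normK ?num_real//.
    rewrite -mulr_suml (@window_sum_eq _ (fun t => w t ^+ 2) n.+1 j K wN)//.
    by move=> t; exact: KF.
  rewrite (@le_trans _ _ (\sum_(k <- K) ell2norm (zz k) ^+ 2))//.
    rewrite mulr_sumr; apply: ler_sum => k _.
    rewrite (@le_trans _ _ ((q * ell2norm (y k)) ^+ 2))//.
      by rewrite exprMn ler_wpM2l ?sqr_ge0 ?ell2norm_fsum.
    rewrite ler_pXn2r ?nnegrE ?ell2norm_ge0// ?mulr_ge0 ?ell2norm_ge0 ?(ltW q0)//.
    exact: (zzP k).2.
  apply: sum_ell2norm_le => I.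
  rewrite exchange_big/= (@le_trans _ _ (\sum_(i <- I) \sum_(k <- K)
    (P + Q + T) * (w (i - k) ^+ 2 * (rnorm (z i) ^+ 2 / P)
      + dw ((i - 1) - k) ^+ 2 * (na ^+ 2 * rnorm (x (i - 1)) ^+ 2 / Q)
      + dw (i - k) ^+ 2 * (nc ^+ 2 * rnorm (x (i + 1)) ^+ 2 / T))))//.
    apply: ler_sum => i _; apply: ler_sum => k _.
    rewrite (@le_trans _ _ ((`|w (i - k)| * rnorm (z i)
      + `|dw ((i - 1) - k)| * (na * rnorm (x (i - 1)))
      + `|dw (i - k)| * (nc * rnorm (x (i + 1)))) ^+ 2))//.
      rewrite ler_pXn2r ?nnegrE ?rnorm_ge0 ?zzE//.
      by rewrite !addr_ge0// !mulr_ge0 ?rnorm_ge0.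
    rewrite (le_trans (sqr_sum3_le _ _ _ P0 Q0 T0))// ler_wpM2l//.
      exact: ltW.
    by rewrite !exprMn !real_normK ?num_real// !mulrA.
  have -> : W * (P + Q + T) ^+ 2 = (P + Q + T) * (W * (P + Q + T)).
    by rewrite expr2; ring.
  rewrite (eq_bigr (fun i => (P + Q + T) *
      ((\sum_(k <- K) w (i - k) ^+ 2) * (rnorm (z i) ^+ 2 / P)
      + (\sum_(k <- K) dw ((i - 1) - k) ^+ 2) * (na ^+ 2 * rnorm (x (i - 1)) ^+ 2 / Q)
      + (\sum_(k <- K) dw (i - k) ^+ 2) * (nc ^+ 2 * rnorm (x (i + 1)) ^+ 2 / T)))); last first.
    by move=> i _; rewrite -mulr_sumr !big_split/= -!mulr_suml.
  rewrite -mulr_sumr ler_wpM2l ?(ltW PQT0)//.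
  have divsq (u v U : R) : 0 < U -> u <= U ^+ 2 -> u / U <= U.
    by move=> U0; rewrite ler_pdivrMr// expr2.
  have quot1 (u U : R) : 0 < U -> 0 <= u ^+ 2 / U.
    by move=> U0; rewrite divr_ge0 ?sqr_ge0// ltW.
  have quot2 (u v U : R) : 0 < U -> 0 <= u ^+ 2 * v ^+ 2 / U.
    by move=> U0; rewrite -exprMn; exact: quot1.
  rewrite (@le_trans _ _ (\sum_(i <- I) (W * (rnorm (z i) ^+ 2 / P)
      + (sigma ^+ 2 * W) * (na ^+ 2 * rnorm (x (i - 1)) ^+ 2 / Q)
      + (sigma ^+ 2 * W) * (nc ^+ 2 * rnorm (x (i + 1)) ^+ 2 / T))))//.
    apply: ler_sum => i _; rewrite lerD//.
      rewrite lerD//.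
        rewrite ler_wpM2r ?quot1//.
        exact: (@window_sum_le _ (fun t => w t ^+ 2) n.+1 i K (fun=> sqr_ge0 _) wN).
      rewrite ler_wpM2r ?quot2// (le_trans _ w_diffW)//.
      exact: (@window_sum_le _ (fun t => dw t ^+ 2) n.+1 (i - 1) K (fun=> sqr_ge0 _) dwN).
    rewrite ler_wpM2r ?quot2// (le_trans _ w_diffW)//.
    exact: (@window_sum_le _ (fun t => dw t ^+ 2) n.+1 i K (fun=> sqr_ge0 _) dwN).
  rewrite !big_split/= -!mulr_sumr -!mulr_suml -!mulr_sumr mulrDr [W * (P + Q)]mulrDr.
  have sW0 : 0 <= sigma ^+ 2 * W by rewrite mulr_ge0 ?sqr_ge0 ?(ltW Wgt0).
  rewrite lerD//; first rewrite lerD//.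
  - rewrite ler_wpM2l ?(ltW Wgt0)// divsq// (le_trans (ell2norm_fsum z I))//.
    by rewrite ler_pXn2r ?nnegrE ?ell2norm_ge0 ?(ltW P0)// lerDl ltW.
  - rewrite [sigma ^+ 2 * W]mulrC -[leLHS]mulrA ler_wpM2l ?(ltW Wgt0)// mulrA divsq//.
    rewrite (@le_trans _ _ ((na * sigma * ell2norm x) ^+ 2))//.
      rewrite !exprMn mulrA [na ^+ 2 * _]mulrC ler_wpM2l ?mulr_ge0 ?sqr_ge0//.
      exact: shifted_sum_le.
    by rewrite ler_pXn2r ?nnegrE ?mulr_ge0 ?(ltW Q0)// lerDl ltW.
  - rewrite [sigma ^+ 2 * W]mulrC -[leLHS]mulrA ler_wpM2l ?(ltW Wgt0)// mulrA divsq//.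
    rewrite (@le_trans _ _ ((nc * sigma * ell2norm x) ^+ 2))//.
      rewrite !exprMn mulrA [nc ^+ 2 * _]mulrC ler_wpM2l ?mulr_ge0 ?sqr_ge0//.
      exact: shifted_sum_le.
    by rewrite ler_pXn2r ?nnegrE ?mulr_ge0 ?(ltW T0)// lerDl ltW.
apply/ler_addgt0Pr => e e0.
have d0 : 0 < e / 3 by rewrite divr_gt0.
rewrite -(rnorm_pos (ltW q0)) -rnorm_ell2 -rnormZ rnorm_ell2.
apply: ell2norm_le => [|F].
  by rewrite addr_ge0 ?(ltW e0)// addr_ge0// !mulr_ge0// addr_ge0.
rewrite fsumZ (rnorm_pos (ltW q0)) (le_trans (main _ F d0))//.
by rewrite le_eqVlt; apply/orP; left; apply/eqP; congr (_ ^+ 2); field.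
Qed.

End localization.

(** * The sine weights *)

Section sine_weights.
Context {R : realType} (n : nat).

Let theta : R := pi / n.+1%:R.
Let s (m : nat) : R := sin (m%:R * theta).

(** The first Dirichlet eigenvector of the second difference on 1, ..., n, extended by zero. *)
Definition sine_weight (t : int) : R :=
  if t is Posz m then if (m <= n)%N then s m else 0 else 0.

Lemma sine_weight_le1 t : `|sine_weight t| <= 1.
Proof.
case: t => m /=; last by rewrite normr0.
by case: ifP; rewrite ?normr0// => _; rewrite ler_norml sin_geN1 sin_le1.
Qed.

Lemma sine_weight_supp t : sine_weight t != 0 -> 0 < t <= n%:Z.
Proof.
case: t => m /=; last by rewrite eqxx.
case: ifP => [mn|_]; last by rewrite eqxx.
case: m mn => [|m] mn; first by rewrite /s mul0r sin0 eqxx.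
by move=> _; lia.
Qed.

Lemma theta_gt0 : 0 < theta.
Proof. by rewrite divr_gt0 ?pi_gt0. Qed.

Lemma sine_weight_sum_gt0 : (0 < n)%N ->
  0 < \sum_(t < n.+1) sine_weight t%:Z ^+ 2.
Proof.
move=> n0; have n1 : (1 < n.+1)%N by rewrite ltnS.
rewrite (bigD1 (Ordinal n1))//= ltr_pwDl//; last first.
  by apply: sumr_ge0 => i _; exact: sqr_ge0.
rewrite n0 exprn_gt0// /s mul1r sin_gt0_pi// theta_gt0/= /theta.
by rewrite ltr_pdivrMr// ltr_pMr ?pi_gt0// ltr1n.
Qed.

Lemma s_rec m : s m.+2 = 2 * cos theta * s m.+1 - s m.
Proof.
rewrite /s (_ : m.+2%:R * theta = m.+1%:R * theta + theta); last first.
  by rewrite -natr1 mulrDl mul1r.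
rewrite (_ : m%:R * theta = m.+1%:R * theta - theta); last first.
  by rewrite -natr1 mulrDl mul1r addrK.
rewrite sinD sinB; ring.
Qed.

(* Summation by parts, using that [s] solves the difference equation [s_rec] *)
Lemma s_diff_sum m : \sum_(t < m) (s t.+1 - s t) ^+ 2 =
  (2 - 2 * cos theta) * \sum_(t < m) s t ^+ 2
  + s m ^+ 2 * (1 - 2 * cos theta) + s m * s m.+1.
Proof.
elim: m => [|m IH].
  by rewrite !big_ord0 /s mul0r sin0 mulr0 expr0n !mul0r !addr0.
rewrite !big_ord_recr/= IH s_rec; ring.
Qed.

(** The boundary terms in [s_diff_sum] vanish because s (n + 1) = sin pi = 0, and 2 - 2 cos theta =
    (2 sin (theta / 2))^2. *)
Lemma sine_weight_diff : \sum_(t < n.+1)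
    (sine_weight (t%:Z + 1) - sine_weight t%:Z) ^+ 2 <=
  (2 * sin (pi / (2 * n.+1%:R))) ^+ 2 * \sum_(t < n.+1) sine_weight t%:Z ^+ 2.
Proof.
have sn : s n.+1 = 0.
  by rewrite /s /theta mulrC divfK ?sinpi// pnatr_eq0.
rewrite (eq_bigr (fun t : 'I_n.+1 => (s t.+1 - s t) ^+ 2)); last first.
  move=> t _; congr ((_ - _) ^+ 2); last by rewrite /= -ltnS ltn_ord.
  rewrite (_ : t%:Z + 1 = Posz t.+1) /=; last lia.
  case: leqP => // nt; rewrite (_ : t.+1 = n.+1) ?sn//.
  by have := ltn_ord t; lia.
rewrite [in leRHS](eq_bigr (fun t : 'I_n.+1 => s t ^+ 2)); last first.
  by move=> t _ /=; rewrite -ltnS ltn_ord.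
rewrite s_diff_sum sn expr0n/= !mul0r !addr0 le_eqVlt; apply/orP; left.
apply/eqP; congr (_ * _).
have -> : theta = pi / (2 * n.+1%:R) + pi / (2 * n.+1%:R).
  rewrite /theta; have : n.+1%:R != 0 :> R by rewrite pnatr_eq0.
  by move: (n.+1%:R) => N N0; field.
rewrite cosD; have := cos2Dsin2 (pi / (2 * n.+1%:R) : R).
rewrite !expr2; nra.
Qed.

End sine_weights.

Section real_cauchy_schwarz.
Context {R : realType} (I : Type) (r : seq I).

(** Discriminant of the sum of the (p i - t q i)^2, a nonnegative quadratic polynomial in t. *)
Lemma sum_mul_sqr_le (p q : I -> R) :
  (\sum_(i <- r) p i * q i) ^+ 2 <=
  (\sum_(i <- r) p i ^+ 2) * (\sum_(i <- r) q i ^+ 2).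
Proof.
set b := \sum_(i <- r) _; set a := \sum_(i <- r) p i ^+ 2; set c := \sum_(i <- r) _.
have quad t : 0 <= a - 2 * t * b + t ^+ 2 * c.
  rewrite [leRHS](_ : _ = \sum_(i <- r) (p i - t * q i) ^+ 2).
    by apply: sumr_ge0 => i _; exact: sqr_ge0.
  rewrite /a /b /c -mulNr !mulr_sumr -!big_split/=; apply: eq_bigr => i _; ring.
have c0 : 0 <= c by apply: sumr_ge0 => i _; exact: sqr_ge0.
(* For c = 0 the polynomial is affine in t, and t = (a + 1) / (2 b) makes it -1 unless b = 0. *)
move: c0; rewrite le_eqVlt => /orP[/eqP c0|c0].
  have [b0|b0] := eqVneq b 0; first by rewrite b0 -c0 mulr0 expr0n.
  have := quad ((a + 1) / (2 * b)); rewrite -c0 mulr0 addr0.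
  have -> : 2 * ((a + 1) / (2 * b)) * b = a + 1.
    by field.
  lra.
have := quad (b / c).
have -> : a - 2 * (b / c) * b + (b / c) ^+ 2 * c = (a * c - b ^+ 2) / c.
  by field; rewrite gt_eqF.
by rewrite pmulr_lge0 ?invr_gt0// subr_ge0.
Qed.

Lemma sum_mul_le (p q : I -> R) (P Q : R) : 0 <= P -> 0 <= Q ->
  \sum_(i <- r) p i ^+ 2 <= P ^+ 2 -> \sum_(i <- r) q i ^+ 2 <= Q ^+ 2 ->
  \sum_(i <- r) p i * q i <= P * Q.
Proof.
move=> P0 Q0 pP qQ.
have h : (\sum_(i <- r) p i * q i) ^+ 2 <= (P * Q) ^+ 2.
  rewrite (le_trans (sum_mul_sqr_le p q))// exprMn ler_pM//.
    by apply: sumr_ge0 => i _; exact: sqr_ge0.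
  by apply: sumr_ge0 => i _; exact: sqr_ge0.
rewrite (le_trans (ler_norm _))// -(@ler_pXn2r _ 2)// ?nnegrE ?mulr_ge0//.
by rewrite real_normK ?num_real.
Qed.

End real_cauchy_schwarz.

(** * The dual of [ell2 X] inside [ell2 (dual X)] *)

Section ell2_duality.
Context {R : realType} (X : normedModType R[i]).
Implicit Types (x : ell2 X) (phi : dual (ell2 X)).

Lemma ell2D x y j : (x + y) j = x j + y j. Proof. by []. Qed.

Lemma ell2B x y j : (x - y) j = x j - y j. Proof. by []. Qed.

Lemma ell2Z a x j : (a *: x) j = a *: x j. Proof. by []. Qed.

Fact coord_subproof (j : int) : (fun x : ell2 X => x j) \in @bounded_op R (ell2 X) X.
Proof.
apply/asboolP; split => //; exists 1 => x; rewrite mul1r; exact: rnorm_ell2_coord.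
Qed.

Definition coord j : 'L(ell2 X, X) := Bop (coord_subproof j).

Lemma sum_singleE (F : {fset int}) (x : int -> X) (i : int) :
  (\sum_(j <- F) single j (x j)) i = if i \in F then x i else 0.
Proof.
rewrite -[LHS]/(coord i (\sum_(j <- F) single j (x j))) bop_sum /=.
have [iF|iF] := boolP (i \in F).
  rewrite (big_fsetD1 i)//= /single_fun eqxx big1_fset ?addr0// => j.
  by rewrite !inE eq_sym => /andP[/negPf->].
by rewrite big_seq big1// => j jF; rewrite /single_fun; case: eqP => // ij; rewrite ij jF in iF.
Qed.

Lemma ell2_tail_le x (F : {fset int}) (e : R) : 0 <= e ->
  ell2norm x ^+ 2 <= \sum_(j <- F) rnorm (x j) ^+ 2 + e ^+ 2 ->
  ell2norm (x - \sum_(j <- F) single j (x j)) <= e.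
Proof.
move=> e0 hF; apply: ell2norm_le => // G.
rewrite (eq_bigr (fun j => if j \in F then 0 else rnorm (x j) ^+ 2)); last first.
  move=> j _; rewrite -[(x - _) j]/(x j - (\sum_(j <- F) single j (x j)) j).
  by rewrite sum_singleE; case: ifP; rewrite ?subrr ?rnorm0 ?expr0n ?subr0.
rewrite -(lerD2l (\sum_(j <- F) rnorm (x j) ^+ 2)) (le_trans _ hF)//.
rewrite (le_trans _ (ell2norm_fsum x (F `|` G)%fset))//.
rewrite [leRHS](big_fsetID _ (mem F))/=.
rewrite (_ : [fset j in (F `|` G)%fset | j \in F]%fset = F); last first.
  by apply/fsetP => j; rewrite !inE/=; case: (j \in F); rewrite ?andbF.
rewrite lerD2l; under eq_bigr do rewrite -if_neg.
rewrite -big_mkcond big_fset_condE/=.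
rewrite (_ : [fset i | i in G & i \notin F]%fset =
   [fset j in (F `|` G)%fset | j \notin F]%fset)//.
by apply/fsetP => j; rewrite !inE/=; case: (j \in F); rewrite ?andbF.
Qed.

Lemma dual_coordE phi j v : dual_coord phi j v = phi (single j v).
Proof. by []. Qed.

(** A phase makes the value [phi v] real, so that such values can be added without cancellation. *)
Lemma near_norming (V : normedModType R[i]) (phi : dual V) (d : R) : 0 < d ->
  exists v : V, exists t : R,
    [/\ rnorm v <= 1, phi v = t%:C%C & rnorm phi - d <= t].
Proof.
move=> d0; have [_ [v /= v1 <-] hv] := sup_adherent d0 (opnorm_has_sup phi).
have [u [u1 ux]] := phaseP (phi v : R[i]).
exists (u *: v), (rnorm (phi v)); split.
- by rewrite rnormZ u1 mul1r.
- by rewrite bopZ.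
- exact: ltW.
Qed.

(** Test phi on x = sum of |phi_j| v_j, with v_j nearly norming for phi_j: then phi x is nearly S
    while |x| <= sqrt S, so S <= |phi| sqrt S. *)
Lemma dual_coord_fsum phi (F : {fset int}) :
  \sum_(j <- F) rnorm (dual_coord phi j) ^+ 2 <= rnorm phi ^+ 2.
Proof.
set S := \sum_(j <- F) _.
have S0 : 0 <= S by apply: sumr_ge0 => j _; exact: sqr_ge0.
pose T := \sum_(j <- F) rnorm (dual_coord phi j).
have T0 : 0 <= T by apply: sumr_ge0 => j _; exact: rnorm_ge0.
have key : S <= rnorm phi * Num.sqrt S.
  apply/ler_addgt0Pr => e e0.
  (* The error at j is weighted by |phi_j|, so the total error is at most T e / (T + 1) <= e. *)
  have d0 : 0 < e / (T + 1) by rewrite divr_gt0// ltr_wpDl.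
  have /choice[v hv] : forall j, exists v : X, rnorm v <= 1 /\ exists2 t : R,
      dual_coord phi j v = t%:C%C & rnorm (dual_coord phi j) - e / (T + 1) <= t.
    move=> j; have [v [t [v1 vt ht]]] := near_norming (dual_coord phi j) d0.
    by exists v; split => //; exists t.
  pose y j := (rnorm (dual_coord phi j))%:C%C *: v j.
  pose x := \sum_(j <- F) single j (y j).
  have xS : ell2norm x <= Num.sqrt S.
    apply: ell2norm_le; first exact: sqrtr_ge0.
    move=> G; rewrite sqr_sqrtr//.
    rewrite (eq_bigr (fun j => if j \in F then rnorm (y j) ^+ 2 else 0)); last first.
      by move=> j _; rewrite sum_singleE; case: ifP; rewrite ?rnorm0 ?expr0n.
    rewrite -big_mkcond big_fset_condE/= (@le_trans _ _ (\sum_(j <- F) rnorm (y j) ^+ 2))//.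
      rewrite [leRHS](big_fsetID _ (mem G))/=.
      rewrite (_ : [fset i | i in G & i \in F]%fset = [fset j in F | j \in G]%fset).
        by rewrite lerDl; apply: sumr_ge0 => j _; exact: sqr_ge0.
      by apply/fsetP => j; rewrite !inE/= andbC.
    apply: ler_sum => j _; rewrite ler_pXn2r ?nnegrE ?rnorm_ge0//.
    rewrite rnormZ rnorm_pos ?rnorm_ge0// ler_piMr ?rnorm_ge0//.
    exact: (hv j).1.
  have phx : S - e <= rnorm (phi x : R[i]).
    rewrite (le_trans _ (Re_le_rnorm _))// bop_sum.
    have -> : complex.Re (\sum_(j <- F) phi (single j (y j)) : R[i]) =
        \sum_(j <- F) complex.Re (phi (single j (y j)) : R[i]).
      by elim/big_rec2 : _ => // j a b _ <-; rewrite ReD.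
    apply: (@le_trans _ _ (\sum_(j <- F) (rnorm (dual_coord phi j) ^+ 2 -
        (e / (T + 1)) * rnorm (dual_coord phi j)))).
      rewrite big_split/= sumrN -mulr_sumr lerD2l lerN2 -/T mulrAC.
      by rewrite ler_pdivrMr ?ltr_wpDl// ler_wpM2l ?(ltW e0)// lerDl.
    apply: ler_sum => j _; rewrite -dual_coordE bopZ.
    have [t -> ht] := (hv j).2.
    rewrite [leRHS](_ : _ = rnorm (dual_coord phi j) * t); last first.
      by rewrite /= mul0r subr0.
    rewrite expr2 -mulrBl mulrC ler_wpM2l ?rnorm_ge0//.
  have := le_trans phx (rnorm_functional phi x).
  rewrite lerBlDr => /le_trans; apply; rewrite lerD2r.
  by rewrite ler_wpM2l ?rnorm_ge0.
have sS := sqr_sqrtr S0; move: key.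
have : 0 <= Num.sqrt S := sqrtr_ge0 S; rewrite -{2}sS le_eqVlt => /orP[/eqP s0 _|s0].
  by rewrite -sS -s0 expr0n sqr_ge0.
rewrite expr2 ler_pM2r// => h; rewrite -sS.
by rewrite ler_pXn2r ?nnegrE ?rnorm_ge0// ltW.
Qed.

(** Split x into finitely many coordinates, handled by Cauchy-Schwarz, and a tail, made small by the
    boundedness of phi. *)
Lemma dual_norm_le phi (M : R) : 0 <= M ->
  (forall F : {fset int}, \sum_(j <- F) rnorm (dual_coord phi j) ^+ 2 <= M ^+ 2) ->
  rnorm phi <= M.
Proof.
move=> M0 hM; rewrite rnorm_bop; apply: opnorm_le => x x1.
apply/ler_addgt0Pr => e e0.
have d0 : 0 < e / (rnorm phi + 1) by rewrite divr_gt0// ltr_wpDl ?rnorm_ge0.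
have [F hF] := ell2norm_approx x (exprn_gt0 2 d0).
have tail := ell2_tail_le (ltW d0) hF.
rewrite -[x](subrK (\sum_(j <- F) single j (x j))) bopD addrC.
rewrite (le_trans (rnormD _ _))// lerD//.
  rewrite bop_sum (le_trans (rnorm_sum _ _ _))//.
  rewrite (@le_trans _ _ (\sum_(j <- F) rnorm (dual_coord phi j) * rnorm (x j)))//.
    by apply: ler_sum => j _; rewrite -dual_coordE rnorm_functional.
  rewrite -[leRHS]mulr1; apply: sum_mul_le => //.
  rewrite (le_trans (ell2norm_fsum x F))// ler_pXn2r ?nnegrE ?ell2norm_ge0//.
rewrite (le_trans (rnorm_functional _ _))//.
rewrite (@le_trans _ _ (rnorm phi * (e / (rnorm phi + 1))))//.
  by rewrite ler_wpM2l ?rnorm_ge0.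
rewrite mulrCA -[leRHS]mulr1 ler_wpM2l ?(ltW e0)//.
by rewrite ler_pdivrMr ?ltr_wpDl ?rnorm_ge0// mul1r lerDl.
Qed.

Fact dual_seq_subproof phi : dual_coord phi \in @sqsummable R (dual X).
Proof.
apply/sqsummableP; exists (rnorm phi); first exact: rnorm_ge0.
exact: dual_coord_fsum.
Qed.

Definition dual_seq phi : ell2 (dual X) := Ell2 (dual_seq_subproof phi).

Lemma dual_seq_norm phi : ell2norm (dual_seq phi) = rnorm phi.
Proof.
apply/eqP; rewrite eq_le; apply/andP; split.
  by apply: ell2norm_le; [exact: rnorm_ge0|exact: dual_coord_fsum].
by apply: dual_norm_le; [exact: ell2norm_ge0|exact: (ell2norm_fsum (dual_seq phi))].
Qed.

(** Inverse of [dual_seq] on finitely supported sequences, which is all that windows ask for. *)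
Definition dual_of_fsupp (F : {fset int}) (y : int -> dual X) : dual (ell2 X) :=
  \sum_(j <- F) (comp_bop (y j) (coord j) : dual (ell2 X)).

Lemma dual_of_fsuppE F y j : dual_coord (dual_of_fsupp F y) j = if j \in F then y j else 0.
Proof.
apply: bop_ext => v; rewrite dual_coordE /dual_of_fsupp.
have -> (w : ell2 X) : (\sum_(j <- F) (comp_bop (y j) (coord j) : dual (ell2 X))) w =
    \sum_(j <- F) y j (w j).
  by elim/big_rec2 : _ => // k a b _ <-.
rewrite /= /single_fun; have [jF|jF] := boolP (j \in F).
  rewrite (big_fsetD1 j)//= eqxx big1_fset ?addr0// => k.
  by rewrite !inE => /andP[/negPf-> _] _; rewrite bop0.
rewrite big_seq big1// => k kF; case: eqP => [kj|_]; last by rewrite bop0.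
by rewrite -kj kF in jF.
Qed.

End ell2_duality.

Section lower_norms.
Context {R : realType}.

(** By scaling, unit vectors of F test all of F. If F has no unit vector, it contains at most 0 and
    both sides hold. *)
Lemma lower_norm_geP (U V : normedModType R[i]) (B : 'L(U, V)) (F : set U) (c : R) :
  (forall (a : R[i]) x, F x -> F (a *: x)) ->
  (c%:E <= lower_norm B F)%E <-> forall x, F x -> c * rnorm x <= rnorm (B x).
Proof.
move=> FZ; split=> [h x Fx|h].
  have [->|x0] := eqVneq x 0; first by rewrite rnorm0 mulr0 rnorm_ge0.
  have x_gt0 : 0 < rnorm x by rewrite rnorm_gt0.
  pose u := (rnorm x)^-1%:C%C *: x.
  have : (c%:E <= (rnorm (B u))%:E)%E.
    apply: le_trans h _; apply: ereal_inf_lbound; exists u => //.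
    by split; [exact: FZ|exact: normalize_rnorm].
  rewrite lee_fin bopZ rnormZ rnorm_pos ?invr_ge0 ?rnorm_ge0//.
  by rewrite ler_pdivlMl// mulrC.
apply: le_ereal_inf_tmp => _ [x [Fx x1] <-]; rewrite lee_fin.
by have := h x Fx; rewrite x1 mulr1.
Qed.

Variable X : normedModType R[i].
Implicit Type B : 'L(ell2 X, ell2 X).

Lemma supp_inZ W (a : R[i]) (x : ell2 X) : supp_in W x -> supp_in W (a *: x).
Proof.
by move=> h j nj; rewrite -[LHS]/(a *: x j) (h j nj) scaler0.
Qed.

Lemma dual_supp_inZ W (a : R[i]) (phi : dual (ell2 X)) :
  dual_supp_in W phi -> dual_supp_in W (a *: phi).
Proof.
move=> h j nj; apply: bop_ext => v.
by rewrite dual_coordE dualZ -dual_coordE (h j nj) scaler0.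
Qed.

Lemma mu_geP (n : nat) B (c : R) : (c%:E <= mu n B)%E <->
  forall k, (forall x, supp_in (window n k) x -> c * rnorm x <= rnorm (B x)) /\
  (forall phi, dual_supp_in (window n k) phi ->
     c * rnorm phi <= rnorm (adjoint B phi)).
Proof.
split=> [h k|h].
  have : (c%:E <= mine (lower_norm B (supp_in (window n k)))
              (lower_norm (adjoint B) (dual_supp_in (window n k))))%E.
    by apply: le_trans h _; apply: ereal_inf_lbound; exists k.
  rewrite le_min => /andP[h1 h2]; split.
    by apply/(lower_norm_geP _ _ (@supp_inZ _)).
  by apply/(lower_norm_geP _ _ (@dual_supp_inZ _)).
apply: le_ereal_inf_tmp => _ [k _ <-]; rewrite le_min; apply/andP; split.
  by apply/(lower_norm_geP _ _ (@supp_inZ _)); exact: (h k).1.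
by apply/(lower_norm_geP _ _ (@dual_supp_inZ _)); exact: (h k).2.
Qed.

Lemma bounded_below_mu (n : nat) B (c : R) : bounded_below c B -> (c%:E <= mu n B)%E.
Proof. by move=> [h1 h2]; apply/mu_geP => k; split=> x _. Qed.

End lower_norms.

Section tridiagonal_localization.
Context {R : realType} (X : normedModType R[i]) (A : 'L(ell2 X, ell2 X)).
Variables (alpha beta gamma : int -> 'L(X, X)).
Hypothesis A_tridiag : tridiagonal A alpha beta gamma.

Lemma seq_norm_ub (a : int -> 'L(X, X)) j : bounded_seq a -> rnorm (a j) <= seq_norm a.
Proof. by move=> ba; apply: ub_le_sup => //; exists j. Qed.

Lemma seq_norm_ge0 (a : int -> 'L(X, X)) : bounded_seq a -> 0 <= seq_norm a.
Proof. by move=> ba; rewrite (le_trans _ (seq_norm_ub 0 ba))// rnorm_ge0. Qed.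

(** Column i of the matrix; a coordinate of the adjoint image is phi composed with such a column. *)
Lemma shift_single (l : R[i]) i v :
  shift_op A l (inject X i v) = inject X (i + 1) (alpha i v)
    + inject X i (beta i v - l *: v) + inject X (i - 1) (gamma i v).
Proof.
have [_ _ _ AE] := A_tridiag; apply: ell2_ext => j.
rewrite shift_opE ell2B ell2Z AE !ell2D /= /single_fun.
rewrite (_ : (j == i + 1) = (j - 1 == i)); last by apply/eqP/eqP; lia.
rewrite (_ : (j == i - 1) = (j + 1 == i)); last by apply/eqP/eqP; lia.
have [->|ji] := eqVneq j i.
  rewrite (_ : (i - 1 == i) = false); last by apply/negbTE/eqP; lia.
  rewrite (_ : (i + 1 == i) = false); last by apply/negbTE/eqP; lia.
  by rewrite !bop0 !add0r !addr0.
have [e|jm] := eqVneq (j - 1) i.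
  rewrite (_ : (j + 1 == i) = false); last by apply/negbTE/eqP; lia.
  by rewrite e !bop0 scaler0 !addr0 subr0.
have [e|jp] := eqVneq (j + 1) i.
  by rewrite e !bop0 scaler0 !add0r subr0.
by rewrite !bop0 scaler0 !addr0 subr0.
Qed.

Lemma adjoint_shift_coord (l : R[i]) (phi : dual (ell2 X)) i :
  dual_coord (adjoint (shift_op A l) phi) i =
  (comp_bop (dual_coord phi (i - 1)) (gamma i) : dual X)
  + ((comp_bop (dual_coord phi i) (beta i) : dual X) - l *: dual_coord phi i)
  + (comp_bop (dual_coord phi (i + 1)) (alpha i) : dual X).
Proof.
apply: bop_ext => v.
rewrite comp_bopE adjointE shift_single !(bopD, bopN, bopZ).
rewrite dualD dualD dualB dualZ !comp_bopE.
by rewrite [LHS]addrC [LHS]addrA [LHS]addrAC.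
Qed.

(** [localization] is used twice: for A - l on [ell2 X], and for the adjoint on [ell2 (dual X)],
    where alpha and gamma exchange their places. *)
Lemma mu_bounded_below (n : nat) (l : R[i]) (c : R) : (0 < n)%N ->
  (c%:E <= mu n (shift_op A l))%E ->
  bounded_below (c - eps'' alpha gamma n) (shift_op A l).
Proof.
move=> n0 /mu_geP h; have [ba bb bc AE] := A_tridiag.
have na0 := seq_norm_ge0 ba; have nc0 := seq_norm_ge0 bc.
pose sigma : R := 2 * sin (pi / (2 * n.+1%:R)).
have sigma0 : 0 <= sigma.
  rewrite mulr_ge0// sin_ge0_pi// divr_ge0 ?pi_ge0//=.
  by rewrite ler_pdivrMr// ler_peMr ?pi_ge0// -natrM ler1n.
have epsE : eps'' alpha gamma n = (seq_norm alpha + seq_norm gamma) * sigma.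
  by rewrite /eps'' /sigma mulrCA mulrA.
split=> x; rewrite mulrBl lerBlDr epsE.
  rewrite !rnorm_ell2. refine (@localization _ X (fun i v => alpha i v)
    (fun i v => beta i v - l *: v) (fun i v => gamma i v)
    (seq_norm alpha) (seq_norm gamma) na0 nc0 _ _ _ _ _
    n (sine_weight n) sigma (sine_weight_le1 n) (@sine_weight_supp R n) 
    (sine_weight_sum_gt0 n0) sigma0 (sine_weight_diff n)
    c x (shift_op A l x) _ _).
  - by move=> i r v; rewrite bopZ.
  - by move=> i r v; rewrite bopZ scalerBr !scalerA mulrC.
  - by move=> i r v; rewrite bopZ.
  - move=> i v; rewrite (le_trans (opnormP _ _))// ler_wpM2r ?rnorm_ge0//.
    exact: (seq_norm_ub i ba).
  - move=> i v; rewrite (le_trans (opnormP _ _))// ler_wpM2r ?rnorm_ge0//.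
    exact: (seq_norm_ub i bc).
  - move=> k y ky; exists (shift_op A l y); last exact: (h k).1.
    move=> i; rewrite shift_opE ell2B ell2Z AE /=.
    by rewrite -!addrA; congr (_ + (_ + _)); rewrite addrC.
  - move=> i; rewrite shift_opE ell2B ell2Z AE /=.
    by rewrite -!addrA; congr (_ + (_ + _)); rewrite addrC.
rewrite [seq_norm alpha + _]addrC -!dual_seq_norm.
(* In row i of the adjoint the coefficient of phi_(i-1) is gamma i and that of phi_(i+1) is alpha i;
   labelling them by column causes the index shifts. *)
have tri (phi : dual (ell2 X)) : tridiagonal_image
    (fun i (psi : dual X) => comp_bop psi (gamma (i + 1)) : dual X)
    (fun i (psi : dual X) => (comp_bop psi (beta i) : dual X) - l *: psi)
    (fun i (psi : dual X) => comp_bop psi (alpha (i - 1)) : dual X)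
    (dual_seq phi) (dual_seq (adjoint (shift_op A l) phi)).
  by move=> i /=; rewrite adjoint_shift_coord subrK addrK.
have compZ (f : 'L(X, X)) (r : R) (psi : dual X) :
    comp_bop (r%:C%C *: psi) f = r%:C%C *: (comp_bop psi f : dual X).
  exact: bop_ext.
apply: (@localization _ (dual X) _ _ _
    (seq_norm gamma) (seq_norm alpha) nc0 na0 _ _ _ _ _
    n (sine_weight n) sigma (sine_weight_le1 n) (@sine_weight_supp R n) 
    (sine_weight_sum_gt0 n0) sigma0 (sine_weight_diff n)
    c (dual_seq x) _ _ (tri x)).
- by move=> i r psi; exact: compZ.
- by move=> i r psi; rewrite compZ scalerBr !scalerA mulrC.
- by move=> i r psi; exact: compZ.
- move=> i psi; rewrite (le_trans (opnorm_comp _ _))// mulrC ler_wpM2r ?opnorm_ge0//.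
  exact: (seq_norm_ub _ bc).
- move=> i psi; rewrite (le_trans (opnorm_comp _ _))// mulrC ler_wpM2r ?opnorm_ge0//.
  exact: (seq_norm_ub _ ba).
- move=> k y ky.
  (* As y is supported in a window, it is the coordinate sequence of a functional to which the bound
     on [mu] applies. *)
  pose F : {fset int} := [fset j in [seq (k + t%:Z)%R | t <- iota 1 n]]%fset.
  pose phi := dual_of_fsupp F y.
  have phiE : dual_seq phi = y.
    apply: ell2_ext => j; rewrite /= dual_of_fsuppE; case: ifPn => // jF.
    apply/esym/ky => jw; move/negP: jF; apply; rewrite !inE.
    apply/mapP; exists `|j - k|%N; last first.
      by move: jw; rewrite /window/=; lia.
    by rewrite mem_iota; move: jw; rewrite /window/=; lia.
  exists (dual_seq (adjoint (shift_op A l) phi)).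
    by rewrite -phiE; exact: tri.
  rewrite -phiE !dual_seq_norm; apply: (h k).2 => j nj.
  by rewrite -[LHS]/(dual_seq phi j) phiE ky.
Qed.

End tridiagonal_localization.

(** * Convergence in the Hausdorff distance *)

Section ultralimits.
Context {R : realType} (U : set_system nat).
Context {UU : UltraFilter U}.

Definition ulim (V : normedZmodType R[i]) (u : nat -> V) (l : V) :=
  forall e : R, 0 < e -> U [set n | rnorm (u n - l) <= e].

(** The limit is the supremum of the t with t <= u n for U-almost all n; since U is an ultrafilter,
    u n < sup S + e holds U-almost everywhere. *)
Lemma real_ulim (u : nat -> R) (M : R) : U [set n | `|u n| <= M] ->
  exists l : R, forall e, 0 < e -> U [set n | `|u n - l| <= e].
Proof.
move=> uM; pose S := [set t : R | U [set n | t <= u n]].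
have S0 : S (- M).
  by apply: filterS uM => n /=; rewrite ler_norml => /andP[].
have Sub : ubound S M.
  move=> t St; rewrite leNgt; apply/negP => Mt.
  have [n [/= h1 h2]] := filter_ex (filterI St uM).
  have := le_trans h1 (le_trans (ler_norm _) h2); rewrite leNgt Mt//.
have hS : has_sup S by split; [exists (- M)|exists M].
exists (sup S) => e e0.
have [t St tS] := sup_adherent e0 hS.
have nS : ~ S (sup S + e).
  move=> h; have := ub_le_sup hS.2 h; rewrite leNgt ltrDl e0//.
have /filterI/(_ St) : U (~` [set n | sup S + e <= u n]).
  by have [] := @in_ultra_setVsetC _ U [set n | sup S + e <= u n] UU.
apply: filterS => n [/= /negP]; rewrite -ltNge => h1 h2.
rewrite ler_norml; apply/andP; split; first by rewrite lerBrDr addrC (le_trans (ltW tS)).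
by rewrite lerBlDr addrC ltW.
Qed.

Lemma complex_ulim (u : nat -> R[i]) (M : R) : U [set n | rnorm (u n) <= M] ->
  exists l : R[i], ulim u l.
Proof.
move=> uM.
have [a ha] := @real_ulim (fun n => complex.Re (u n)) M
  (filterS (fun n h => le_trans (absRe_le_rnorm (u n)) h) uM).
have [b hb] := @real_ulim (fun n => complex.Im (u n)) M
  (filterS (fun n h => le_trans (absIm_le_rnorm (u n)) h) uM).
exists (a +i* b)%C => e e0; have e20 : 0 < e / 2 by rewrite divr_gt0.
apply: filterS (filterI (ha _ e20) (hb _ e20)) => n [/= h1 h2].
rewrite (le_trans (rnorm_le_ReIm _))// [leRHS](splitr e).
by move: h1 h2; case: (u n) => c d /= h1 h2; rewrite lerD.
Qed.

End ultralimits.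

Lemma exists_free_ultrafilter :
  exists U : set_system nat, UltraFilter U /\ (forall N : nat, U [set n | (N <= n)%N]).
Proof.
have [U [UU Uoo]] := @ultraFilterLemma nat \oo _.
by exists U; split => // N; apply: Uoo; exact: nbhs_infty_ge.
Qed.

Section hausdorff_convergence.
Context {R : realType}.

Lemma dist_le (S : set R[i]) (s t : R[i]) (e : R) : S t -> rnorm (s - t) <= e ->
  (dist s S <= e%:E)%E.
Proof.
move=> St h; apply: (@le_trans _ _ (rnorm (s - t))%:E); last by rewrite lee_fin.
by apply: ereal_inf_lbound; exists t.
Qed.

Lemma hausdorff_dist_le (S T : set R[i]) (e : R) : 0 <= e ->
  (forall s, S s -> exists2 t, T t & rnorm (s - t) <= e) ->
  (forall t, T t -> exists2 s, S s & rnorm (t - s) <= e) ->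
  (hausdorff_dist S T <= e%:E)%E.
Proof.
move=> e0 hS hT; rewrite /hausdorff_dist !ge_max lee_fin e0/=; apply/andP; split.
  by apply: ge_ereal_sup => _ [s /hS[t Tt h] <-]; exact: dist_le Tt h.
by apply: ge_ereal_sup => _ [t /hT[s Ss h] <-]; exact: dist_le Ss h.
Qed.

Lemma hausdorff_dist_cvg0 (S T : nat -> set R[i]) :
  (forall e : R, 0 < e -> exists N : nat, forall n : nat, (N <= n)%N ->
     (hausdorff_dist (S n) (T n) <= e%:E)%E) ->
  (fun n => hausdorff_dist (S n) (T n)) @ \oo --> 0%E.
Proof.
move=> h; have d0 n : (0 <= hausdorff_dist (S n) (T n))%E.
  by rewrite /hausdorff_dist le_max lexx.
move=> A /= [e /= e0 eA]; have [|N hN] := h (e / 2); first by rewrite divr_gt0.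
exists N => // n Nn /=; have := hN n Nn; have := d0 n.
case: (hausdorff_dist (S n) (T n)) => [r| |]//.
rewrite !lee_fin => r0 re; apply: eA.
rewrite /ball /= sub0r normrN ger0_norm// (le_lt_trans re)//.
by rewrite ltr_pdivrMr// ltr_pMr// ltr1n.
Qed.

End hausdorff_convergence.

Section spectra_shrink.
Context {R : realType} (V : normedModType R[i]).

(* Compactness and the 1-Lipschitz dependence of the lower norms on the shift *)
Lemma Spec_closed_shrink (B : 'L(V, V)) (eps r : R) : cauchy_complete V ->
  0 <= eps -> 0 < r -> exists2 d : R, 0 < d & forall l,
  Spec_closed (eps + d) B l -> exists2 m, Spec_closed eps B m & rnorm (l - m) <= r.
Proof.
move=> cV eps0 r0; apply: contrapT => hn.
(* If no d works, d = 1 / (n + 1) provides bad points l n. They are bounded, and their ultralimit m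
   is a point of [Spec_closed eps B] close to some l n. *)
have /choice[l hl] : forall n : nat, exists l,
    Spec_closed (eps + (n.+1%:R)^-1) B l /\
    forall m, Spec_closed eps B m -> r < rnorm (l - m).
  move=> n; apply: contrapT => hl; apply: hn; exists (n.+1%:R)^-1; first by rewrite invr_gt0.
  move=> l Bl; apply: contrapT => hm; apply: hl; exists l; split=> // m Bm.
  by rewrite ltNge; apply/negP => lm; apply: hm; exists m.
have epsn n : 0 <= eps + (n.+1%:R)^-1 by rewrite addr_ge0// invr_ge0.
have [U [UU Uoo]] := exists_free_ultrafilter.
have [|m hm] := @complex_ulim R U UU l (rnorm B + eps + 1).
  apply: filterE => n /=; rewrite leNgt; apply/negP => h.
  have : ~ Spec_closed (eps + (n.+1%:R)^-1) B (l n).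
    apply/notin_Spec_closedP => //; exists (rnorm (l n) - rnorm B).
      have : (n.+1%:R)^-1 <= 1 :> R by rewrite invf_le1// ler1n.
      move: h; move: ((n.+1%:R)^-1 : R) => v; lra.
    exact: bounded_below_far.
  by apply; exact: (hl n).1.
have Bm : Spec_closed eps B m.
  apply: contrapT => /(notin_Spec_closedP _ _ cV eps0)[c epsc hc].
  (* One third of c - eps pays for |l n - m|, one for 1 / (n + 1), and the last keeps the inequality
     strict. *)
  have e0 : 0 < (c - eps) / 3 by rewrite divr_gt0// subr_gt0.
  have [N hN] := invn_small e0.
  have [n [/= h1 h2]] := filter_ex (filterI (hm _ e0) (Uoo N)).
  have : ~ Spec_closed (eps + (n.+1%:R)^-1) B (l n).
    apply/notin_Spec_closedP => //; exists (c - rnorm (l n - m)).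
      have := hN n h2; move: h1 ((n.+1%:R)^-1 : R) => h1 v; lra.
    exact: bounded_below_shift hc.
  by apply; exact: (hl n).1.
have r20 : 0 < r / 2 by rewrite divr_gt0.
have [n /= h] := filter_ex (hm _ r20).
have := (hl n).2 m Bm; lra.
Qed.

End spectra_shrink.

Section inclusion_sets.
Context {R : realType} (X : completeNormedModType R[i]) (A : 'L(ell2 X, ell2 X)).
Variables (alpha beta gamma : int -> 'L(X, X)).
Hypothesis A_tridiag : tridiagonal A alpha beta gamma.

Let cE : cauchy_complete (ell2 X).
Proof. exact/ell2_cauchy_complete/completeNormedMod_cauchy_complete. Qed.

Lemma Gamma_closed_sub (n : nat) (eta : R) l : 0 <= eta ->
  Gamma_closed n eta A l -> Spec_closed eta A l.
Proof.
move=> eta0 h; apply: contrapT => /(notin_Spec_closedP _ _ cE eta0)[c ec hc].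
have := le_trans (bounded_below_mu n hc) h.
by rewrite lee_fin leNgt ec.
Qed.

Lemma Spec_closed_sub (n : nat) (eps : R) l : (0 < n)%N -> 0 <= eps ->
  Spec_closed eps A l -> Gamma_closed n (eps + eps'' alpha gamma n) A l.
Proof.
move=> n0 eps0; apply: contraPP => /negP; rewrite /Gamma_closed /= -ltNge => h.
(* [mu] may be +oo, hence the detour through a real c. *)
have [c ec cmu] : exists2 c : R, eps + eps'' alpha gamma n < c &
    (c%:E <= mu n (shift_op A l))%E.
  case: (mu n (shift_op A l)) h => [r| |]//.
    by rewrite lte_fin => h; exists r.
  by move=> _; exists (eps + eps'' alpha gamma n + 1); rewrite ?ltrDl// leey.
apply/(notin_Spec_closedP _ _ cE eps0).
exists (c - eps'' alpha gamma n); first by rewrite ltrBrDr.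
exact: (mu_bounded_below A_tridiag n0 cmu).
Qed.

Lemma gamma_open_sub (n : nat) (eta : R) l : 0 < eta ->
  gamma_open n eta A l -> spec_open eta A l.
Proof.
move=> eta0 h; apply: contrapT => /(notin_spec_openP _ _ cE eta0) hc.
have := le_lt_trans (bounded_below_mu n hc) h.
by rewrite ltxx.
Qed.

Lemma spec_open_sub (n : nat) (eps : R) l : (0 < n)%N -> 0 < eps ->
  spec_open eps A l -> gamma_open n (eps + eps'' alpha gamma n) A l.
Proof.
move=> n0 eps0; apply: contraPP => /negP; rewrite /gamma_open /= -leNgt => h.
apply/(notin_spec_openP _ _ cE eps0).
have -> : eps = eps + eps'' alpha gamma n - eps'' alpha gamma n by rewrite addrK.
exact: (mu_bounded_below A_tridiag n0 h).
Qed.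

Lemma eps''_ge0 n : 0 <= eps'' alpha gamma n.
Proof.
have [ba _ bc _] := A_tridiag.
rewrite /eps'' mulr_ge0 ?mulr_ge0 ?addr_ge0 ?seq_norm_ge0//.
rewrite sin_ge0_pi// divr_ge0 ?pi_ge0//=.
by rewrite ler_pdivrMr// ler_peMr ?pi_ge0// -natrM ler1n.
Qed.

Lemma eps''_small (d : R) : 0 < d -> exists N : nat, forall n : nat, (N <= n)%N ->
  eps'' alpha gamma n <= d.
Proof.
move=> d0; have [ba _ bc _] := A_tridiag.
pose c := 2 * (seq_norm alpha + seq_norm gamma) + 1.
have c0 : 0 < c by rewrite ltr_wpDl// mulr_ge0// addr_ge0 ?seq_norm_ge0.
have dc0 : 0 < d / c by rewrite divr_gt0.
have /cvgrPdist_le csin := @continuous_sin R 0.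
have [e /= e0 he] := csin _ dc0.
have pe0 : 0 < e / (pi + 1) by rewrite divr_gt0// ltr_wpDl ?pi_ge0.
have [N hN] := invn_small pe0.
exists N => n /hN h.
pose x : R := pi / (2 * n.+1%:R).
have x0 : 0 <= x by rewrite divr_ge0 ?pi_ge0.
have xe : x < e.
  have : pi * (n.+1%:R)^-1 < e :> R.
    rewrite (@le_lt_trans _ _ (pi * (e / (pi + 1))))//.
      by rewrite ler_wpM2l ?pi_ge0.
    rewrite mulrCA gtr_pMr// ltr_pdivrMr ?mul1r ?ltrDl//.
    by rewrite ltr_wpDl ?pi_ge0.
  apply: le_lt_trans; rewrite /x ler_wpM2l ?pi_ge0//.
  by rewrite lef_pV2 ?posrE// ler_peMl// ler1n.
have : `|sin 0 - sin x| <= d / c.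
  by apply: he; rewrite /= sub0r normrN ger0_norm.
rewrite sin0 sub0r normrN => /(le_trans (ler_norm _)) sx.
rewrite /eps'' -/x (@le_trans _ _ (c * (d / c)))//.
  rewrite (@le_trans _ _ (2 * (seq_norm alpha + seq_norm gamma) * (d / c)))//.
    by rewrite ler_wpM2l// mulr_ge0// addr_ge0 ?seq_norm_ge0.
  by rewrite ler_wpM2r ?(ltW dc0)// lerDl.
by rewrite mulrCA mulfV ?mulr1// gt_eqF.
Qed.

Lemma closed_convergence (eps : R) : 0 <= eps ->
  (fun n : nat => hausdorff_dist (Gamma_closed n (eps + eps'' alpha gamma n) A)
                                 (Spec_closed eps A)) @ \oo --> 0%E.
Proof.
move=> eps0; apply: hausdorff_dist_cvg0 => r r0.
have [d d0 hd] := Spec_closed_shrink A cE eps0 r0.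
have [N hN] := eps''_small d0.
(* [N.+1] makes n positive, as [Spec_closed_sub] requires. *)
exists N.+1 => n Nn; apply: hausdorff_dist_le; first exact: ltW.
  move=> l /Gamma_closed_sub -/(_ (addr_ge0 eps0 (eps''_ge0 n))) h; apply: hd.
  apply: contrapT => /notin_Spec_closedP.
  have ed0 : 0 <= eps + d by rewrite addr_ge0 ?(ltW d0).
  move=> /(_ cE ed0)[c ec hc]; have : ~ Spec_closed (eps + eps'' alpha gamma n) A l.
    apply/notin_Spec_closedP => //; first exact: addr_ge0 eps0 (eps''_ge0 n).
    exists c => //; apply: le_lt_trans ec; rewrite lerD2l; apply: hN.
    exact: ltnW.
  by apply.
move=> l h; exists l; last by rewrite subrr rnorm0 ltW.
by apply: Spec_closed_sub => //; apply: leq_ltn_trans Nn.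
Qed.

(** [gamma_open] lies in [spec_open] at level eps + eps''_n, hence close to the closed set at level
    eps, in which the open one is assumed dense; r / 2 is spent on each approximation. *)
Lemma open_convergence (eps : R) : 0 < eps ->
  (forall l, Spec_closed eps A l -> forall r : R, 0 < r ->
     exists2 m, spec_open eps A m & rnorm (l - m) <= r) ->
  (fun n : nat => hausdorff_dist (gamma_open n (eps + eps'' alpha gamma n) A)
                                 (spec_open eps A)) @ \oo --> 0%E.
Proof.
move=> eps0 dense; apply: hausdorff_dist_cvg0 => r r0.
have r20 : 0 < r / 2 by rewrite divr_gt0.
have [d d0 hd] := Spec_closed_shrink A cE (ltW eps0) r20.
have [N hN] := eps''_small d0.
exists N.+1 => n Nn; apply: hausdorff_dist_le; first exact: ltW.
  have en0 : 0 < eps + eps'' alpha gamma n by rewrite ltr_wpDr ?eps''_ge0.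
  move=> l /(gamma_open_sub en0) h.
  have [|m hm lm] := hd l.
    apply: contrapT => /notin_Spec_closedP.
    have ed0 : 0 <= eps + d by rewrite addr_ge0 ?(ltW d0) ?(ltW eps0).
    move=> /(_ cE ed0)[c ec hc]; have : ~ spec_open (eps + eps'' alpha gamma n) A l.
      apply/notin_spec_openP => //; apply: bounded_below_le hc.
      by rewrite (le_trans _ (ltW ec))// lerD2l hN// ltnW.
    by apply.
  have [p hp mp] := dense m hm _ r20.
  exists p => //; rewrite -(subrK m l) -addrA (le_trans (rnormD _ _))//.
  by rewrite [leRHS](splitr r) lerD.
move=> l h; exists l; last by rewrite subrr rnorm0 ltW.
by apply: spec_open_sub => //; apply: leq_ltn_trans Nn.
Qed.

End inclusion_sets.

(** * Averages of the resolvent *)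

Section roots_of_unity.
Context {R : realType}.

Lemma root_of_unity_exists (N : nat) : (0 < N)%N ->
  exists w : R[i], w ^+ N = 1 /\ forall e, (0 < e < N)%N -> w ^+ e != 1.
Proof.
move=> N0; pose t : R := pi *+ 2 / N%:R.
have NR : N%:R != 0 :> R by rewrite pnatr_eq0 -lt0n.
pose w : R[i] := (cos t +i* sin t)%C.
have wX n : w ^+ n = (cos (n%:R * t) +i* sin (n%:R * t))%C.
  elim: n => [|n IH]; first by rewrite expr0 mul0r cos0 sin0.
  rewrite exprS IH -natr1 mulrDl mul1r cosD sinD.
  by apply/eqP; rewrite eq_complex/=; apply/andP; split; apply/eqP; ring.
exists w; split=> [|e /andP[e0 eN]].
  by rewrite wX mulrC divfK// cos2pi sin2pi.
(* w^e = 1 would give cos (2 h) = 1 with h = e pi / N strictly between 0 and pi. *)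
rewrite wX; apply/eqP => -[] /eqP + _; apply/negP.
pose h : R := e%:R * pi / N%:R.
have -> : e%:R * t = h + h by rewrite /t /h mulr2n; field.
have : 0 < sin h.
  apply: sin_gt0_pi; rewrite /h divr_gt0 ?mulr_gt0 ?pi_gt0 ?ltr0n//=.
  by rewrite ltr_pdivrMr ?ltr0n// mulrC ltr_pM2l ?pi_gt0// ltr_nat.
rewrite cosD => s0; have := cos2Dsin2 h; rewrite !expr2 => cs.
apply/eqP => hh; nra.
Qed.

Lemma sum_root_of_unity (N : nat) (w : R[i]) (e : nat) : (0 < N)%N ->
  w ^+ N = 1 -> (forall e, (0 < e < N)%N -> w ^+ e != 1) ->
  \sum_(n < N) (w ^+ e) ^+ n = if (N %| e)%N then N%:R else 0.
Proof.
move=> N0 wN wP; rewrite -(expr_mod e wN) /dvdn.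
have [->|eN] := eqVneq (e %% N)%N 0%N.
  by rewrite expr0; under eq_bigr do rewrite expr1n; rewrite sumr_const card_ord.
have /wP : (0 < e %% N < N)%N by rewrite lt0n eN ltn_mod.
rewrite -subr_eq0 => w1; apply: (mulfI w1).
by rewrite mulr0 -subrX1 exprAC wN expr1n subrr.
Qed.

End roots_of_unity.

Section resolvent_averaging.
Context {R : realType} (V : normedModType R[i]).
Variables (S : 'L(V, V)) (T : R[i] -> V -> V) (M rho : R).
Hypothesis M0 : 0 <= M.
Hypothesis S_le : forall x, rnorm (S x) <= M * rnorm x.
Hypothesis T_le : forall z x, rnorm z <= rho -> rnorm (T z x) <= M * rnorm x.
Hypothesis T_eq : forall z x, rnorm z <= rho -> T z x = S x + z *: S (T z x).

Lemma iter_bop_le K x : rnorm (iter K S x) <= M ^+ K * rnorm x.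
Proof.
elim: K => [|K IH] /=; first by rewrite expr0 mul1r.
by rewrite (le_trans (S_le _))// exprS -mulrA ler_wpM2l.
Qed.

Lemma iterZ K a x : iter K S (a *: x) = a *: iter K S x.
Proof. by elim: K => //= K ->; rewrite bopZ. Qed.

Lemma iterD K x y : iter K S (x + y) = iter K S x + iter K S y.
Proof. by elim: K => //= K ->; rewrite bopD. Qed.

(** [T_eq] is the resolvent identity, S being the inverse of an operator B and T z that of B - z; it
    is iterated K times. *)
Lemma neumann_expansion K z x : rnorm z <= rho ->
  T z x = \sum_(l < K) z ^+ l *: iter l.+1 S x + z ^+ K *: iter K S (T z x).
Proof.
move=> zr; elim: K => [|K IH]; first by rewrite big_ord0 add0r expr0 scale1r.
rewrite big_ord_recr /= {1}IH -addrA; congr (_ + _).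
rewrite {1}(T_eq x zr) iterD iterZ scalerDr scalerA -exprSr; congr (_ + _).
  by rewrite -iterS iterSr.
by rewrite -iterS iterSr.
Qed.

(* The kernel [1 + Re (zeta w^(-nk))] is nonnegative of mean [1] and filters the
   frequencies [0] and [k] out of the Neumann series at the points [r w^n]. *)
Lemma resolvent_averaging (k : nat) (r : R) (zeta : R[i]) x : (0 < k)%N ->
  0 < r -> r <= rho -> r * M < 1 -> rnorm zeta <= 1 ->
  rnorm (S x + (zeta * (r ^+ k / 2)%:C%C) *: iter k.+1 S x) <= M * rnorm x.
Proof.
move=> k0 r0 rrho rM zeta1; apply/ler_addgt0Pr => e e0.
have rM0 : 0 <= r * M by rewrite mulr_ge0// ltW.
(* K is past k and so large that the remainder of the Neumann series, estimated with kernel at most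
   2 and |z| = r, is at most e. *)
have [K kK hK] : exists2 K : nat, (k < K)%N & 2 * (r * M) ^+ K * (M * rnorm x) <= e.
  have d0 : 0 < e / (2 * (M * rnorm x) + 1).
    by rewrite divr_gt0// ltr_wpDl// !mulr_ge0 ?rnorm_ge0.
  have rMn : `|r * M| < 1 by rewrite ger0_norm.
  have /cvgrPdist_le/(_ _ d0)[K _ hK] := cvg_expr rMn.
  exists (maxn K k.+1); first exact: leq_maxr.
  have := hK _ (leq_maxl K k.+1); rewrite /= sub0r normrN ger0_norm ?exprn_ge0//.
  rewrite ler_pdivlMr; last by rewrite ltr_wpDl// !mulr_ge0 ?rnorm_ge0.
  have : 0 <= (r * M) ^+ (maxn K k.+1) by rewrite exprn_ge0.
  move: ((r * M) ^+ _) (M * rnorm x) => q m q0; lra.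
pose N := (K + k)%N; have N0 : (0 < N)%N by rewrite addn_gt0 k0 orbT.
have NR : 0 < N%:R :> R by rewrite ltr0n.
have [w [wN wP]] := @root_of_unity_exists R N N0.
have w1 : rnorm w = 1.
  apply/eqP; rewrite -(@pexpr_eq1 _ (rnorm w) N)// ?rnorm_ge0//.
  by rewrite -rnormX wN rnorm1.
have w0 : w != 0 by rewrite -rnorm_gt0 w1.
have winv : w ^- k = w ^+ K.
  by apply: (mulfI (expf_neq0 k w0)); rewrite mulfV ?expf_neq0// -exprD addnC wN.
have cj (u : R[i]) : rnorm u = 1 -> (u^*)%C = u^-1.
  by move=> u1; rewrite invc_norm rnormE u1 expr1n invr1 mul1r.
pose c (n : nat) : R := 1 + complex.Re (zeta * (w ^+ K) ^+ n).
have cE n : (c n)%:C%C = 1 + (zeta / 2) * (w ^+ K) ^+ n + ((zeta^*)%C / 2) * (w ^+ k) ^+ n.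
  rewrite /c [LHS](_ : _ = 1 + (complex.Re (zeta * (w ^+ K) ^+ n))%:C%C);
    last by rewrite rmorphD rmorph1.
  have cjw : (((w ^+ K) ^+ n)^*)%C = (w ^+ k) ^+ n.
    by rewrite cj ?rnormX ?w1 ?expr1n// -winv exprVn invrK.
  by rewrite -addrA; congr (_ + _); rewrite ReJ_add rmorphM /= cjw mulrDl !(mulrAC _ _ 2^-1).
have c_ge0 n : 0 <= c n.
  have h : rnorm (zeta * (w ^+ K) ^+ n) <= 1.
    by rewrite rnormM !rnormX w1 !expr1n mulr1.
  have := le_trans (absRe_le_rnorm _) h; rewrite /c ler_norml; lra.
have c_le2 n : c n <= 2.
  have h : rnorm (zeta * (w ^+ K) ^+ n) <= 1.
    by rewrite rnormM !rnormX w1 !expr1n mulr1.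
  have := le_trans (absRe_le_rnorm _) h; rewrite /c ler_norml; lra.
have sumw e' := sum_root_of_unity e' N0 wN wP.
have csum l : (l < K)%N -> \sum_(n < N) (c n)%:C%C * (w ^+ l) ^+ n =
    (if l == 0%N then N%:R else 0) + (if l == k then (zeta / 2) * N%:R else 0).
  move=> lK; under eq_bigr do rewrite cE !mulrDl mul1r -!mulrA -!exprMn -!exprD.
  rewrite !big_split/= -!mulr_sumr !sumw.
  rewrite (_ : (N %| l)%N = (l == 0%N)); last first.
    by apply/idP/eqP => [|->//]; case: l lK => // l lK /dvdn_leq; rewrite /N; lia.
  rewrite (_ : (N %| k + l)%N = false); last first.
    by apply/negbTE/negP => /dvdn_leq; rewrite /N; lia.
  rewrite /= !mulr0 addr0; congr (_ + _).
  rewrite (_ : (N %| K + l)%N = (l == k)); last first.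
    apply/idP/eqP => [|->]; last by rewrite /N.
    by move=> /dvdnP[[|[|q]]]; rewrite /N; nia.
  by case: ifP => _; rewrite ?mulrA// !mulr0.
have K0 : (0 < K)%N by apply: leq_ltn_trans kK.
have c0sum : \sum_(n < N) c n = N%:R.
  have := csum 0%N K0; rewrite eqxx (_ : (0 == k)%N = false) ?addr0; last first.
    by apply/negbTE; rewrite eq_sym -lt0n.
  under eq_bigr do rewrite expr0 expr1n mulr1.
  by rewrite -rmorph_sum -(rmorph_nat (real_complex R)) => /complexI.
pose z n : R[i] := r%:C%C * w ^+ n.
have zr n : rnorm (z n) <= rho.
  by rewrite rnormM rnormX w1 expr1n mulr1 rnorm_pos ?(ltW r0).
pose err := \sum_(n < N) ((c n)%:C%C * z n ^+ K) *: iter K S (T (z n) x).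
set Y := S x + _.
have YE : \sum_(n < N) (c n)%:C%C *: T (z n) x = N%:R *: Y + err.
  under eq_bigr => n _ do rewrite (neumann_expansion K x (zr n)) scalerDr scalerA.
  rewrite big_split/=; congr (_ + _).
  under eq_bigr do rewrite scaler_sumr.
  rewrite exchange_big/=.
  transitivity (\sum_(l < K) ((r ^+ l)%:C%C * ((if l == 0%N :> nat then N%:R else 0)
      + (if l == k :> nat then (zeta / 2) * N%:R else 0))) *: iter l.+1 S x).
    apply: eq_bigr => l _; rewrite -csum// mulr_sumr scaler_suml.
    apply: eq_bigr => n _; rewrite scalerA; congr (_ *: _).
    by rewrite /z exprMn rmorphXn /= -!exprM mulnC mulrCA.
  have l0k : (Ordinal K0 != Ordinal kK).
    by apply/eqP => /(congr1 val) /= e0k; move: k0; rewrite -e0k.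
  rewrite (bigD1 (Ordinal K0))//= (bigD1 (Ordinal kK))//=; last by rewrite eq_sym.
  rewrite big1 ?addr0; last first.
    move=> l /andP[l0 lk]; rewrite (_ : (l == 0 :> nat) = false); last first.
      by apply/negbTE; apply: contra l0 => /eqP l0; apply/eqP/val_inj.
    rewrite (_ : (l == k :> nat) = false); last first.
      by apply/negbTE; apply: contra lk => /eqP lk; apply/eqP/val_inj.
    by rewrite addr0 mulr0 scale0r.
  have kF : (k == 0)%N = false by apply/negbTE; rewrite -lt0n.
  rewrite /= eq_sym kF eqxx addr0 add0r.
  rewrite expr0 rmorph1 mul1r /Y scalerDr scalerA; congr (_ + _ *: _).
  by rewrite rmorphM /= fmorphV /= rmorph_nat; ring.
have errle : rnorm err <= N%:R * (2 * (r * M) ^+ K * (M * rnorm x)).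
  rewrite (le_trans (rnorm_sum _ _ _))//.
  rewrite [leRHS](_ : _ = \sum_(n < N) (2 * (r * M) ^+ K * (M * rnorm x))); last first.
    by rewrite sumr_const card_ord mulr_natl.
  apply: ler_sum => n _; rewrite rnormZ rnormM rnorm_pos// rnormX.
  rewrite [rnorm (z n)](_ : _ = r); last first.
    by rewrite rnormM rnormX w1 expr1n mulr1 rnorm_pos ?(ltW r0).
  rewrite exprMn !mulrA -!mulrA ler_pM//.
    by rewrite mulr_ge0 ?exprn_ge0 ?rnorm_ge0// ltW.
  rewrite ler_wpM2l ?exprn_ge0 ?(ltW r0)//.
  rewrite (le_trans (iter_bop_le _ _))// ler_wpM2l ?exprn_ge0//; exact: T_le.
rewrite -(ler_pM2l NR) -[X in X * rnorm Y](rnorm_pos (ltW NR)) rmorph_nat -rnormZ.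
have -> : N%:R *: Y = \sum_(n < N) (c n)%:C%C *: T (z n) x - err by rewrite YE addrK.
rewrite (le_trans (rnormD _ _))// rnormN mulrDr lerD//; last first.
  by rewrite (le_trans errle)// ler_wpM2l ?(ltW NR).
(* The kernel is nonnegative with sum N, so averaging preserves the bound M. *)
rewrite (le_trans (rnorm_sum _ _ _))// -c0sum mulr_suml; apply: ler_sum => n _.
by rewrite rnormZ rnorm_pos// ler_wpM2l// T_le.
Qed.

End resolvent_averaging.

(** * Complex uniform convexity *)

Section four_point_excess.
Context {R : realType}.

(* [four_point x y - 4 |x|^2] is the excess of the mean of |x + zeta y|^2 over
   the fourth roots of unity zeta. *)
Definition four_point (V : normedModType R[i]) (x y : V) : R :=
  rnorm (x + y) ^+ 2 + rnorm (x - y) ^+ 2 +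
  rnorm (x + 'i%C *: y) ^+ 2 + rnorm (x - 'i%C *: y) ^+ 2.

(** A form of complex uniform convexity that is linear in squared norms and therefore passes to
    [ell2] by summation over coordinates. *)
Definition excess_controlled (V : normedModType R[i]) := forall e : R, 0 < e ->
  exists2 C : R, 0 <= C & forall x y : V,
    rnorm y ^+ 2 <= e ^+ 2 * rnorm x ^+ 2 + C * (four_point x y - 4 * rnorm x ^+ 2).

Lemma rnorm_i : rnorm ('i%C : R[i]) = 1.
Proof.
apply/eqP; rewrite -(@pexpr_eq1 _ _ 2)// ?rnorm_ge0//.
by rewrite rnorm_sqrE/= expr0n expr1n add0r.
Qed.

Section norm_inequalities.
Context {V : normedModType R[i]}.
Implicit Types x y : V.

Lemma two_point_ge x y :
  2 * rnorm x ^+ 2 <= rnorm (x + y) ^+ 2 + rnorm (x - y) ^+ 2.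
Proof.
have : rnorm (2 *: x) <= rnorm (x + y) + rnorm (x - y).
  rewrite (_ : 2 *: x = (x + y) + (x - y)) ?rnormD//.
  by rewrite addrACA subrr addr0 scaler_nat mulr2n.
rewrite rnormZ -(rmorph_nat (real_complex R)) rnorm_pos//.
have := rnorm_ge0 (x + y); have := rnorm_ge0 (x - y); have := rnorm_ge0 x.
have := sqr_ge0 (rnorm (x + y) - rnorm (x - y)); nra.
Qed.

Lemma two_point_ge_r x y :
  2 * rnorm y ^+ 2 <= rnorm (x + y) ^+ 2 + rnorm (x - y) ^+ 2.
Proof. by rewrite [x + y]addrC rnorm_distC two_point_ge. Qed.

Lemma four_point_ge x y : 4 * rnorm x ^+ 2 <= four_point x y.
Proof.
have := two_point_ge x y; have := two_point_ge x ('i%C *: y).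
rewrite /four_point; lra.
Qed.

Lemma four_point_scale (a : R[i]) x y :
  four_point (a *: x) (a *: y) = rnorm a ^+ 2 * four_point x y.
Proof.
rewrite /four_point scalerA ['i%C * a]mulrC -scalerA -!scalerDr -!scalerBr.
by rewrite !rnormZ !exprMn -!mulrDr.
Qed.

End norm_inequalities.

Lemma four_point_complex (a : R[i]) :
  rnorm (1 + a) ^+ 2 + rnorm (1 - a) ^+ 2 + rnorm (1 + 'i%C * a) ^+ 2
  + rnorm (1 - 'i%C * a) ^+ 2 = 4 + 4 * rnorm a ^+ 2.
Proof.
by rewrite !rnorm_sqrE; case: a => a b /=; ring.
Qed.

(** For |x| = 1 and |y| >= e, suppose the four-point mean is below 1 + s^2. A functional phi norming
    x shows that |phi y| <= s and that none of the four points is short, so none is long either. By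
    convexity the disc of all x + (z / 2) y, |z| <= 1, stays in a ball of radius H close to 1,
    against complex uniform convexity. *)
Lemma complex_uniformly_convex_excess (Y : normedModType R[i]) :
  complex_uniformly_convex Y -> excess_controlled Y.
Proof.
move=> cuc e e0.
(* Below, y is divided by 2 H with H <= 6, hence e / 12. *)
have [d d0 hd] := cuc (e / 12) (divr_gt0 e0 (ltr0Sn _ 11)).
(* s <= d / 6 ensures (1 + 5 s) (1 - d) < 1. *)
pose s : R := Num.min 1 (d / 6).
have s0 : 0 < s by rewrite lt_min ltr01 divr_gt0.
have s1 : s <= 1 by rewrite ge_min lexx.
have sd : s <= d / 6 by rewrite ge_min lexx orbT.
have unit_case (x y : Y) : rnorm x = 1 -> e <= rnorm y ->
    4 * (1 + s ^+ 2) <= four_point x y.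
  move=> x1 ye; rewrite leNgt; apply/negP => h.
  have [phi phi1 phix] := norming_functional x.
  have phile (z : Y) : rnorm (phi z : R[i]) <= rnorm z.
    by rewrite (le_trans (rnorm_functional _ _))// ler_piMl ?rnorm_ge0.
  rewrite x1 in phix.
  pose a : R[i] := phi y.
  have ph (z : R[i]) : rnorm (1 + z * a) <= rnorm (x + z *: y).
    have := phile (x + z *: y); rewrite bopD bopZ phix.
    by rewrite (rmorph1 (real_complex R)).
  have pp (z : R[i]) : rnorm (1 + z * a) ^+ 2 <= rnorm (x + z *: y) ^+ 2.
    by rewrite ler_pXn2r ?nnegrE ?rnorm_ge0.
  (* Comparison with the scalars 1 + z a for the four roots of unity z, whose squared moduli add up
     to 4 + 4 |a|^2. *)
  have as2 : rnorm a ^+ 2 <= s ^+ 2.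
    have := four_point_complex a; have := pp 1; have := pp (-1).
    have := pp 'i%C; have := pp (- 'i%C).
    rewrite !mul1r !mulN1r !mulNr !scaleNr !scale1r; move: h; rewrite /four_point; lra.
  have as1 : rnorm a <= s by move: as2; rewrite ler_pXn2r ?nnegrE ?rnorm_ge0 ?(ltW s0).
  have low (z : R[i]) : rnorm z = 1 -> 1 - 2 * s <= rnorm (x + z *: y) ^+ 2.
    move=> z1; rewrite (le_trans _ (pp z))//.
    have : rnorm (1 : R[i]) - rnorm (- (z * a)) <= rnorm (1 - - (z * a)).
      exact: ler_rnormB.
    rewrite opprK rnormN rnormM z1 mul1r rnorm1 => h1.
    have := rnorm_ge0 (1 + z * a); nra.
  have l1 := low 1 rnorm1; have l2 := low (-1) (etrans (rnormN _) rnorm1).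
  have l3 := low 'i%C rnorm_i; have l4 := low (- 'i%C) (etrans (rnormN _) rnorm_i).
  rewrite scale1r in l1; rewrite scaleN1r in l2; rewrite scaleNr in l4.
  pose H := 1 + 5 * s.
  have H0 : 0 < H by rewrite addr_gt0// mulr_gt0.
  (* Three squares are at least 1 - 2 s and all four add up to less than 4 (1 + s^2), which leaves
     at most 1 + 4 s^2 + 6 s for the remaining one. *)
  have up (v : Y) : rnorm v ^+ 2 <= 1 + 4 * s ^+ 2 + 6 * s -> rnorm v <= H.
    move=> hv; rewrite -(@ler_pXn2r _ 2)// ?nnegrE ?rnorm_ge0 ?(ltW H0)//.
    by rewrite (le_trans hv)// /H; nra.
  have u1 : rnorm (x + y) <= H by apply: up; move: h; rewrite /four_point; lra.
  have u2 : rnorm (x - y) <= H by apply: up; move: h; rewrite /four_point; lra.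
  have u3 : rnorm (x + 'i%C *: y) <= H by apply: up; move: h; rewrite /four_point; lra.
  have u4 : rnorm (x - 'i%C *: y) <= H by apply: up; move: h; rewrite /four_point; lra.
  have realdir (p : R) (v : Y) : rnorm (x + v) <= H -> rnorm (x - v) <= H ->
      rnorm (`|p|%:C%C *: x + p%:C%C *: v) <= `|p| * H.
    move=> h1 h2; have [p0|p0] := leP 0 p.
      by rewrite ger0_norm// -scalerDr rnormZ rnorm_pos// ler_wpM2l.
    rewrite (_ : p%:C%C = - `|p|%:C%C); last by rewrite ltr0_norm// rmorphN opprK.
    by rewrite scaleNr -scalerBr rnormZ rnorm_pos// ler_wpM2l.
  have H1 : 1 <= H by rewrite lerDl mulr_ge0// ltW.
  (* x + (z / 2) y is a convex combination of points in the ball of radius H, because |Re z| / 2 +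
     |Im z| / 2 <= 1. *)
  have hull (z : R[i]) : rnorm z <= 1 -> rnorm (x + (z / 2) *: y) <= H.
    move=> z1; set p := complex.Re z; set q := complex.Im z.
    have p1 : `|p| <= 1 := le_trans (absRe_le_rnorm z) z1.
    have q1 : `|q| <= 1 := le_trans (absIm_le_rnorm z) z1.
    pose t := 1 - `|p| / 2 - `|q| / 2.
    have t0 : 0 <= t by rewrite /t; lra.
    have tE : 2^-1 * `|p| + 2^-1 * `|q| + t = 1 by rewrite /t; lra.
    have -> : x + (z / 2) *: y = (2^-1)%:C%C *: ((`|p|%:C%C *: x + p%:C%C *: y)
        + (`|q|%:C%C *: x + q%:C%C *: ('i%C *: y))) + t%:C%C *: x.
      rewrite !scalerDr !scalerA addrACA [_ + t%:C%C *: x]addrAC -!scalerDl.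
      rewrite -[x in LHS]scale1r; congr (_ *: _ + _ *: _).
        by rewrite -!rmorphM -!rmorphD tE rmorph1.
      rewrite [in LHS](complexE z) -/p -/q fmorphV rmorph_nat; ring.
    rewrite (le_trans (rnormD _ _))// rnormZ rnorm_pos// rnormZ rnorm_pos// x1 mulr1.
    have h1 := realdir p y u1 u2; have h2 := realdir q ('i%C *: y) u3 u4.
    have h3 := rnormD (`|p|%:C%C *: x + p%:C%C *: y)
       (`|q|%:C%C *: x + q%:C%C *: ('i%C *: y)).
    rewrite /t; have := normr_ge0 p; have := normr_ge0 q; nra.
  have Hi : 0 < H^-1 by rewrite invr_gt0.
  have H6 : H <= 6 by rewrite /H; lra.
  have HiE : H * H^-1 = 1 by rewrite mulfV ?gt_eqF.
  have Hi6 : 6^-1 <= H^-1 by rewrite lef_pV2 ?posrE.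
  have := hd (H^-1%:C%C *: x) ((H^-1 / 2)%:C%C *: y).
  rewrite !rnormZ [rnorm H^-1%:C%C]rnorm_pos ?(ltW Hi)//.
  rewrite [rnorm (H^-1 / 2)%:C%C]rnorm_pos ?divr_ge0 ?(ltW Hi)// x1 mulr1.
  move=> hh; have : H^-1 <= 1 - d.
    apply: hh.
      rewrite (@le_trans _ _ (6^-1 / 2 * rnorm y))//.
        by rewrite (_ : e / 12 = 6^-1 / 2 * e) ?ler_wpM2l//; field.
      by rewrite ler_wpM2r ?rnorm_ge0// ler_wpM2r.
    move=> z z1; have -> : H^-1%:C%C *: x + z *: ((H^-1 / 2)%:C%C *: y) =
        H^-1%:C%C *: (x + (z / 2) *: y).
      rewrite scalerDr !scalerA; congr (_ + _ *: _).
      have half : (2^-1)%:C%C = 2^-1 :> R[i] by rewrite fmorphV rmorph_nat.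
      by rewrite rmorphM /= half; ring.
    rewrite rnormZ rnorm_pos ?(ltW Hi)// -(ler_pM2l H0) mulrA HiE mul1r mulr1.
    exact: hull.
  move=> h1; have : H * H^-1 <= H * (1 - d) by rewrite ler_wpM2l ?(ltW H0).
  rewrite HiE /H; have : 0 <= s * d by rewrite mulr_ge0 ?(ltW s0) ?(ltW d0).
  lra.
have s20 : 0 < s ^+ 2 by rewrite exprn_gt0.
have hom (x y : Y) : e * rnorm x <= rnorm y ->
    4 * (1 + s ^+ 2) * rnorm x ^+ 2 <= four_point x y.
  have [->|x0] := eqVneq x 0.
    by move=> _; rewrite rnorm0 expr0n mulr0 (le_trans _ (four_point_ge 0 y))// rnorm0 expr0n mulr0.
  have x_gt0 : 0 < rnorm x by rewrite rnorm_gt0.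
  move=> h; have h1 : e <= (rnorm x)^-1 * rnorm y by rewrite ler_pdivlMl// mulrC.
  have := unit_case ((rnorm x)^-1%:C%C *: x) ((rnorm x)^-1%:C%C *: y).
  rewrite normalize_rnorm// rnormZ four_point_scale rnorm_pos ?invr_ge0 ?(ltW x_gt0)//.
  move/(_ erefl h1); rewrite exprVn ler_pdivlMl ?exprn_gt0//.
  by rewrite [_ ^+ 2 * _]mulrC.
(* For |y| > e |x|, |y|^2 is at most half the four-point sum, which is half the excess plus 2 |x|^2,
   and the excess is at least 4 s^2 |x|^2. *)
exists (2^-1 + (2 * s ^+ 2)^-1).
  by rewrite addr_ge0// invr_ge0 mulr_ge0// ltW.
move=> x y; have ex0 : 0 <= four_point x y - 4 * rnorm x ^+ 2.
  by rewrite subr_ge0 four_point_ge.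
have C0 : 0 <= 2^-1 + (2 * s ^+ 2)^-1.
  by rewrite addr_ge0// invr_ge0 mulr_ge0// ltW.
have [yx|xy] := leP (rnorm y) (e * rnorm x).
  rewrite (@le_trans _ _ (e ^+ 2 * rnorm x ^+ 2))//.
    by rewrite -exprMn ler_pXn2r ?nnegrE ?rnorm_ge0 ?mulr_ge0 ?rnorm_ge0 ?(ltW e0).
  by rewrite lerDl mulr_ge0.
have h := hom x y (ltW xy).
rewrite (@le_trans _ _ ((2^-1 + (2 * s ^+ 2)^-1) * (four_point x y - 4 * rnorm x ^+ 2)))//;
  last by rewrite lerDr mulr_ge0 ?sqr_ge0.
have h2 : 2 * rnorm y ^+ 2 <= four_point x y.
  have := two_point_ge_r x y; rewrite /four_point.
  have := sqr_ge0 (rnorm (x + 'i%C *: y)); have := sqr_ge0 (rnorm (x - 'i%C *: y)); lra.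
have h3 : 2 * rnorm x ^+ 2 <= (2 * s ^+ 2)^-1 * (four_point x y - 4 * rnorm x ^+ 2).
  rewrite [leRHS]mulrC ler_pdivlMr ?mulr_gt0//; move: h; lra.
rewrite mulrDl; lra.
Qed.

(** The term in -|x_j|^2 has the wrong sign for finite sums, so F is enlarged by a set G carrying
    almost all of |x|^2. *)
Lemma excess_controlled_ell2 (Y : normedModType R[i]) :
  excess_controlled Y -> excess_controlled (ell2 Y).
Proof.
move=> hY e e0; have [C C0 hC] := hY e e0; exists C => // x y.
rewrite -[rnorm y]/(ell2norm y).
have bound (F G : {fset int}) : (F `<=` G)%fset ->
    \sum_(j <- F) rnorm (y j) ^+ 2 <= e ^+ 2 * ell2norm x ^+ 2
    + C * (four_point x y - 4 * \sum_(j <- G) rnorm (x j) ^+ 2).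
  move=> FG; rewrite (le_trans (fsum_subset_le y FG))//.
  have h : \sum_(j <- G) rnorm (y j) ^+ 2 <= \sum_(j <- G)
      (e ^+ 2 * rnorm (x j) ^+ 2 + C * (four_point (x j) (y j) - 4 * rnorm (x j) ^+ 2)).
    by apply: ler_sum => j _; exact: hC.
  rewrite (le_trans h)// big_split/= -!mulr_sumr big_split/= sumrN -mulr_sumr.
  rewrite lerD//; first by rewrite ler_wpM2l ?sqr_ge0// ell2norm_fsum.
  rewrite ler_wpM2l// lerD2r /four_point !big_split/=.
  apply: lerD; first (apply: lerD; first apply: lerD).
  - exact: (ell2norm_fsum (x + y) G).
  - exact: (ell2norm_fsum (x - y) G).
  - exact: (ell2norm_fsum (x + 'i%C *: y) G).
  - exact: (ell2norm_fsum (x - 'i%C *: y) G).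
apply/ler_addgt0Pr => d d0.
have C40 : 0 < 4 * C + 1 by rewrite ltr_wpDl// mulr_ge0.
have [G hG] := ell2norm_approx x (divr_gt0 d0 C40).
rewrite -[leLHS](@sqr_sqrtr _ (ell2norm y ^+ 2)) ?sqr_ge0//.
have nn (F : {fset int}) : 0 <= \sum_(j <- F) rnorm (y j) ^+ 2.
  by apply: sumr_ge0 => j _; exact: sqr_ge0.
set B := _ + d.
have hB (F : {fset int}) : \sum_(j <- F) rnorm (y j) ^+ 2 <= B.
  rewrite (le_trans (bound F (F `|` G)%fset (fsubsetUl F G)))//.
  rewrite /B -[rnorm x]/(ell2norm x) -[leRHS]addrA lerD2l.
  have h := fsum_subset_le x (fsubsetUr F G).
  have : C * (4 * (ell2norm x ^+ 2 - \sum_(j <- (F `|` G)%fset) rnorm (x j) ^+ 2)) <= d.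
    rewrite (@le_trans _ _ (C * (4 * (d / (4 * C + 1)))))//.
      by rewrite ler_wpM2l// ler_wpM2l//; lra.
    rewrite (_ : C * _ = d * ((4 * C) / (4 * C + 1))); last by ring.
    rewrite ler_piMr ?(ltW d0)//.
    by rewrite ler_pdivrMr// mul1r lerDl.
  lra.
have B0 : 0 <= B := le_trans (nn fset0) (hB fset0).
have : ell2norm y <= Num.sqrt B.
  by apply: ell2norm_le => [|F]; rewrite ?sqrtr_ge0// sqr_sqrtr.
rewrite -(@ler_pXn2r _ 2) ?nnegrE ?ell2norm_ge0 ?sqrtr_ge0// (sqr_sqrtr B0).
by rewrite sqr_sqrtr ?sqr_ge0.
Qed.

Lemma excess_controlled_isometry (E : normedModType R[i]) (F : normedModType R[i])
    (J : E -> F) : (forall x, rnorm (J x) = rnorm x) ->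
  (forall (a : R[i]) x y, J (x + a *: y) = J x + a *: J y) ->
  excess_controlled F -> excess_controlled E.
Proof.
move=> Jn Jl hF e e0; have [C C0 hC] := hF e e0; exists C => // x y.
have := hC (J x) (J y); rewrite /four_point -!Jn.
have J1 : J (x + y) = J x + J y by have := Jl 1 x y; rewrite !scale1r.
have J2 : J (x - y) = J x - J y by have := Jl (-1) x y; rewrite !scaleN1r.
have J3 : J (x - 'i%C *: y) = J x - 'i%C *: J y.
  by have := Jl (- 'i%C) x y; rewrite !scaleNr.
by rewrite J1 J2 J3 Jl.
Qed.

(* If [u] nearly maximises [|T u|], the bound on [T u + zeta c T^2 u] leaves no
   room for [T^2 u], whereas [T] is bounded below. *)
Lemma excess_controlled_contra (E : normedModType R[i]) (T : 'L(E, E)) (M c b : R) :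
  excess_controlled E -> 0 < M -> 0 < c -> 0 < b ->
  (forall u, b * rnorm u <= rnorm (T u)) ->
  (forall zeta u, rnorm zeta <= 1 ->
     rnorm (T u + (zeta * c%:C%C) *: T (T u)) <= M * rnorm u) ->
  (forall M', 0 < M' < M -> exists u, M' * rnorm u < rnorm (T u)) -> False.
Proof.
move=> hE M0 c0 b0 lowT upT nearT.
(* k |u| bounds |c T^2 u| from below; k / (2 M) and t are chosen so that each of the two terms of
   [excess_controlled] is at most a quarter of k^2 |u|^2. *)
pose k := c * b ^+ 2.
have k0 : 0 < k by rewrite mulr_gt0// exprn_gt0.
have [C C0 hC] := hE (k / (2 * M)) (divr_gt0 k0 (mulr_gt0 (ltr0Sn _ 1) M0)).
pose t := Num.min (M / 2) (k ^+ 2 / (32 * M * (C + 1))).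
have D0 : 0 < 32 * M * (C + 1) by rewrite !mulr_gt0// ltr_wpDl.
have t0 : 0 < t by rewrite lt_min !divr_gt0// exprn_gt0.
have tM : t <= M / 2 by rewrite ge_min lexx.
have tk : t * (32 * M * (C + 1)) <= k ^+ 2.
  by rewrite -ler_pdivlMr// ge_min lexx orbT.
have [|u hu] := nearT (M - t).
  by apply/andP; split; lra.
have u0 : 0 < rnorm u.
  rewrite rnorm_gt0; apply/eqP => u0.
  by move: hu; rewrite u0 bop0 !rnorm0 mulr0 ltxx.
pose x := T u; pose y := c%:C%C *: T (T u).
have ylow : k * rnorm u <= rnorm y.
  rewrite /y rnormZ (rnorm_pos (ltW c0)) /k -mulrA ler_wpM2l ?(ltW c0)//.
  rewrite expr2 -mulrA (le_trans _ (lowT (T u)))// ler_wpM2l ?(ltW b0)//.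
have up1 := upT 1 u; have up2 := upT (-1) u.
have up3 := upT 'i%C u; have up4 := upT (- 'i%C) u.
have sq (v : E) : rnorm v <= M * rnorm u -> rnorm v ^+ 2 <= (M * rnorm u) ^+ 2.
  by move=> h; rewrite ler_pXn2r ?nnegrE ?rnorm_ge0 ?mulr_ge0 ?rnorm_ge0 ?(ltW M0).
have fp : four_point x y <= 4 * (M * rnorm u) ^+ 2.
  have a1 : rnorm (x + y) ^+ 2 <= (M * rnorm u) ^+ 2.
    by apply: sq; have := up1; rewrite mul1r rnorm1; exact.
  have a2 : rnorm (x - y) ^+ 2 <= (M * rnorm u) ^+ 2.
    by apply: sq; have := up2; rewrite mulN1r rnormN rnorm1 scaleNr; exact.
  have a3 : rnorm (x + 'i%C *: y) ^+ 2 <= (M * rnorm u) ^+ 2.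
    by apply: sq; have := up3; rewrite rnorm_i scalerA; exact.
  have a4 : rnorm (x - 'i%C *: y) ^+ 2 <= (M * rnorm u) ^+ 2.
    by apply: sq; have := up4; rewrite rnormN rnorm_i mulNr scaleNr scalerA; exact.
  rewrite /four_point; lra.
have xup : rnorm x ^+ 2 <= (M * rnorm u) ^+ 2.
  have := four_point_ge x y; lra.
have xlow : ((M - t) * rnorm u) ^+ 2 <= rnorm x ^+ 2.
  rewrite ler_pXn2r ?nnegrE ?rnorm_ge0 ?mulr_ge0 ?(ltW u0) ?(ltW hu)//; lra.
have ysq : (k * rnorm u) ^+ 2 <= rnorm y ^+ 2.
  have ku0 : 0 <= k * rnorm u by rewrite mulr_ge0 ?rnorm_ge0// ltW.
  by rewrite ler_pXn2r ?nnegrE ?rnorm_ge0.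
have h := hC x y.
have h1 : (k / (2 * M)) ^+ 2 * rnorm x ^+ 2 <= k ^+ 2 / 4 * rnorm u ^+ 2.
  rewrite (@le_trans _ _ ((k / (2 * M)) ^+ 2 * (M * rnorm u) ^+ 2))//.
    by rewrite ler_wpM2l ?sqr_ge0.
  rewrite le_eqVlt; apply/orP; left; apply/eqP; field.
  by rewrite gt_eqF.
have h2 : C * (four_point x y - 4 * rnorm x ^+ 2) <= k ^+ 2 / 4 * rnorm u ^+ 2.
  rewrite (@le_trans _ _ (C * (8 * M * t * rnorm u ^+ 2)))//.
    rewrite ler_wpM2l//; move: fp xlow; rewrite !exprMn; nra.
  rewrite mulrA ler_wpM2r ?sqr_ge0//.
  have : 0 <= M * t by rewrite mulr_ge0// ltW.
  lra.
have : 0 < (k * rnorm u) ^+ 2 by rewrite exprn_gt0// mulr_gt0.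
have := le_trans ysq (le_trans h (lerD h1 h2)); rewrite !exprMn.
move: (k ^+ 2) (rnorm u ^+ 2) => a d; lra.
Qed.

End four_point_excess.

(** * Finite-dimensional spaces *)

Section dimension_count.
Variables (F : fieldType) (V : vectType F).

Lemma dim_add_vector (U : {vspace V}) (v : V) : v \notin U ->
  \dim (U + <[v]>) = (\dim U).+1.
Proof.
move=> vU; rewrite dimv_disjoint_sum.
  by rewrite dim_vline (_ : v != 0) ?addn1//; apply: contra vU => /eqP ->; exact: mem0v.
apply/eqP; rewrite -subv0; apply/subvP => w /memv_capP[wU /vlineP[k wE]].
have [k0|k0] := eqVneq k 0; first by rewrite wE k0 scale0r memv0.
case/negP: vU; rewrite (_ : v = k^-1 *: w) ?memvZ//.
by rewrite wE scalerA mulVf// scale1r.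
Qed.

(* [ev l] : pairing with the [l]-th vector of a fixed sequence; the [s k] are
   triangular for these pairings. *)
Lemma extend_triangular (ev : nat -> V -> F) (K q q' : nat) (s : nat -> V)
    (P : V -> Prop) (U : {vspace V}) :
  (forall l a v w, ev l (a *: v + w) = a * ev l v + ev l w) ->
  (forall a v w, P v -> P w -> P (a *: v + w)) ->
  (q <= q')%N -> (q' <= K.+1)%N ->
  (forall v, v \in U -> P v /\ forall l, (q <= l <= K)%N -> ev l v = 0) ->
  (forall k, (q <= k < q')%N -> [/\ P (s k), ev k (s k) != 0 &
     forall l, (k < l <= K)%N -> ev l (s k) = 0]) ->
  exists2 U' : {vspace V}, (\dim U + (q' - q) <= \dim U')%N &
    forall v, v \in U' -> P v /\ forall l, (q' <= l <= K)%N -> ev l v = 0.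
Proof.
move=> evL PL qq' q'K hU hs.
suff : forall n, (q + n <= q')%N -> exists2 U' : {vspace V},
    (\dim U + n <= \dim U')%N &
    forall v, v \in U' -> P v /\ forall l, (q + n <= l <= K)%N -> ev l v = 0.
  by move=> /(_ (q' - q)%N); rewrite subnKC//; exact.
elim=> [|n IH] hn.
  by exists U; rewrite ?addn0// => v /hU; rewrite addn0.
have [|U1 dU1 hU1] := IH; first by lia.
have [Ps evs evs0] : [/\ P (s (q + n)%N), ev (q + n)%N (s (q + n)%N) != 0 &
    forall l, (q + n < l <= K)%N -> ev l (s (q + n)%N) = 0].
  by apply: hs; lia.
exists (U1 + <[s (q + n)%N]>)%VS.
  rewrite dim_add_vector; first by lia.
  apply: contra evs => /hU1[_ /(_ (q + n)%N)] -> //; lia.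
move=> v /memv_addP[u /hU1[Pu evu] [w /vlineP[k ->] ->]]; rewrite addrC.
split; first exact: PL.
move=> l hl; rewrite evL evs0; last lia.
by rewrite evu ?mulr0 ?addr0//; lia.
Qed.

End dimension_count.

Section local_operators.
Variables (F : fieldType) (X : lmodType F) (d : nat) (b : 'I_d -> X).
Hypothesis span_b : forall x, exists c : 'I_d -> F, x = \sum_(i < d) c i *: b i.
Variable L : nat.
Implicit Types (x y : nat -> X).

Definition delta j (v : X) : nat -> X := fun k => if k == j then v else 0.

(** The entries determine psi on sequences living on 0, ..., L - 1; independence is counted in this
    space of dimension L d. *)
Definition functional_matrix (psi : (nat -> X) -> F) : 'M[F]_(L, d) :=
  \matrix_(j, i) psi (delta j (b i)).

Let coef (v : X) : 'I_d -> F := projT1 (cid (span_b v)).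

Let coefE v : v = \sum_(i < d) coef v i *: b i.
Proof. exact: (projT2 (cid (span_b v))). Qed.

(** [b] spans X without being assumed free, so [coef] is a mere choice, and linearity is recorded in
    s only. *)
Definition pairing x (s : 'M[F]_(L, d)) : F :=
  \sum_(j < L) \sum_(i < d) s j i * coef (x j) i.

Lemma pairing_linear x a s t :
  pairing x (a *: s + t) = a * pairing x s + pairing x t.
Proof.
rewrite /pairing mulr_sumr -big_split; apply: eq_bigr => j _ /=.
rewrite mulr_sumr -big_split; apply: eq_bigr => i _ /=.
by rewrite !mxE mulrDl mulrA.
Qed.

Definition functional (psi : (nat -> X) -> F) :=
  forall a x y, psi (a *: x + y) = a * psi x + psi y.

Lemma functional0 psi : functional psi -> psi 0 = 0.
Proof.
move=> h; have := h (-1) 0 0; rewrite scaler0 addr0 mulN1r.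
by rewrite addNr.
Qed.

Lemma functional_sum psi (I : Type) (r : seq I) (a : I -> F) (x : I -> nat -> X) :
  functional psi -> psi (\sum_(i <- r) a i *: x i) = \sum_(i <- r) a i * psi (x i).
Proof.
move=> h; elim: r => [|i r IH]; first by rewrite !big_nil functional0.
by rewrite !big_cons h IH.
Qed.

Lemma pairing_functional psi x : functional psi -> (forall j, (L <= j)%N -> x j = 0) ->
  pairing x (functional_matrix psi) = psi x.
Proof.
move=> hpsi xL.
have xE : x = \sum_(j < L) 1 *: (\sum_(i < d) coef (x j) i *: delta j (b i)).
  apply/funext => k.
  have fsum (I : finType) (f : I -> nat -> X) : (\sum_i f i) k = \sum_i f i k.
    by elim/big_rec2 : _ => // i u v _ <-.
  rewrite fsum; under eq_bigr do rewrite scale1r fsum.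
  have [kL|kL] := ltnP k L.
    rewrite (bigD1 (Ordinal kL))//= [X in _ = _ + X]big1 ?addr0; last first.
      move=> j jk; rewrite big1// => i _; rewrite fctE /delta.
      rewrite (_ : (k == j) = false) ?scaler0//; apply/negbTE.
      by apply: contra jk => /eqP e; apply/eqP/val_inj.
    rewrite {1}(coefE (x k)); apply: eq_bigr => i _.
    by rewrite fctE /delta eqxx.
  rewrite xL// big1// => j _; rewrite big1// => i _; rewrite fctE /delta.
  rewrite (_ : (k == j) = false) ?scaler0//; apply/negbTE/eqP.
  by have := ltn_ord j; lia.
rewrite {2}xE functional_sum//; transitivity (\sum_(j < L) \sum_(i < d)
    coef (x j) i * psi (delta j (b i))); last first.
  by apply: eq_bigr => j _; rewrite mul1r functional_sum.
by apply: eq_bigr => j _; apply: eq_bigr => i _; rewrite mxE mulrC.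
Qed.

Lemma linear_fun0 (U W : lmodType F) (T : U -> W) : linear T -> T 0 = 0.
Proof.
by move=> h; have := h (-1) 0 0; rewrite scaler0 addr0 scaleN1r addNr.
Qed.

Lemma iter_linear_map (U : lmodType F) (T : U -> U) k :
  linear T -> linear (iter k T).
Proof. by move=> h; elim: k => // k IH a u v; rewrite !iterS IH h. Qed.

Variables (al be ga : nat -> X -> X) (phi : nat -> X -> F).
Hypothesis al_lin : forall j, linear (al j).
Hypothesis be_lin : forall j, linear (be j).
Hypothesis ga_lin : forall j, linear (ga j).
Hypothesis phi_lin : forall j a u v, phi j (a *: u + v) = a * phi j u + phi j v.

(** At j = 0 the missing left neighbour counts as 0; accordingly [g_rel] asks for relations at j > 0
    only. *)
Definition band_op x : nat -> X := fun j =>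
  (if j is j'.+1 then al j' (x j') else 0) + be j (x j) + ga j.+1 (x j.+1).

Lemma band_op_linear : linear band_op.
Proof.
move=> a x y; apply/funext => j; rewrite [RHS]/(a *: band_op x j + band_op y j).
rewrite /band_op !fctE; case: j => [|j].
  by rewrite !add0r be_lin ga_lin scalerDr [LHS]addrACA.
by rewrite al_lin be_lin ga_lin !scalerDr [X in X + _ = _]addrACA [LHS]addrACA.
Qed.

Definition cut lo hi x : nat -> X := fun j => if (lo <= j < hi)%N then x j else 0.

Lemma cut_linear lo hi : linear (cut lo hi).
Proof.
move=> a x y; apply/funext => j.
rewrite [RHS]/(a *: cut lo hi x j + cut lo hi y j) /cut.
by case: ifP => // _; rewrite scaler0; exact/esym/addr0.
Qed.

(** Each application of the operator reaches one site further. *)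
Lemma band_op_local k c x y :
  (forall j, (c <= j + k)%N -> (j <= c + k)%N -> x j = y j) ->
  iter k band_op x c = iter k band_op y c.
Proof.
elim: k c => [|k IH] c xy /=; first by apply: xy; rewrite addn0.
rewrite /band_op; congr (_ + be _ _ + ga _ _).
- case: c xy => // c xy; congr (al _ _); apply: IH => j h1 h2; apply: xy; lia.
- by apply: IH => j h1 h2; apply: xy; lia.
- by apply: IH => j h1 h2; apply: xy; lia.
Qed.

Lemma iter_functional (T : (nat -> X) -> nat -> X) k c : linear T ->
  functional (fun x => phi c (iter k T x c)).
Proof.
by move=> hT a x y; rewrite (iter_linear_map k hT) -phi_lin.
Qed.

Variables (K : nat) (g : nat -> nat -> X).
Hypothesis g_supp : forall l j, (L <= j)%N -> g l j = 0.
Hypothesis g_rel : forall l j, (0 < l <= K)%N -> (0 < j)%N -> (j.+1 < L)%N ->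
  band_op (g l) j = g l.-1 j.
Hypothesis phi_kill : forall l j, (0 < l <= K)%N -> (j < L)%N -> phi j (g l j) = 0.

Lemma iter_band_op k l c : (k <= l <= K)%N -> (k <= c)%N -> (c + k < L)%N ->
  iter k band_op (g l) c = g (l - k) c.
Proof.
elim: k c => [|k IH] c kl kc cL; first by rewrite subn0.
have -> : (l - k.+1 = (l - k).-1)%N by lia.
rewrite -g_rel; [|lia|lia|lia].
rewrite iterS /band_op; congr (_ + be _ _ + ga _ _).
- case: c kc cL => [|c] kc cL; first lia.
  by congr (al _ _); apply: IH; lia.
- by apply: IH; lia.
- by apply: IH; lia.
Qed.

(** Suppose phi_c (g_0 c) is nonzero. Since the g_l vanish at lo and hi, the operator T cut to the
    sites in between still maps the cut g_l to the cut g_(l-1). The functionals phi_c o T^k with k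
    <= K are then triangular on the g_l, and K + 1 > L d of them are too many. *)
Lemma dead_ends_contra lo hi c : (lo.+1 <= c < hi)%N -> (hi < L)%N ->
  (forall l, (l <= K)%N -> g l lo = 0) -> (forall l, (l <= K)%N -> g l hi = 0) ->
  (L * d <= K)%N -> phi c (g 0 c) = 0.
Proof.
move=> /andP[loc chi] hiL glo ghi LK; apply/eqP/negPn/negP => alive.
pose T x := cut lo.+1 hi (band_op x).
pose g' l := cut lo.+1 hi (g l).
have T_lin : linear T.
  move=> a x y; rewrite /T band_op_linear; exact: cut_linear.
have gin l j : (l <= K)%N -> (lo <= j <= hi)%N -> g' l j = g l j.
  move=> lK jh; rewrite /g' /cut; case: ifP => // /negbT nj.
  have [->|jlo] := eqVneq j lo; first by rewrite glo.
  have -> : j = hi by lia.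
  by rewrite ghi.
have Tg l : (0 < l <= K)%N -> T (g' l) = g' l.-1.
  move=> lK; apply/funext => j; rewrite /T {2}/g' /cut; case: ifP => // jh.
  rewrite -g_rel; [|lia|lia|lia].
  have lK' : (l <= K)%N by case/andP: lK.
  case: j jh => [|j] jh; first lia.
  by rewrite /band_op !gin//; lia.
have iterT k l : (k <= l <= K)%N -> iter k T (g' l) = g' (l - k)%N.
  elim: k => [|k IH] kl; first by rewrite subn0.
  by rewrite iterS IH ?Tg ?subnS//; lia.
have g'L l j : (L <= j)%N -> g' l j = 0.
  by move=> Lj; rewrite /g' /cut; case: ifP => // _; rewrite g_supp.
have g'c l : (l <= K)%N -> g' l c = g l c by move=> lK; apply: gin => //; lia.
pose s k := functional_matrix (fun x => phi c (iter k T x c)).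
have ps k l : (k <= l <= K)%N -> pairing (g' l) (s k) = phi c (g (l - k)%N c).
  move=> kl; rewrite pairing_functional; [|exact: iter_functional|exact: g'L].
  by rewrite iterT// g'c//; lia.
have [||||||U dU _] := @extend_triangular F _ (fun l => pairing (g' l)) K 0 K.+1 s
    (fun=> True) 0%VS.
- by move=> l; exact: pairing_linear.
- by [].
- by [].
- by [].
- move=> v; rewrite memv0 => /eqP ->; split => // l _.
  by have := pairing_linear (g' l) (-1) 0 0; rewrite scaler0 addr0 mulN1r addNr.
- move=> k kK; split => //; first by rewrite ps ?subnn//; lia.
  move=> l kl; rewrite ps; last lia.
  by apply: phi_kill; lia.
have := dimvS (subvf U); rewrite dimvf dim_matrix.
by move: dU; rewrite dimv0; lia.
Qed.

(** The two halves give spaces with disjoint supports that annihilate g_l for l at least half their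
    length. At the midpoint c, the functionals phi_c o (band_op)^k, with k from that value up to the
    length of a half, are triangular on the g_l and enlarge the sum. The gain of a quarter of the
    whole length at each scale adds up to p 2^p / 4. *)
Lemma alive_interval p a : (a + 2 ^ p <= L)%N -> (2 ^ p <= K.+1)%N ->
  (forall j, (a <= j < a + 2 ^ p)%N -> phi j (g 0 j) != 0) ->
  exists2 U : {vspace 'M[F]_(L, d)}, (p * 2 ^ p <= 4 * \dim U)%N &
    forall v, v \in U ->
      (forall (j : 'I_L) i, ~~ (a <= j < a + 2 ^ p)%N -> v j i = 0) /\
      forall l, (2 ^ p %/ 2 <= l <= K)%N -> pairing (g l) v = 0.
Proof.
have pairing0 l : pairing (g l) 0 = 0.
  by have := pairing_linear (g l) (-1) 0 0; rewrite scaler0 addr0 mulN1r addNr.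
elim: p a => [|p IH] a aL pK alive.
  exists 0%VS; first by rewrite mul0n.
  move=> v; rewrite memv0 => /eqP ->; split=> [j i _|l _]; first by rewrite mxE.
  exact: pairing0.
have p2 : (2 ^ p.+1 = 2 ^ p + 2 ^ p)%N by rewrite expnS mul2n addnn.
have pgt0 : (0 < 2 ^ p)%N by rewrite expn_gt0.
rewrite p2 in aL pK alive *.
have [|||U1 dU1 hU1] := IH a; [lia|lia|by move=> j hj; apply: alive; lia|].
have [|||U2 dU2 hU2] := IH (a + 2 ^ p)%N; [lia|lia|by move=> j hj; apply: alive; lia|].
have dU12 : \dim (U1 + U2) = (\dim U1 + \dim U2)%N.
  rewrite dimv_disjoint_sum//; apply/eqP; rewrite -subv0.
  apply/subvP => w /memv_capP[/hU1[w1 _] /hU2[w2 _]].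
  rewrite memv0; apply/eqP/matrixP => j i; rewrite mxE.
  by have [hj|hj] := boolP (a <= j < a + 2 ^ p)%N; [apply: w2; lia|exact: w1].
pose c := (a + 2 ^ p)%N.
pose s k := functional_matrix (fun x => phi c (iter k band_op x c)).
pose P (v : 'M[F]_(L, d)) := forall (j : 'I_L) i, ~~ (a <= j < a + (2 ^ p + 2 ^ p))%N -> v j i = 0.
have ps k l : (k <= l <= K)%N -> (k < 2 ^ p)%N ->
    pairing (g l) (s k) = phi c (g (l - k)%N c).
  move=> kl kp; rewrite pairing_functional; last exact: g_supp.
    by rewrite iter_band_op//; rewrite /c; lia.
  exact/iter_functional/band_op_linear.
have [||||||U dU hU] := @extend_triangular F _ (fun l => pairing (g l)) K
    (2 ^ p %/ 2) (2 ^ p) s P (U1 + U2)%VS.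
- by move=> l; exact: pairing_linear.
- by move=> t v w hv hw j i hj; rewrite !mxE hv// hw// mulr0 addr0.
- lia.
- lia.
- move=> v /memv_addP[u1 /hU1[u1s u1p] [u2 /hU2[u2s u2p] ->]]; split.
    by move=> j i hj; rewrite mxE u1s ?u2s ?addr0//; lia.
  move=> l hl; rewrite -[u1]scale1r pairing_linear u1p// u2p//.
  by rewrite mulr0 addr0.
- move=> k hk; split.
  (* k < 2^p keeps the sites reached from c inside the interval. *)
  + move=> j i hj; rewrite mxE (@band_op_local _ _ _ 0).
      rewrite (linear_fun0 (iter_linear_map k band_op_linear)) -[LHS]/(phi c 0).
      by have := phi_lin c (-1) 0 0; rewrite scaler0 addr0 mulN1r addNr.
    move=> t h1 h2; rewrite /delta; case: eqP => // tj; exfalso.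
    by move: hj; rewrite -tj; move: h1 h2; rewrite /c; lia.
  + by rewrite ps ?subnn; [apply: alive; rewrite /c; lia|lia|lia].
  + move=> l kl; rewrite ps; [|lia|lia].
    by apply: phi_kill; rewrite /c; lia.
exists U.
  move: dU dU1 dU2; rewrite dU12 mulnDr (mulSn p).
  have : (2 ^ p %/ 2 * 2 <= 2 ^ p)%N by exact: leq_divM.
  move: (2 ^ p %/ 2)%N (p * 2 ^ p)%N (2 ^ p)%N (\dim U) (\dim U1) (\dim U2).
  move=> h pm m u u1 u2; lia.
move=> v /hU[hv hl]; split; first exact: hv.
by move=> l; rewrite addnn -muln2 mulnK//; exact: hl.
Qed.

(** 2^p consecutive sites with phi_j (g_0 j) nonzero would give dimension p 2^p / 4 > L d. So on
    each side of the centre 2^p there is a site where all g_l vanish, and [dead_ends_contra] applies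
    between the two. *)
Lemma band_contra p : L = (2 * 2 ^ p).+1 -> (12 * d < p)%N ->
  (L * d <= K)%N -> (2 ^ p <= K)%N ->
  (forall j, (j < L)%N -> phi j (g 0 j) != 0 \/ forall l, (l <= K)%N -> g l j = 0) ->
  phi (2 ^ p)%N (g 0 (2 ^ p)%N) = 0.
Proof.
move=> LE dp LK pK alt.
have pgt0 : (0 < 2 ^ p)%N by rewrite expn_gt0.
have no_alive a : (a + 2 ^ p <= L)%N ->
    ~ (forall j, (a <= j < a + 2 ^ p)%N -> phi j (g 0 j) != 0).
  move=> aL alive; have [|U dU _] := alive_interval aL _ alive; first by lia.
  have := dimvS (subvf U); rewrite dimvf dim_matrix.
  move: dU; move: (\dim U) => u dU uL; have : (u <= (2 * 2 ^ p).+1 * d)%N by rewrite -LE.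
  by move: dU pgt0 dp; move: (2 ^ p)%N => m; nia.
have dead_in a : (a + 2 ^ p <= L)%N -> exists2 j, (a <= j < a + 2 ^ p)%N &
    forall l, (l <= K)%N -> g l j = 0.
  move=> aL; apply: contrapT => h; apply: (no_alive a aL) => j hj.
  have [|//|hd] := alt j; first by lia.
  by exfalso; apply: h; exists j.
have [|lo hlo dlo] := dead_in 0%N; first by lia.
have [|hi hhi dhi] := dead_in (2 ^ p).+1; first by lia.
by apply: (@dead_ends_contra lo hi) => //; lia.
Qed.

End local_operators.

(** * Ultralimits in normed and in finitely spanned spaces *)

Section ultralimit_arithmetic.
Context {R : realType} (U : set_system nat) {UU : UltraFilter U}.
Context {V : normedModType R[i]}.
Implicit Types (u v : nat -> V).

Lemma ulim_unique u l l' : ulim U u l -> ulim U u l' -> l = l'.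
Proof.
move=> h h'; apply/eqP; rewrite -subr_eq0 -rnorm_eq0 eq_le rnorm_ge0 andbT.
apply/ler_addgt0Pr => e e0; rewrite add0r; have e20 : 0 < e / 2 by rewrite divr_gt0.
have [n [/= h1 h2]] := filter_ex (filterI (h _ e20) (h' _ e20)).
rewrite (_ : l - l' = (u n - l') - (u n - l)); last by rewrite opprB [RHS]addrC addrA subrK.
by rewrite (le_trans (rnormD _ _))// rnormN [leRHS](splitr e) lerD.
Qed.

Lemma ulim_ext u v l : U [set n | u n = v n] -> ulim U u l -> ulim U v l.
Proof. by move=> uv h e e0; apply: filterS2 uv (h e e0) => n /= ->. Qed.

Lemma ulim_near u l (C : R) (w : nat -> V) (l' : V) :
  (forall n, rnorm (w n - l') <= C * rnorm (u n - l)) -> ulim U u l -> ulim U w l'.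
Proof.
move=> h ul e e0.
have C0 : 0 < `|C| + 1 by rewrite ltr_wpDl.
apply: filterS (ul (e / (`|C| + 1)) (divr_gt0 e0 C0)) => n /= hn.
rewrite (le_trans (h n))// (@le_trans _ _ ((`|C| + 1) * rnorm (u n - l)))//.
  by rewrite ler_wpM2r ?rnorm_ge0// (le_trans (ler_norm _))// lerDl.
by rewrite mulrC -ler_pdivlMr.
Qed.

Lemma ulim_cst (l : V) : ulim U (fun=> l) l.
Proof. by move=> e e0; apply: filterE => n /=; rewrite subrr rnorm0 ltW. Qed.

Lemma ulimD u v l l' : ulim U u l -> ulim U v l' ->
  ulim U (fun n => u n + v n) (l + l').
Proof.
move=> h h' e e0; have e20 : 0 < e / 2 by rewrite divr_gt0.
apply: filterS (filterI (h _ e20) (h' _ e20)) => n [/= h1 h2].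
by rewrite opprD addrACA (le_trans (rnormD _ _))// [leRHS](splitr e) lerD.
Qed.

Lemma ulimZ (a : R[i]) u l : ulim U u l -> ulim U (fun n => a *: u n) (a *: l).
Proof.
by apply: (@ulim_near _ _ (rnorm a)) => n; rewrite -scalerBr rnormZ.
Qed.

Lemma ulimZl (t : nat -> R[i]) (a : R[i]) (v : V) : ulim U t a ->
  ulim U (fun n => t n *: v) (a *: v).
Proof.
move=> ta e e0; have v0 : 0 < rnorm v + 1 by rewrite ltr_wpDl ?rnorm_ge0.
apply: filterS (ta _ (divr_gt0 e0 v0)) => n /=.
rewrite ler_pdivlMr// -scalerBl rnormZ; apply: le_trans.
by rewrite ler_wpM2l ?rnorm_ge0// lerDl.
Qed.

Lemma ulim_rnorm u l : ulim U u l -> (fun n => rnorm (u n)) @ U --> rnorm l.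
Proof.
move=> h; apply/cvgrPdist_le => e e0; apply: filterS (h e e0) => n /= hn.
rewrite ler_norml; have := ler_rnormB (u n) l; have := ler_rnormB l (u n).
rewrite [rnorm (l - u n)]rnorm_distC => h1 h2; apply/andP; split; lra.
Qed.

(** Induction on d, without independence of b: a last vector in the span of the others is dropped;
    otherwise its coefficients are bounded and have an ultralimit. *)
Lemma span_ulim d (b : 'I_d -> V) u (M : R) :
  (forall n, exists c : 'I_d -> R[i], u n = \sum_(i < d) c i *: b i) ->
  U [set n | rnorm (u n) <= M] ->
  exists l, ulim U u l /\ exists c : 'I_d -> R[i], l = \sum_(i < d) c i *: b i.
Proof.
elim: d b u M => [|d IH] b u M ub uM.
  exists 0; split; last by exists (fun=> 0); rewrite big_ord0.
  apply: (@ulim_ext (fun=> 0)); last exact: ulim_cst.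
  by apply: filterE => n /=; have [c ->] := ub n; rewrite big_ord0.
pose b' (i : 'I_d) := b (widen_ord (leqnSn d) i).
have /choice[c cE] := ub.
pose t n := c n ord_max.
pose y n := \sum_(i < d) c n (widen_ord (leqnSn d) i) *: b' i.
have uE n : u n = y n + t n *: b ord_max by rewrite cE big_ord_recr.
have yb n : exists c : 'I_d -> R[i], y n = \sum_(i < d) c i *: b' i.
  by exists (fun i => c n (widen_ord (leqnSn d) i)).
have lift_span (x : V) : (exists c : 'I_d -> R[i], x = \sum_(i < d) c i *: b' i) ->
    forall s : R[i], exists c : 'I_d.+1 -> R[i],
      x + s *: b ord_max = \sum_(i < d.+1) c i *: b i.
  move=> [c' ->] s; exists (fun i => if unlift ord_max i is Some j then c' j else s).
  rewrite big_ord_recr/= unlift_none; congr (_ + _); apply: eq_bigr => i _.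
  rewrite (_ : widen_ord (leqnSn d) i = lift ord_max i) ?liftK; last first.
    by apply: val_inj => /=; rewrite /bump leqNgt ltn_ord add0n.
  by congr (_ *: _); rewrite /b'; congr b; apply: val_inj => /=; rewrite /bump leqNgt ltn_ord.
have [[c0 bE]|nb] := pselect (exists c : 'I_d -> R[i], b ord_max = \sum_(i < d) c i *: b' i).
  have [n|l [ul lb]] := IH b' u M _ uM.
    exists (fun i => c n (widen_ord (leqnSn d) i) + t n * c0 i).
    rewrite uE bE scaler_sumr -big_split/=; apply: eq_bigr => i _.
    by rewrite scalerDl scalerA.
  exists l; split => //; have [c' c'E] := lift_span l lb 0.
  by exists c'; rewrite -c'E scale0r addr0.
(* With unbounded coefficients t n, the vectors y n / t n would tend to minus the last vector,
   putting it in the span of the others. *)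
have [T hT] : exists T : R, U [set n | rnorm (t n) <= T].
  apply: contrapT => /forallNP hn.
  have big (T : R) : U [set n | T < rnorm (t n)].
    have [//|] := @in_ultra_setVsetC _ U [set n | rnorm (t n) <= T] UU.
      by move=> h; case: (hn T).
    by apply: filterS => n /= /negP; rewrite -ltNge.
  pose v n := (t n)^-1 *: y n.
  have vlim : ulim U v (- b ord_max).
    move=> e e0; apply: filterS (filterI uM (filterI (big 0) (big (M / e)))).
    move=> n [/= h1 [h2 h3]]; rewrite opprK.
    have tn0 : t n != 0 by rewrite -rnorm_gt0.
    have -> : v n + b ord_max = (t n)^-1 *: u n.
      by rewrite uE scalerDr scalerA mulVf// scale1r.
    rewrite rnormZ rnormV ler_pdivrMl// (le_trans h1)//.
    by rewrite ltW// -ltr_pdivrMr.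
  have [n||l [vl [c' lE]]] := IH b' v (rnorm (b ord_max) + 1).
  - have [c' yE] := yb n; exists (fun i => (t n)^-1 * c' i).
    by rewrite /v yE scaler_sumr; apply: eq_bigr => i _; rewrite scalerA.
  - apply: filterS (vlim 1 ltr01) => n /= h.
    rewrite -[v n](subrK (- b ord_max)) (le_trans (rnormD _ _))// rnormN addrC.
    by rewrite lerD2l.
  apply: nb; exists (fun i => - c' i).
  rewrite -[LHS]opprK -(ulim_unique vl vlim) lE -sumrN.
  by apply: eq_bigr => i _; rewrite scaleNr.
have [tau htau] := complex_ulim hT.
have [|l [yl lb]] := IH b' y (M + T * rnorm (b ord_max)) yb.
  apply: filterS2 uM hT => n /= h1 h2.
  rewrite (_ : y n = u n - t n *: b ord_max); last by rewrite uE addrK.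
  rewrite (le_trans (rnormD _ _))// rnormN rnormZ lerD// ler_wpM2r ?rnorm_ge0//.
exists (l + tau *: b ord_max); split; last exact: lift_span.
apply: (@ulim_ext (fun n => y n + t n *: b ord_max)).
  by apply: filterE => n /=; rewrite uE.
by apply: ulimD => //; exact: ulimZl.
Qed.

End ultralimit_arithmetic.

(** * Near-maximisers of [rnorm (T u)] *)

Section near_maximisers.
Context {R : realType} (X : normedModType R[i]) (T : 'L(ell2 X, ell2 X)).
Variables (M : R) (c : nat -> R).
Hypothesis M0 : 0 < M.
Hypothesis T_le : forall x, rnorm (T x) <= M * rnorm x.
Hypothesis T_avg : forall k (s : R[i]) x, (0 < k)%N -> rnorm s <= 1 ->
  rnorm (T x + (s * (c k)%:C%C) *: iter k.+1 T x) <= M * rnorm x.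
Hypothesis T_near : forall M', 0 < M' < M -> exists u, M' * rnorm u < rnorm (T u).

Definition two_point_excess (x y : X) : R :=
  rnorm (x + y) ^+ 2 + rnorm (x - y) ^+ 2 - 2 * rnorm x ^+ 2.

Lemma two_point_excess_ge0 x y : 0 <= two_point_excess x y.
Proof. by rewrite subr_ge0 two_point_ge. Qed.

Lemma two_point_excess_scale (s : R[i]) x y :
  two_point_excess (s *: x) (s *: y) = rnorm s ^+ 2 * two_point_excess x y.
Proof. rewrite /two_point_excess -scalerDr -scalerBr !rnormZ !exprMn; ring. Qed.

Lemma shifted_fsum_le (f : int -> R) (F : {fset int}) (s : int) (C : R) :
  (forall G : {fset int}, \sum_(i <- G) f i <= C) ->
  \sum_(i <- F) f (i + s) <= C.
Proof.
move=> h; rewrite -(big_map (fun j => j + s) xpredT f).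
have := h [fset j in [seq (i + s)%R | i <- F]]%fset.
rewrite (perm_big [seq i + s | i <- F])//; apply: uniq_perm => [||j]; rewrite ?fset_uniq ?inE//.
by rewrite map_inj_uniq ?fset_uniq//; exact: addIr.
Qed.

Lemma near_unit_maximiser (eta : R) : 0 < eta ->
  exists u, rnorm u = 1 /\ M ^+ 2 - eta <= rnorm (T u) ^+ 2.
Proof.
move=> eta0; pose t := Num.min (M / 2) (eta / (2 * M)).
have t0 : 0 < t by rewrite lt_min !divr_gt0// mulr_gt0.
have tM : t <= M / 2 by rewrite ge_min lexx.
have te : t * (2 * M) <= eta by rewrite -ler_pdivlMr ?mulr_gt0// ge_min lexx orbT.
have [|u hu] := @T_near (M - t); first by apply/andP; split; lra.
have u0 : u != 0.
  by apply/eqP => u0; move: hu; rewrite u0 bop0 !rnorm0 mulr0 ltxx.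
have u_gt0 : 0 < rnorm u by rewrite rnorm_gt0.
exists ((rnorm u)^-1%:C%C *: u); split; first exact: normalize_rnorm.
have Mt0 : 0 <= M - t by lra.
rewrite (@le_trans _ _ ((M - t) ^+ 2))//; first by have := sqr_ge0 t; nra.
rewrite ler_pXn2r ?nnegrE ?rnorm_ge0// bopZ rnormZ rnorm_pos ?invr_ge0 ?rnorm_ge0//.
by rewrite ler_pdivlMl// mulrC ltW.
Qed.

(** Over all coordinates the sum is |T u + y|^2 + |T u - y|^2 - 2 |T u|^2, at most 2 M^2 - 2 (M^2 -
    eta). The terms are nonnegative, so F may be enlarged until it carries almost all of |T u|^2. *)
Lemma excess_fsum_le (eta : R) u k (F : {fset int}) : (0 < k)%N -> rnorm u = 1 ->
  M ^+ 2 - eta <= rnorm (T u) ^+ 2 ->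
  \sum_(i <- F) two_point_excess (T u i) ((c k)%:C%C *: iter k.+1 T u i) <= 2 * eta.
Proof.
move=> k0 u1 hu; pose y : ell2 X := (c k)%:C%C *: iter k.+1 T u.
apply/ler_addgt0Pr => e e0; have e20 : 0 < e / 2 by rewrite divr_gt0.
have [G hG] := ell2norm_approx (T u) e20.
have sub : \sum_(i <- F) two_point_excess (T u i) (y i) <=
    \sum_(i <- (F `|` G)%fset) two_point_excess (T u i) (y i).
  rewrite [leRHS](big_fsetID _ (mem F))/=.
  rewrite (_ : [fset j in (F `|` G)%fset | j \in F]%fset = F); last first.
    by apply/fsetP => j; rewrite !inE/=; case: (j \in F); rewrite ?andbF.
  by rewrite lerDl; apply: sumr_ge0 => j _; exact: two_point_excess_ge0.
rewrite (le_trans sub)// /two_point_excess !big_split/= sumrN -mulr_sumr.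
have h1 : rnorm (T u + y) ^+ 2 <= M ^+ 2.
  have r1 : rnorm (1 : R[i]) <= 1 by rewrite rnorm1.
  have := T_avg u k0 r1.
  by rewrite mul1r u1 mulr1 => h; rewrite ler_pXn2r ?nnegrE ?rnorm_ge0 ?(ltW M0).
have h2 : rnorm (T u - y) ^+ 2 <= M ^+ 2.
  have r1 : rnorm (-1 : R[i]) <= 1 by rewrite rnormN rnorm1.
  have := T_avg u k0 r1.
  rewrite mulN1r scaleNr u1 mulr1 => h.
  by rewrite ler_pXn2r ?nnegrE ?rnorm_ge0 ?(ltW M0).
have h3 := ell2norm_fsum (T u + y) (F `|` G)%fset.
have h4 := ell2norm_fsum (T u - y) (F `|` G)%fset.
have h5 := fsum_subset_le (T u) (fsubsetUr F G).
have h6 : \sum_(j <- (F `|` G)%fset) rnorm (T u j + y j) ^+ 2 <= M ^+ 2 := le_trans h3 h1.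
have h7 : \sum_(j <- (F `|` G)%fset) rnorm (T u j - y j) ^+ 2 <= M ^+ 2 := le_trans h4 h2.
have hu' : M ^+ 2 - eta <= ell2norm (T u) ^+ 2 := hu.
lra.
Qed.

(* [j0] exists because the sum over [i] of the left-hand sides at [j0 = i] is
   bounded, while the sum of [|T u i|^2] is nearly [M^2]. *)
Lemma localized_maximiser (K L m : nat) : exists2 C : R, 0 <= C &
  forall eta : R, 0 < eta -> exists u, exists j0 : int,
    T u j0 != 0 /\ forall l j, (l <= K)%N -> (j < L)%N ->
      rnorm (iter l.+1 T u (j0 + (j%:Z - m%:Z))) ^+ 2 <= C * rnorm (T u j0) ^+ 2 /\
      ((0 < l)%N -> two_point_excess (T u (j0 + (j%:Z - m%:Z)))
         ((c l)%:C%C *: iter l.+1 T u (j0 + (j%:Z - m%:Z)))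
       <= eta * C * rnorm (T u j0) ^+ 2).
Proof.
(* Bound for sums of q l over sites: M^(2 (l + 1)) from the norm of T^(l+1) u, and 2 from the excess
   divided by eta. *)
pose D (l : nat) : R := (M ^+ l.+1) ^+ 2 + 2.
pose C0 := \sum_(l < K.+1) \sum_(j < L) D l.
have D0 l : 0 <= D l by rewrite addr_ge0 ?sqr_ge0.
have C00 : 0 <= C0 by apply: sumr_ge0 => l _; apply: sumr_ge0.
have M20 : 0 < M ^+ 2 by rewrite exprn_gt0.
(* As |T u|^2 >= M^2 / 2, this makes C |T u|^2 >= C0 + 1, more than any finite sum of Q. *)
pose C := (C0 + 1) * 2 / M ^+ 2.
have Cge0 : 0 <= C.
  by rewrite /C divr_ge0 ?(ltW M20)// mulr_ge0// addr_ge0.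
exists C => // eta' eta'0; pose eta := Num.min eta' (M ^+ 2 / 2).
have eta0 : 0 < eta by rewrite lt_min eta'0 divr_gt0.
have etale : eta <= eta' by rewrite ge_min lexx.
have etaM : eta <= M ^+ 2 / 2 by rewrite ge_min lexx orbT.
have [u [u1 hu]] := near_unit_maximiser eta0; exists u.
pose dd l i : R := if (0 < l)%N then
  two_point_excess (T u i) ((c l)%:C%C *: iter l.+1 T u i) else 0.
have dd0 l i : 0 <= dd l i by rewrite /dd; case: ifP; rewrite ?two_point_excess_ge0.
pose q l i := rnorm (iter l.+1 T u i) ^+ 2 + eta^-1 * dd l i.
have q0 l i : 0 <= q l i.
  by rewrite addr_ge0 ?sqr_ge0 ?mulr_ge0 ?invr_ge0 ?(ltW eta0).
have qsum l s (F : {fset int}) : \sum_(i <- F) q l (i + s) <= D l.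
  rewrite big_split/= lerD//.
    rewrite (le_trans (shifted_sum_le (iter l.+1 T u) F s))//.
    rewrite ler_pXn2r ?nnegrE ?ell2norm_ge0 ?exprn_ge0 ?(ltW M0)//.
    by have := iter_bop_le (ltW M0) T_le l.+1 u; rewrite u1 mulr1.
  have h : \sum_(i <- F) dd l (i + s) <= 2 * eta.
    apply: (@shifted_fsum_le (dd l) F s (2 * eta)) => G.
      rewrite /dd; case: (boolP (0 < l)%N) => l0.
      exact: excess_fsum_le.
    by rewrite big1// mulr_ge0// ltW.
  by rewrite -mulr_sumr ler_pdivrMl// mulrC.
pose Q i := \sum_(l < K.+1) \sum_(j < L) q l (i + (j%:Z - m%:Z)).
have Qsum (F : {fset int}) : \sum_(i <- F) Q i <= C0.
  rewrite exchange_big/=; apply: ler_sum => l _.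
  by rewrite exchange_big/=; apply: ler_sum => j _; exact: qsum.
have [j0 [xj0 hj0]] : exists j0, T u j0 != 0 /\ Q j0 <= C * rnorm (T u j0) ^+ 2.
  apply: contrapT => hn.
  have hQ i : C * rnorm (T u i) ^+ 2 <= Q i.
    have [->|xi] := eqVneq (T u i) 0.
      by rewrite rnorm0 expr0n mulr0; apply: sumr_ge0 => l _; apply: sumr_ge0.
    rewrite leNgt; apply/negP => h; apply: hn; exists i; split=> //; exact: ltW.
  have : C * rnorm (T u) ^+ 2 <= C0.
    apply/ler_addgt0Pr => e e0.
    have e'0 : 0 < e / (C + 1) by rewrite divr_gt0// ltr_wpDl.
    have [F hF] := ell2norm_approx (T u) e'0.
    rewrite (@le_trans _ _ (C * (\sum_(j <- F) rnorm (T u j) ^+ 2 + e / (C + 1))))//.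
      by rewrite ler_wpM2l.
    rewrite mulrDr lerD//.
      rewrite (le_trans _ (Qsum F))// mulr_sumr; apply: ler_sum => i _; exact: hQ.
    by rewrite mulrCA ler_piMr ?(ltW e0)// ler_pdivrMr ?ltr_wpDl// mul1r lerDl.
  apply/negP; rewrite -ltNge (@lt_le_trans _ _ (C * (M ^+ 2 / 2)))//.
    rewrite (_ : C * _ = C0 + 1) ?ltrDl// /C; field; exact: lt0r_neq0.
  by rewrite ler_wpM2l//; lra.
exists j0; split => // l j lK jL.
have qle : q l (j0 + (j%:Z - m%:Z)) <= C * rnorm (T u j0) ^+ 2.
  apply: le_trans hj0.
  have lK' : (l < K.+1)%N by [].
  rewrite /Q (bigD1 (Ordinal lK'))//= (bigD1 (Ordinal jL))//= -addrA lerDl.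
  by rewrite addr_ge0//; apply: sumr_ge0 => *; [|apply: sumr_ge0].
split=> [|l0].
  by rewrite (le_trans _ qle)// lerDl mulr_ge0// invr_ge0 ltW.
have : eta^-1 * dd l (j0 + (j%:Z - m%:Z)) <= C * rnorm (T u j0) ^+ 2.
  by rewrite (le_trans _ qle)// lerDr sqr_ge0.
rewrite ler_pdivrMl// /dd l0 => /le_trans; apply.
by rewrite mulrA ler_wpM2r ?sqr_ge0// ler_wpM2r.
Qed.

End near_maximisers.

(** * The contradiction in finite dimension *)

Section finite_dimensional_case.
Context {R : realType} (X : normedModType R[i]).
Variables (d : nat) (b : 'I_d -> X).
Hypothesis span_b : forall x, exists c : 'I_d -> R[i], x = \sum_(i < d) c i *: b i.

Lemma span_bounded_ulim (U : set_system nat) {UU : UltraFilter U} (u : nat -> X) (M : R) :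
  (forall n, rnorm (u n) <= M) -> exists l, ulim U u l.
Proof.
move=> uM; have uM' : U [set n | rnorm (u n) <= M] by exact: filterE.
have [n|l [ul _]] := @span_ulim R U UU X d b u M _ uM'.
  exact: span_b.
by exists l.
Qed.

(** Operator and argument both vary with n; the uniform bound C controls f n (x n - l). *)
Lemma ulim_apply (U : set_system nat) {UU : UltraFilter U} (f : nat -> X -> X)
    (C : R) (x : nat -> X) (l w : X) :
  (forall n, linear (f n)) -> (forall n v, rnorm (f n v) <= C * rnorm v) ->
  ulim U x l -> ulim U (fun n => f n l) w -> ulim U (fun n => f n (x n)) w.
Proof.
move=> fl fC xl flw.
have h : ulim U (fun n => f n (x n - l)) 0.
  apply: ulim_near xl => n; rewrite subr0; exact: fC.
apply: (@ulim_ext _ U UU _ (fun n => f n (x n - l) + f n l)).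
  by apply: filterE => n /=; have := fl n 1 (x n - l) l; rewrite !scale1r subrK.
by rewrite -[w]add0r; exact: ulimD.
Qed.

Lemma ulim_linear_map (U : set_system nat) {UU : UltraFilter U} (f : nat -> X -> X)
    (F : X -> X) : (forall n, linear (f n)) ->
  (forall v, ulim U (fun n => f n v) (F v)) -> linear F.
Proof.
move=> fl fF s u v; apply: (ulim_unique (fF _)).
apply: (@ulim_ext _ U UU _ (fun n => s *: f n u + f n v)).
  by apply: filterE => n /=; rewrite fl.
by apply: ulimD => //; exact: ulimZ.
Qed.

Lemma two_point_excess_ulim (U : set_system nat) {UU : UltraFilter U}
    (x y : nat -> X) (x' y' : X) (e : nat -> R) :
  ulim U x x' -> ulim U y y' ->
  (forall n, two_point_excess (x n) (y n) <= e n) ->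
  (forall r : R, 0 < r -> exists N : nat, forall n : nat, (N <= n)%N -> e n <= r) ->
  (forall N : nat, U [set n | (N <= n)%N]) ->
  two_point_excess x' y' <= 0.
Proof.
move=> xx yy he e0 UN; apply/ler_addgt0Pr => r r0; rewrite add0r.
have ny : ulim U (fun n => - y n) (- y').
  by rewrite -scaleN1r; apply: ulim_ext (ulimZ (-1) yy); apply: filterE => n /=; rewrite scaleN1r.
have sq (z : nat -> X) z' : ulim U z z' ->
    (fun n => rnorm (z n) ^+ 2) @ U --> rnorm z' ^+ 2.
  by move=> /ulim_rnorm h; rewrite expr2; under eq_cvg do rewrite expr2; exact: cvgM.
have h : (fun n => two_point_excess (x n) (y n)) @ U --> two_point_excess x' y'.
  apply: cvgB; first by apply: cvgD; apply: sq; exact: ulimD.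
  by apply: cvgM; [exact: cvg_cst|exact: sq].
have r20 : 0 < r / 2 by rewrite divr_gt0.
have /cvgrPdist_le h' := h.
have [N hN] := e0 _ r20.
have [n [/= h1 h2]] := filter_ex (filterI (h' _ r20) (UN N)).
have := hN n h2; have := he n; move: h1; rewrite ler_norml => /andP[_]; lra.
Qed.

Variables (T B : 'L(ell2 X, ell2 X)) (M Cb : R) (c : nat -> R).
Variables (a b' c' : int -> X -> X).
Hypothesis a_lin : forall i, linear (a i).
Hypothesis b_lin : forall i, linear (b' i).
Hypothesis c_lin : forall i, linear (c' i).
Hypothesis a_le : forall i v, rnorm (a i v) <= Cb * rnorm v.
Hypothesis b_le : forall i v, rnorm (b' i v) <= Cb * rnorm v.
Hypothesis c_le : forall i v, rnorm (c' i v) <= Cb * rnorm v.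
Hypothesis BE : forall x : ell2 X, tridiagonal_image a b' c' x (B x).
Hypothesis BT : forall x, B (T x) = x.
Hypothesis M0 : 0 < M.
Hypothesis c0 : forall k, 0 < c k.
Hypothesis T_le : forall x, rnorm (T x) <= M * rnorm x.
Hypothesis T_avg : forall k (s : R[i]) x, (0 < k)%N -> rnorm s <= 1 ->
  rnorm (T x + (s * (c k)%:C%C) *: iter k.+1 T x) <= M * rnorm x.
Hypothesis T_near : forall M', 0 < M' < M -> exists u, M' * rnorm u < rnorm (T u).

Lemma finite_dimensional_contra : False.
Proof.
(* L sites centred at m, with p > 12 d; K is large enough for both L d <= K and 2^p <= K, as
   [band_contra] asks. *)
pose p := (12 * d).+1; pose m := (2 ^ p)%N; pose L := (2 * m).+1; pose K := (L * d + m)%N.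
have [C C0 hC] := localized_maximiser M0 T_le T_avg T_near K L m.
have /choice[u hu] : forall n : nat, exists u, exists j0 : int,
    T u j0 != 0 /\ forall l j, (l <= K)%N -> (j < L)%N ->
      rnorm (iter l.+1 T u (j0 + (j%:Z - m%:Z))) ^+ 2 <= C * rnorm (T u j0) ^+ 2 /\
      ((0 < l)%N -> two_point_excess (T u (j0 + (j%:Z - m%:Z)))
         ((c l)%:C%C *: iter l.+1 T u (j0 + (j%:Z - m%:Z)))
       <= (n.+1%:R)^-1 * C * rnorm (T u j0) ^+ 2).
  by move=> n; apply: hC; rewrite invr_gt0.
have {hu}/choice[j0 hj] := hu.
(* Translation brings the site j0 n to the centre m, and rho n turns the value of T (u n) there into
   a unit vector. *)
pose pos n (j : nat) : int := j0 n + (j%:Z - m%:Z).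
pose rho n := (rnorm (T (u n) (j0 n)))^-1.
have rho0 n : 0 < rho n by rewrite invr_gt0 rnorm_gt0; exact: (hj n).1.
pose G n l j : X := (rho n)%:C%C *: iter l.+1 T (u n) (pos n j).
have scale_le n (x : X) (D : R) : rnorm x ^+ 2 <= D * rnorm (T (u n) (j0 n)) ^+ 2 ->
    rnorm ((rho n)%:C%C *: x) ^+ 2 <= D.
  move=> h; rewrite rnormZ (rnorm_pos (ltW (rho0 n))) exprMn /rho exprVn.
  by rewrite ler_pdivrMl ?exprn_gt0 ?rnorm_gt0 ?(hj n).1// mulrC.
have GC n l j : (l <= K)%N -> (j < L)%N -> rnorm (G n l j) <= C + 1.
  move=> lK jL; have h := scale_le n _ _ ((hj n).2 l j lK jL).1.
  have hh : rnorm (G n l j) ^+ 2 <= C := h.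
  rewrite leNgt; apply/negP => h'; have := rnorm_ge0 (G n l j); nra.
have Gex n l j : (0 < l <= K)%N -> (j < L)%N ->
    two_point_excess (G n 0 j) ((c l)%:C%C *: G n l j) <= (n.+1%:R)^-1 * C.
  move=> /andP[l0 lK] jL; have h := ((hj n).2 l j lK jL).2 l0.
  rewrite /G scalerA [(c l)%:C%C * _]mulrC -scalerA.
  rewrite two_point_excess_scale (rnorm_pos (ltW (rho0 n))) exprVn.
  by rewrite ler_pdivrMl ?exprn_gt0 ?rnorm_gt0 ?(hj n).1// mulrC.
have [U [UU UN]] := exists_free_ultrafilter.
have /choice[g0 hg0] : forall lj : nat * nat, exists v, (lj.1 <= K)%N -> (lj.2 < L)%N ->
    ulim U (fun n => G n lj.1 lj.2) v.
  case=> l j /=; have [/andP[lK jL]|nlj] := boolP ((l <= K)%N && (j < L)%N).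
    by have [|v hv] := @span_bounded_ulim U UU (fun n => G n l j) (C + 1) _; [move=> n; exact: GC|exists v].
  by exists 0 => lK jL; rewrite lK jL in nlj.
pose g l j : X := if (j < L)%N then g0 (l, j) else 0.
have Gg l j : (l <= K)%N -> (j < L)%N -> ulim U (fun n => G n l j) (g l j).
  by move=> lK jL; rewrite /g jL; exact: (hg0 (l, j)).
have limop (f : int -> X -> X) : (forall i v, rnorm (f i v) <= Cb * rnorm v) ->
    exists F : nat -> X -> X, forall j v, ulim U (fun n => f (pos n j) v) (F j v).
  move=> fC; have /choice[F hF] : forall jv : nat * X, exists w,
      ulim U (fun n => f (pos n jv.1) jv.2) w.
    by move=> jv; apply: (@span_bounded_ulim U UU _ (Cb * rnorm jv.2)) => n; exact: fC.
  by exists (fun j v => F (j, v)) => j v; exact: (hF (j, v)).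
have [al hal] := limop a a_le; have [be hbe] := limop b' b_le.
have [ga hga] := limop c' c_le.
have al_lin j : linear (al j).
  by apply: (@ulim_linear_map U UU (fun n => a (pos n j))) => // n; exact: a_lin.
have be_lin j : linear (be j).
  by apply: (@ulim_linear_map U UU (fun n => b' (pos n j))) => // n; exact: b_lin.
have ga_lin j : linear (ga j).
  by apply: (@ulim_linear_map U UU (fun n => c' (pos n j))) => // n; exact: c_lin.
have linZ (f : X -> X) (s : R[i]) x : linear f -> f (s *: x) = s *: f x.
  by move=> h; have := h s x 0; rewrite !addr0 (linear_fun0 h) addr0.
have g_rel l j : (0 < l <= K)%N -> (0 < j)%N -> (j.+1 < L)%N ->
    band_op al be ga (g l) j = g l.-1 j.
  move=> /andP[l0 lK] jgt0 jL; case: j jgt0 jL => [//|j] _ jL.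
  have Gj := Gg l.-1 j.+1 (leq_trans (leq_pred l) lK) (ltnW jL).
  apply: ulim_unique Gj.
  apply: (@ulim_ext _ U UU _ (fun n => a (pos n j) (G n l j)
      + b' (pos n j.+1) (G n l j.+1) + c' (pos n j.+2) (G n l j.+2))).
    apply: filterE => n /=; rewrite /G !(linZ _ _ _ (a_lin _)) !(linZ _ _ _ (b_lin _)) !(linZ _ _ _ (c_lin _)).
    rewrite -!scalerDr; congr (_ *: _); rewrite (prednK l0) -[iter l T (u n)]BT -iterS.
    rewrite BE; rewrite (_ : pos n j.+1 - 1 = pos n j); last by rewrite /pos; lia.
    by rewrite (_ : pos n j.+1 + 1 = pos n j.+2)//; rewrite /pos; lia.
  rewrite /band_op; apply: ulimD; first apply: ulimD.
  - apply: (@ulim_apply U UU (fun n => a (pos n j)) Cb _ (g l j)) => //.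
    by apply: Gg => //; lia.
  - apply: (@ulim_apply U UU (fun n => b' (pos n j.+1)) Cb _ (g l j.+1)) => //.
    by apply: Gg => //; lia.
  - apply: (@ulim_apply U UU (fun n => c' (pos n j.+2)) Cb _ (g l j.+2)) => //.
    by apply: Gg => //; lia.
have ex_le l j : (0 < l <= K)%N -> (j < L)%N ->
    two_point_excess (g 0 j) ((c l)%:C%C *: g l j) <= 0.
  move=> lK jL; have [_ lK'] := andP lK.
  apply: (@two_point_excess_ulim U UU (fun n => G n 0 j) (fun n => (c l)%:C%C *: G n l j)
    _ _ (fun n => (n.+1%:R)^-1 * C)) => //.
  - exact: Gg.
  - by apply: ulimZ; exact: Gg.
  - by move=> n; exact: Gex.
  - move=> r r0; have rC : 0 < r / (C + 1) by rewrite divr_gt0// ltr_wpDl.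
    have [N hN] := invn_small rC; exists N => n /hN.
    rewrite ler_pdivlMr ?ltr_wpDl//; apply: le_trans.
    by rewrite ler_wpM2l ?invr_ge0// lerDl.
have /choice[phi hphi] : forall j, exists phi : dual X, rnorm phi <= 1 /\
    phi (g 0 j) = (rnorm (g 0 j))%:C%C.
  by move=> j; have [f f1 fE] := norming_functional (g 0 j); exists f.
have phi_le j x : rnorm (phi j x : R[i]) <= rnorm x.
  by rewrite (le_trans (rnorm_functional _ _))// ler_piMl ?rnorm_ge0//; exact: (hphi j).1.
(* As phi_j x = |x|, the parallelogram identity for scalars gives 2 |x|^2 + 2 |phi_j y|^2 <= |x +
   y|^2 + |x - y|^2 <= 2 |x|^2, so phi_j y = 0. *)
have kill l j : (0 < l <= K)%N -> (j < L)%N -> (phi j (g l j) : R[i]) = 0.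
  move=> lK jL; have := ex_le l j lK jL; rewrite /two_point_excess.
  set x := g 0 j; set y := _ *: g l j.
  have h1 : rnorm (phi j x + phi j y : R[i]) ^+ 2 <= rnorm (x + y) ^+ 2.
    by have := phi_le j (x + y); rewrite bopD => h; rewrite ler_pXn2r ?nnegrE ?rnorm_ge0.
  have h2 : rnorm (phi j x - phi j y : R[i]) ^+ 2 <= rnorm (x - y) ^+ 2.
    by have := phi_le j (x - y); rewrite bopB => h; rewrite ler_pXn2r ?nnegrE ?rnorm_ge0.
  have h3 : rnorm (phi j x : R[i]) = rnorm x.
    by rewrite (hphi j).2 rnorm_pos ?rnorm_ge0.
  have par (s t : R[i]) : rnorm (s + t) ^+ 2 + rnorm (s - t) ^+ 2 =
      2 * rnorm s ^+ 2 + 2 * rnorm t ^+ 2.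
    by rewrite !rnorm_sqrE; case: s t => [s1 s2] [t1 t2] /=; ring.
  move=> h4; have h5 := par (phi j x) (phi j y).
  have : rnorm (phi j y : R[i]) ^+ 2 <= 0 by rewrite h3 in h5; lra.
  move=> h6; have /eqP : rnorm (phi j y : R[i]) ^+ 2 = 0.
    by apply/eqP; rewrite eq_le h6 sqr_ge0.
  rewrite sqrf_eq0 rnorm_eq0 /y bopZ => /eqP/(congr1 (@rnorm R R[i]^o)).
  rewrite rnorm0 rnormZ => /eqP; rewrite mulf_eq0 => /orP[|/eqP/rnorm0_eq0//].
  by rewrite rnorm_pos ?(ltW (c0 l))// gt_eqF.
(* Where g_0 vanishes the excess is at least 2 |c_l g_l|^2, so g_l vanishes there as well. *)
have alt j : (j < L)%N -> (phi j (g 0 j) : R[i]) != 0 \/ forall l, (l <= K)%N -> g l j = 0.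
  move=> jL; have [g00|g0n] := eqVneq (g 0 j) 0; last first.
    by left; rewrite (hphi j).2 -rnorm_gt0 rnorm_pos ?rnorm_ge0// rnorm_gt0.
  right=> l lK; have [->//|l0] := posnP l.
  have := ex_le l j _ jL; rewrite l0 lK => /(_ isT).
  have := two_point_ge_r (g 0 j) ((c l)%:C%C *: g l j).
  rewrite /two_point_excess g00 rnorm0 expr0n mulr0 subr0 => h1 h2.
  have h3 : rnorm ((c l)%:C%C *: g l j) ^+ 2 <= 0 by lra.
  have /eqP : rnorm ((c l)%:C%C *: g l j) ^+ 2 = 0.
    by apply/eqP; rewrite eq_le h3 sqr_ge0.
  rewrite sqrf_eq0 rnorm_eq0 scaler_eq0 => /orP[|/eqP//].
  by rewrite -rnorm_eq0 rnorm_pos ?(ltW (c0 l))// gt_eqF.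
have mL : (m < L)%N by rewrite /L; lia.
have gm1 : rnorm (g 0 m) = 1.
  have h : (fun n => rnorm (G n 0 m)) @ U --> rnorm (g 0 m).
    by apply: ulim_rnorm; exact: Gg.
  have G1 n : rnorm (G n 0 m) = 1.
    rewrite /G /pos subrr addr0; apply: normalize_rnorm; exact: (hj n).1.
  apply/eqP; rewrite -subr_eq0 -normr_eq0 eq_le normr_ge0 andbT.
  apply/ler_addgt0Pr => e e0; have /cvgrPdist_le/(_ e e0)/filter_ex[n /=] := h.
  by rewrite G1 add0r.
have phi_lin j s x y : (phi j (s *: x + y) : R[i]) = s * phi j x + phi j y.
  by rewrite bopD bopZ.
have g_supp l j : (L <= j)%N -> g l j = 0 by rewrite /g ltnNge => ->.
have LK : (L * d <= K)%N by rewrite /K leq_addr.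
have mK : (2 ^ p <= K)%N by rewrite /K leq_addl.
(* At the centre phi_m (g_0 m) = |g_0 m| = 1, whereas [band_contra] makes it 0. *)
have := @band_contra R[i] X d b span_b L al be ga (fun j x => phi j x : R[i])
  al_lin be_lin ga_lin phi_lin K g g_supp g_rel kill p erefl (ltnSn _) LK mK alt.
rewrite -/m (hphi m).2 gm1 => /(congr1 (@rnorm R R[i])).
by rewrite rnorm0 rnorm_pos// => /eqP; rewrite oner_eq0.
Qed.

End finite_dimensional_case.

(** * Density of the open pseudospectrum *)

Section density.
Context {R : realType} (X : completeNormedModType R[i]) (A : 'L(ell2 X, ell2 X)).
Variables (alpha beta gamma : int -> 'L(X, X)).
Hypothesis A_tridiag : tridiagonal A alpha beta gamma.

Let cE : cauchy_complete (ell2 X).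
Proof. exact/ell2_cauchy_complete/completeNormedMod_cauchy_complete. Qed.

Lemma spec_open_dense (eps : R) : globevnik_property X -> 0 < eps ->
  forall l, Spec_closed eps A l -> forall r : R, 0 < r ->
  exists2 m, spec_open eps A m & rnorm (l - m) <= r.
Proof.
move=> globX eps0 l Al r r0; apply: contrapT => hn.
pose B := shift_op A l; pose M := eps^-1.
have M0 : 0 < M by rewrite invr_gt0.
(* By contradiction, the disc of radius r about l misses [spec_open eps A], so on it A - (l + z) has
   inverses of norm at most M. Outside the disc D z is arbitrary. *)
have /choice[D hD] : forall z, exists D : 'L(ell2 X, ell2 X), rnorm z <= r ->
    is_inverse (shift_op A (l + z)) D /\ rnorm D <= M.
  move=> z; have [zr|zr] := pselect (rnorm z <= r); last by exists 0.
  have h : bounded_below eps (shift_op A (l + z)).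
    apply/notin_spec_openP => // h; apply: hn; exists (l + z) => //.
    by rewrite opprD addNKr rnormN.
  by have [D BD DM] := bounded_below_invertible cE eps0 h; exists D.
have r00 : rnorm (0 : R[i]) <= r by rewrite rnorm0 ltW.
pose T := D 0.
have [BTinv TM] : is_inverse B T /\ rnorm T <= M.
  by have := hD 0 r00; rewrite addr0.
have BT x : B (T x) = x by exact: inverseVK BTinv.
have TB x : T (B x) = x by exact: inverseK BTinv.
have op_le (C : 'L(ell2 X, ell2 X)) x : rnorm C <= M -> rnorm (C x) <= M * rnorm x.
  by move=> CM; rewrite (le_trans (opnormP C x))// ler_wpM2r ?rnorm_ge0.
have T_le x : rnorm (T x) <= M * rnorm x by exact: op_le.
have D_le z x : rnorm z <= r -> rnorm (D z x) <= M * rnorm x.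
  by move=> zr; apply: op_le; exact: (hD z zr).2.
have D_eq z x : rnorm z <= r -> D z x = T x + z *: T (D z x).
  move=> zr; have [h _] := hD z zr.
  have e : shift_op A (l + z) (D z x) = x by exact: inverseVK h.
  rewrite -[LHS]TB -bopZ -bopD; congr (T _).
  rewrite -{2}e (shift_op_shift A l) (addrC l) addrK -/B.
  by rewrite subrK.
(* r' M <= 1 / 2 gives the condition r' M < 1 of [resolvent_averaging]. *)
pose r' := Num.min r (eps / 2).
have r'0 : 0 < r' by rewrite lt_min r0 divr_gt0.
have r'r : r' <= r by rewrite ge_min lexx.
have r'M : r' * M < 1.
  rewrite ltr_pdivrMr// mul1r (@le_lt_trans _ _ (eps / 2))//.
    by rewrite ge_min lexx orbT.
  by rewrite ltr_pdivrMr// ltr_pMr// ltr1n.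
pose c k := r' ^+ k / 2.
have c_gt0 k : 0 < c k by rewrite divr_gt0// exprn_gt0.
have T_avg k (s : R[i]) x : (0 < k)%N -> rnorm s <= 1 ->
    rnorm (T x + (s * (c k)%:C%C) *: iter k.+1 T x) <= M * rnorm x.
  move=> k0 s1.
  exact: (@resolvent_averaging R (ell2 X) T (fun z x => D z x) M r
    (ltW M0) T_le D_le D_eq k r' s x k0 r'0 r'r r'M s1).
(* As l belongs to [Spec_closed eps A], the norm of T is not below M; this supplies the
   near-maximisers. *)
have not_better M' : 0 < M' < M -> ~ (rnorm T <= M').
  move=> /andP[M'0 M'M] h.
  have : ~ Spec_closed eps A l; last by apply.
  apply/notin_Spec_closedP => //; first exact: ltW.
  exists M'^-1; first by rewrite -[eps]invrK ltf_pV2// posrE.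
  by apply: (@inverse_bounded_below _ _ _ _ T); rewrite ?invr_gt0// invrK.
have T_near M' : 0 < M' < M -> exists u, M' * rnorm u < rnorm (T u).
  move=> hM'; apply: contrapT => /forallNP h; apply: (not_better M' hM').
  rewrite rnorm_bop; apply: opnorm_le => x x1.
  have /negP := h x; rewrite -leNgt => /le_trans; apply.
  by rewrite ler_piMr// ltW//; case/andP: hM'.
(* T is bounded below by b, since u = B (T u); the added 1 keeps the denominator positive. *)
pose b : R := (rnorm B + 1)^-1.
have B1 : 0 < rnorm B + 1 by rewrite ltr_wpDl ?rnorm_ge0.
have b0 : 0 < b by rewrite invr_gt0.
case: globX => [[d [e span_e]]|cuc|cuc].
- have [ba bb bc AE] := A_tridiag.
  pose Cb : R := seq_norm alpha + (seq_norm beta + rnorm l) + seq_norm gamma.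
  have sa := seq_norm_ge0 ba; have sb := seq_norm_ge0 bb; have sc := seq_norm_ge0 bc.
  have l0 := rnorm_ge0 l.
  have op_ub (a : int -> 'L(X, X)) i v : bounded_seq a ->
      rnorm (a i v) <= seq_norm a * rnorm v.
    move=> h; rewrite (le_trans (opnormP _ _))// ler_wpM2r ?rnorm_ge0//.
    exact: seq_norm_ub.
  apply: (@finite_dimensional_contra R X d e span_e T B M Cb c
    (fun i v => alpha i v) (fun i v => beta i v - l *: v) (fun i v => gamma i v)) => //.
  + by move=> i a u v; rewrite bopD bopZ.
  + move=> i a u v; rewrite bopD bopZ scalerBr scalerDr !scalerA [l * a]mulrC.
    by rewrite opprD addrACA.
  + by move=> i a u v; rewrite bopD bopZ.
  + move=> i v; rewrite (le_trans (op_ub _ _ _ ba))// ler_wpM2r ?rnorm_ge0//.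
    by rewrite /Cb; lra.
  + move=> i v; rewrite (le_trans (rnormD _ _))// rnormN rnormZ.
    rewrite (@le_trans _ _ ((seq_norm beta + rnorm l) * rnorm v))//.
      by rewrite mulrDl lerD2r op_ub.
    by rewrite ler_wpM2r ?rnorm_ge0// /Cb; lra.
  + move=> i v; rewrite (le_trans (op_ub _ _ _ bc))// ler_wpM2r ?rnorm_ge0//.
    by rewrite /Cb; lra.
  + move=> x i; rewrite /B shift_opE ell2B ell2Z AE.
    by rewrite -!addrA; congr (_ + (_ + _)); rewrite addrC.
- apply: (@excess_controlled_contra R (ell2 X) T M (c 1%N) b) => //.
  + exact/excess_controlled_ell2/complex_uniformly_convex_excess.
  + move=> u; rewrite ler_pdivrMl// -{1}[u]BT (le_trans (opnormP B _))//.
    by rewrite ler_wpM2r ?rnorm_ge0// lerDl.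
  + by move=> z u z1; exact: (T_avg 1%N).
(* When [dual X] is the convex space, the argument runs for the adjoint of T on [dual (ell2 X)],
   embedded isometrically in [ell2 (dual X)]. *)
- apply: (@excess_controlled_contra R (dual (ell2 X)) (adjoint T) M (c 1%N) b) => //.
  + apply: (@excess_controlled_isometry R _ (ell2 (dual X)) (@dual_seq R X)).
    * exact: dual_seq_norm.
    * by move=> a phi psi; apply: ell2_ext => j; apply: bop_ext.
    * exact/excess_controlled_ell2/complex_uniformly_convex_excess.
  + move=> phi; rewrite ler_pdivrMl//.
    have e : phi = comp_bop (adjoint T phi) B by apply: bop_ext => x /=; rewrite TB.
    rewrite {1}e (le_trans (opnorm_comp _ _))// mulrC.
    by rewrite ler_wpM2r ?opnorm_ge0// lerDl.
  + move=> z phi z1; rewrite [leLHS]rnorm_bop; apply: opnorm_le => x x1.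
    rewrite dualD dualZ !adjointE -bopZ -bopD.
    rewrite (le_trans (rnorm_functional _ _))// mulrC ler_wpM2r ?rnorm_ge0//.
    rewrite (le_trans (T_avg 1%N z x isT z1))// ler_piMr// ltW//.
  + move=> M' hM'; apply: contrapT => /forallNP h; apply: (not_better M' hM').
    rewrite rnorm_bop; apply: opnorm_le => x x1.
    have [phi phi1 phiE] := norming_functional (T x).
    have -> : rnorm (T x) = rnorm (adjoint T phi x : R[i]).
      by rewrite adjointE phiE rnorm_pos ?rnorm_ge0.
    have M'0 : 0 <= M' by rewrite ltW//; case/andP: hM'.
    rewrite (le_trans (rnorm_functional _ _))//.
    have /negP := h phi; rewrite -leNgt => hphi.
    have h1 : rnorm (adjoint T phi) <= M'.
      by rewrite (le_trans hphi)// ler_piMr.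
    by rewrite (le_trans _ h1)// ler_piMr ?rnorm_ge0.
Qed.

End density.

Theorem theorem1p2 (R : realType) (X : completeNormedModType R[i])
    (A : 'L(ell2 X, ell2 X)) (alpha beta gamma : int -> 'L(X, X))
    (A_tridiag : tridiagonal A alpha beta gamma) :
  [/\ forall eps : R, 0 <= eps ->
        (fun n : nat =>
           hausdorff_dist (Gamma_closed n (eps + eps'' alpha gamma n) A)
                          (Spec_closed eps A)) @ \oo --> 0%E,
      (fun n : nat =>
         hausdorff_dist (Gamma_closed n (eps'' alpha gamma n) A)
                        (spectrum A)) @ \oo --> 0%E
    & globevnik_property X ->
      forall eps : R, 0 < eps ->
        (fun n : nat =>
           hausdorff_dist (gamma_open n (eps + eps'' alpha gamma n) A)
                          (spec_open eps A)) @ \oo --> 0%E ].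
Proof.
split; first by move=> eps eps0; exact: closed_convergence A_tridiag eps eps0.
  have := closed_convergence A_tridiag (lexx 0).
  by rewrite /Spec_closed eqxx; under eq_fun do rewrite add0r.
move=> globX eps eps0; apply: (open_convergence A_tridiag eps0).
exact: (spec_open_dense A_tridiag globX eps0).
Qed.
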